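(* Let $n,k\ge 1$ be integers and let $R$ be a Hermitian symmetric function on $\mathbb{C}^n$ such that $R\in\mathcal{P}_k(\mathbb{C}^n)$. Then either $N_-(R)=0$ or $N_+(R)\ge k+1$.
   Context: For a complex manifold $M$ with complex conjugate manifold $M'$, a holomorphic function $R:M\times M'\to\mathbb{C}$ (written $R(z,\overline w)$ for $z,w\in M$, so holomorphic in $z$ and antiholomorphic in $w$) is called Hermitian symmetric if $R(z,\overline w)=\overline{R(w,\overline z)}$ for all $z,w\in M$. For short one says ''Hermitian symmetric function on $M$''. For a positive integer $N$, $\mathcal{P}_N(M)$ is the set of Hermitian symmetric $R$ such that $\sum_{i,j=1}^N R(z_i,\overline{z_j})a_i\overline{a_j}\ge 0$ for all $(z_1,\dots,z_N)\in M^N$ and all $a\in\mathbb{C}^N$. A Hermitian symmetric function $R$ on $\mathbb{C}^n$ has a Taylor expansion (at the origin) $R(z,\overline z)=\sum_{a,b}c_{ab}z^a\overline z^b$, over multi-indices $a,b$. $N_+(R)$ and $N_-(R)$ denote the number of positive and negative eigenvalues, respectively, of the (perhaps infinite) Hermitian matrix $(c_{ab})$; the value infinity is allowed. For an infinite matrix, the number of positive (negative) eigenvalues is taken to be the supremum, over finite principal submatrices, of the number of positive (negative) eigenvalues counted with multiplicity. *)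

(* Defs.v *)
From HB Require Import structures.
From mathcomp Require Import all_boot all_order all_algebra.
From mathcomp Require Import all_classical all_reals all_analysis.
From mathcomp Require Import complex.

Set Implicit Arguments.
Unset Strict Implicit.
Unset Printing Implicit Defensive.

Import Order.TTheory GRing.Theory Num.Theory.
Import numFieldNormedType.Exports.

Local Open Scope classical_set_scope.
Local Open Scope ring_scope.

(* R[i] packaged as a numClosedFieldType: numFieldNormedType then makes it a
   normed module over itself, which it does not do for the bare type R[i]. *)
Definition Cx (R : realType) : numClosedFieldType := R[i].

(* The conjugate manifold of C^n is identified with C^n through
   w |-> conj_vec w.  A function on the product is thus a function F of
   two independent variables of C^n, and R(z, \bar w) is F z (conj_vec w). *)
Definition conj_vec (R : realType) (n : nat) (z : 'rV[Cx R]_n) : 'rV[Cx R]_n :=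
  map_mx Num.conj z.

(* The scalars are complex, so differentiability is complex (Frechet)
   differentiability, jointly in both variables. *)
Definition holomorphic2 (R : realType) (n : nat)
    (F : 'rV[Cx R]_n -> 'rV[Cx R]_n -> Cx R) : Prop :=
  forall p : 'rV[Cx R]_n * 'rV[Cx R]_n,
    differentiable (fun q : 'rV[Cx R]_n * 'rV[Cx R]_n => F q.1 q.2) p.

Definition hermitian_symmetric (R : realType) (n : nat)
    (F : 'rV[Cx R]_n -> 'rV[Cx R]_n -> Cx R) : Prop :=
  holomorphic2 F /\
  forall z w : 'rV[Cx R]_n, F z (conj_vec w) = Num.conj (F w (conj_vec z)).

(* The class P_N(C^n).  In a numClosedFieldType, 0 <= x means that x
   is real and nonnegative. *)
Definition psd_class (R : realType) (n N : nat)
    (F : 'rV[Cx R]_n -> 'rV[Cx R]_n -> Cx R) : Prop :=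
  hermitian_symmetric F /\
  forall (z : 'I_N -> 'rV[Cx R]_n) (a : 'I_N -> Cx R),
    0 <= \sum_(i < N) \sum_(j < N)
           F (z i) (conj_vec (z j)) * a i * Num.conj (a j).

Definition multi_index (n : nat) := {ffun 'I_n -> nat}.

Definition mfact (n : nat) (a : multi_index n) : nat :=
  (\prod_(j < n) (a j)`!)%N.

Definition partial1 (R : realType) (n : nat) (j : 'I_n)
    (F : 'rV[Cx R]_n -> 'rV[Cx R]_n -> Cx R) :
    'rV[Cx R]_n -> 'rV[Cx R]_n -> Cx R :=
  fun z w => 'D_(delta_mx 0 j) (fun x : 'rV[Cx R]_n => F x w) z.

Definition partial2 (R : realType) (n : nat) (j : 'I_n)
    (F : 'rV[Cx R]_n -> 'rV[Cx R]_n -> Cx R) :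
    'rV[Cx R]_n -> 'rV[Cx R]_n -> Cx R :=
  fun z w => 'D_(delta_mx 0 j) (fun y : 'rV[Cx R]_n => F z y) w.

(* d^a/dz^a and d^b/dw^b, the coordinates being taken in a fixed order
   (immaterial for holomorphic functions). *)
Definition mpartial1 (R : realType) (n : nat) (a : multi_index n)
    (F : 'rV[Cx R]_n -> 'rV[Cx R]_n -> Cx R) :
    'rV[Cx R]_n -> 'rV[Cx R]_n -> Cx R :=
  foldr (fun j G => iter (a j) (partial1 j) G) F (enum 'I_n).

Definition mpartial2 (R : realType) (n : nat) (b : multi_index n)
    (F : 'rV[Cx R]_n -> 'rV[Cx R]_n -> Cx R) :
    'rV[Cx R]_n -> 'rV[Cx R]_n -> Cx R :=
  foldr (fun j G => iter (b j) (partial2 j) G) F (enum 'I_n).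

(* The coefficient c_{ab} of z^a \bar z^b in the expansion of R(z, \bar z)
   at the origin, i.e. of z^a w^b in that of F z w. *)
Definition taylor_coef (R : realType) (n : nat)
    (F : 'rV[Cx R]_n -> 'rV[Cx R]_n -> Cx R) (a b : multi_index n) : Cx R :=
  mpartial1 a (mpartial2 b F) 0 0 / (mfact a * mfact b)%N%:R.

(* Eigenvalues, repeated according to their algebraic multiplicity. *)
Definition eigenvalues (R : realType) (m : nat) (A : 'M[Cx R]_m) : seq (Cx R) :=
  sval (closed_field_poly_normal (char_poly A)).

Definition num_pos_eigen (R : realType) (m : nat) (A : 'M[Cx R]_m) : nat :=
  count (fun x : Cx R => 0 < x) (eigenvalues A).

Definition num_neg_eigen (R : realType) (m : nat) (A : 'M[Cx R]_m) : nat :=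
  count (fun x : Cx R => x < 0) (eigenvalues A).

(* For an infinite matrix c: suprema, possibly +oo, over the finite principal
   submatrices, indexed here by the injective families s of indices. *)
Definition num_pos (R : realType) (I : Type) (c : I -> I -> Cx R) : \bar R :=
  ereal_sup [set x : \bar R | exists (m : nat) (s : 'I_m -> I), injective s /\
    x = (num_pos_eigen (\matrix_(i < m, j < m) c (s i) (s j)))%:R%:E].

Definition num_neg (R : realType) (I : Type) (c : I -> I -> Cx R) : \bar R :=
  ereal_sup [set x : \bar R | exists (m : nat) (s : 'I_m -> I), injective s /\
    x = (num_neg_eigen (\matrix_(i < m, j < m) c (s i) (s j)))%:R%:E].

Definition N_plus (R : realType) (n : nat)
    (F : 'rV[Cx R]_n -> 'rV[Cx R]_n -> Cx R) : \bar R :=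
  num_pos (taylor_coef F).

Definition N_minus (R : realType) (n : nat)
    (F : 'rV[Cx R]_n -> 'rV[Cx R]_n -> Cx R) : \bar R :=
  num_neg (taylor_coef F).

(* Main.v *)
Require Import Defs.
From mathcomp Require Import all_boot all_order all_algebra.
From mathcomp Require Import all_classical all_reals all_analysis.
From mathcomp Require Import complex ring lra zify.

Set Implicit Arguments.
Unset Strict Implicit.
Unset Printing Implicit Defensive.

Import Order.TTheory GRing.Theory Num.Theory.
Import numFieldNormedType.Exports.

Local Open Scope classical_set_scope.
Local Open Scope ring_scope.

(** Write K(z, w) for R(z, \bar w). Point masses and Taylor functionals at the
    origin see the same Hermitian form: for a finitely supported measure
    la = sum c_p delta_p put K(la, mu) = sum c_p \bar c_q K(p, q). If some
    m-dimensional space of measures is positive definite for this form, then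
    replacing each evaluation by a long Taylor polynomial at the origin keeps it
    positive definite, and a finite principal submatrix of the matrix of Taylor
    coefficients gets m positive eigenvalues ([N_plus_ge]). So assume that no
    (k+1)-dimensional space of measures is positive definite; it has to be shown
    that the Taylor matrix is positive semidefinite.

    This is done by induction on k with Schur complements ([finite_rank]). If
    K(z, z) > 0 for some z, split off the rank one kernel f(z) \bar{f(w)} built
    from the column of z; the remainder K' is again Hermitian and entire, it is in
    the class P_{k-1}, and it has one positive square less. The induction ends at
    k = 1, where K(z, z) >= 0 for all z and K has at most one positive square
    ([rank_one_kernel]). There the remainder S of K after splitting off a positive
    measure la is negative semidefinite, and K(z, z) >= 0 forces
    |S(z, z)| <= |f(z)|^2; the Cauchy-Schwarz inequality gives
    |S(z, w)| <= |f(z)| |f(w)|. For fixed w the quotient S(., w) / f is bounded,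
    so by Riemann and Liouville S(., w) is a multiple of f ([entire_quotient]).
    Since S(., w) integrates to 0 against la and f does not, S = 0. Hence K is a
    finite sum of kernels f_i(z) \bar{f_i(w)} with entire f_i, its Taylor matrix is
    a Gram matrix, and there is no negative eigenvalue ([num_neg_eigen_rank]).

    The argument needs the basic theory of entire functions, developed from
    complex differentiability alone. Its root is the maximum principle at the
    centre of a disc ([center_bound]), obtained from a version of Goursat's
    theorem for finite sums over polar grids, so that no integral occurs. It
    yields the Cauchy estimate, a uniform second order remainder, the fact that
    derivatives are again entire, and Taylor expansions, first in one variable by
    iterating the difference quotient at 0, then in several variables by
    expanding one coordinate at a time ([taylor_ops_close], [taylor_ops_sum]). In
    several variables a function is called entire when it is bounded on balls and
    complex differentiable along every line; this class is stable under
    directional derivatives, whereas Frechet differentiability is used once, to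
    see that R belongs to it ([differentiable_entire]). *)

(** * The modulus as a real number *)

Section Modulus.
Variable R : realType.
Local Notation C := (Cx R).
Implicit Types (x y z : C).

Definition ofR (a : R) : C := Complex a 0.
(** The norm of [Cx R] takes its values in [Cx R], whose order is partial; the
    estimates below are made with its real part. *)
Definition nc (z : C) : R := complex.Re (`|z| : R[i]).

Lemma ncE z : `|z| = ofR (nc z).
Proof. by rewrite /nc /ofR (normc_def (z : R[i])). Qed.

Lemma ofR_le a b : (ofR a <= ofR b) = (a <= b).
Proof. exact: lecR. Qed.
Lemma ofR_lt a b : (ofR a < ofR b) = (a < b).
Proof. exact: ltcR. Qed.
Lemma ofRD a b : ofR (a + b) = ofR a + ofR b.
Proof. exact: (raddfD (real_complex R)). Qed.
Lemma ofRN a : ofR (- a) = - ofR a.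
Proof. exact: (raddfN (real_complex R)). Qed.
Lemma ofRB a b : ofR (a - b) = ofR a - ofR b.
Proof. by rewrite ofRD ofRN. Qed.
Lemma ofRM a b : ofR (a * b) = ofR a * ofR b.
Proof. exact: (rmorphM (real_complex R)). Qed.
Lemma ofR0 : ofR 0 = 0. Proof. by []. Qed.
Lemma ofR1 : ofR 1 = 1. Proof. by []. Qed.
Lemma ofR_nat n : ofR n%:R = n%:R.
Proof. exact: (rmorph_nat (real_complex R)). Qed.
Lemma ofRV a : ofR a^-1 = (ofR a)^-1.
Proof. exact: (fmorphV (real_complex R)). Qed.
Lemma ofRX a n : ofR (a ^+ n) = ofR a ^+ n.
Proof. exact: (rmorphXn (real_complex R)). Qed.
Lemma ofR_inj : injective ofR.
Proof. exact: complexI. Qed.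

Lemma nc_ge0 z : 0 <= nc z.
Proof. by rewrite -ofR_le -ncE normr_ge0. Qed.
Lemma ncD x y : nc (x + y) <= nc x + nc y.
Proof. by rewrite -ofR_le ofRD -!ncE ler_normD. Qed.
Lemma ncM x y : nc (x * y) = nc x * nc y.
Proof. by apply: ofR_inj; rewrite ofRM -!ncE normrM. Qed.
Lemma ncN x : nc (- x) = nc x.
Proof. by apply: ofR_inj; rewrite -!ncE normrN. Qed.
Lemma ncC x y : nc (x - y) = nc (y - x).
Proof. by rewrite -ncN opprB. Qed.
Lemma nc0 : nc 0 = 0.
Proof. by apply: ofR_inj; rewrite -!ncE normr0. Qed.
Lemma nc1 : nc 1 = 1.
Proof. by apply: ofR_inj; rewrite -!ncE normr1. Qed.
Lemma nc_eq0 z : (nc z == 0) = (z == 0).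
Proof. by rewrite -(inj_eq ofR_inj) -ncE ofR0 normr_eq0. Qed.
Lemma nc_gt0 z : (0 < nc z) = (z != 0).
Proof. by rewrite lt_neqAle nc_ge0 andbT eq_sym nc_eq0. Qed.
Lemma ncV z : nc z^-1 = (nc z)^-1.
Proof. by apply: ofR_inj; rewrite ofRV -!ncE normfV. Qed.
Lemma ncX z n : nc (z ^+ n) = nc z ^+ n.
Proof. by apply: ofR_inj; rewrite ofRX -!ncE normrX. Qed.
Lemma nc_ofR a : nc (ofR a) = `|a|.
Proof.
apply: ofR_inj; rewrite -ncE; have [a0|a0] := ger0P a.
  by rewrite ger0_norm // -ofR0 ofR_le.
by rewrite ltr0_norm ?ofRN // -ofR0 ofR_lt.
Qed.
Lemma nc_nat n : nc n%:R = n%:R.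
Proof. by rewrite -ofR_nat nc_ofR ger0_norm. Qed.
Lemma nc_conj z : nc (Num.conj z) = nc z.
Proof. by apply: ofR_inj; rewrite -!ncE norm_conjC. Qed.
Lemma ncB x y : nc (x - y) <= nc x + nc y.
Proof. by rewrite (le_trans (ncD _ _)) // ncN. Qed.
Lemma nc_tri x y z : nc (x - z) <= nc (x - y) + nc (y - z).
Proof. by rewrite (_ : x - z = (x - y) + (y - z)) ?ncD //; ring. Qed.
Lemma nc_dist x y : nc x <= nc y + nc (x - y).
Proof. by rewrite [in leLHS](_ : x = y + (x - y)) ?ncD //; ring. Qed.
Lemma nc_sum (I : Type) (r : seq I) (P : pred I) (F : I -> C) :
  nc (\sum_(i <- r | P i) F i) <= \sum_(i <- r | P i) nc (F i).
Proof.
elim/big_rec2: _ => [|i y1 y2 _ h]; first by rewrite nc0.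
by rewrite (le_trans (ncD _ _)) // lerD2l.
Qed.

Lemma normC_le z (a : R) : (`|z| <= ofR a) = (nc z <= a).
Proof. by rewrite ncE ofR_le. Qed.
Lemma normC_lt z (a : R) : (`|z| < ofR a) = (nc z < a).
Proof. by rewrite ncE ofR_lt. Qed.

Lemma nc_Re z : `|complex.Re (z : R[i])| <= nc z.
Proof.
rewrite /nc (normc_def (z : R[i])) /= -sqrtr_sqr ler_wsqrtr // lerDl sqr_ge0 //.
Qed.
Lemma nc_Im z : `|complex.Im (z : R[i])| <= nc z.
Proof.
rewrite /nc (normc_def (z : R[i])) /= -sqrtr_sqr ler_wsqrtr // lerDr sqr_ge0 //.
Qed.
Lemma nc_cplx (a b : R) : nc (Complex a b) <= `|a| + `|b|.
Proof.
have -> : (Complex a b : C) = ofR a + (Complex 0 1 : C) * ofR b.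
  exact: (complexE (Complex a b)).
apply: le_trans (ncD _ _) _; rewrite ncM !nc_ofR.
have -> : nc (Complex 0 1) = 1.
  by rewrite /nc (normc_def (Complex 0 1 : R[i])) /= expr0n add0r expr1n sqrtr1.
by rewrite mul1r.
Qed.

Lemma nc_eps z : (forall e : R, 0 < e -> nc z <= e) -> z = 0.
Proof.
move=> h; apply/eqP; rewrite -nc_eq0; apply/eqP/le_anti; rewrite nc_ge0 andbT.
by apply/ler_addgt0Pl => e e0; rewrite addr0 h.
Qed.

End Modulus.

(** * Goursat's theorem for grid sums *)

Section Goursat.
Variable R : realType.
Local Notation C := (Cx R).

(** A discrete contour integral. The summand is the trapezoidal rule around the
    grid cell with lower corner (a, b), with weight [al] on the edges in the first
    direction and [be] on those in the second. *)
Definition cell_sum (al be : C) (u : nat -> nat -> C) (p q : nat) : C :=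
  \sum_(a < p) \sum_(b < q)
    (al * (u a b + u a.+1 b - u a b.+1 - u a.+1 b.+1)
     + be * (u a.+1 b + u a.+1 b.+1 - u a b - u a b.+1)).

(** The edges interior to the rectangle are run through in both directions. *)
Lemma cell_sum_boundary al be u p q :
  cell_sum al be u p q =
    al * \sum_(a < p) (u a 0 + u a.+1 0 - u a q - u a.+1 q) +
    be * \sum_(b < q) (u p b + u p b.+1 - u 0 b - u 0 b.+1).
Proof.
rewrite /cell_sum.
under eq_bigr => a _ do rewrite big_split -!mulr_sumr /=.
rewrite big_split -!mulr_sumr /=; congr (_ * _ + _ * _).
  apply: eq_bigr => a _.
  have -> : u a 0 + u a.+1 0 - u a q - u a.+1 q =
     - ((u a q + u a.+1 q) - (u a 0 + u a.+1 0)) by ring.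
  rewrite -(telescope_sumr (fun b => u a b + u a.+1 b)) // -sumrN big_mkord.
  by apply: eq_bigr => b _; ring.
rewrite exchange_big /=; apply: eq_bigr => b _.
have -> : u p b + u p b.+1 - u 0 b - u 0 b.+1 =
     (u p b + u p b.+1) - (u 0 b + u 0 b.+1) by ring.
rewrite -(telescope_sumr (fun a => u a b + u a b.+1)) // big_mkord.
by apply: eq_bigr => a _; ring.
Qed.

(** Only the boundary counts, so the bound grows like the side [p] and not like
    the number of cells. *)
Lemma cell_sum_bound al be (k eta : R) (u : nat -> nat -> C) p :
  nc al <= k -> nc be <= k ->
  (forall a b, (a <= p)%N -> (b <= p)%N -> nc (u a b) <= eta) ->
  nc (cell_sum al be u p p) <= 8 * p%:R * k * eta.
Proof.
move=> hal hbe hu.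
have eta0 : 0 <= eta by apply: le_trans (nc_ge0 _) (hu 0 0 _ _).
have k0 : 0 <= k by apply: le_trans (nc_ge0 _) hal.
have h4 (x1 x2 x3 x4 : C) : nc x1 <= eta -> nc x2 <= eta -> nc x3 <= eta ->
   nc x4 <= eta -> nc (x1 + x2 - x3 - x4) <= 4 * eta.
  move=> h1 h2 h3 h4; have := ncB (x1 + x2 - x3) x4.
  have := ncB (x1 + x2) x3; have := ncD x1 x2; lra.
have hs (f : 'I_p -> C) : (forall i, nc (f i) <= 4 * eta) ->
   nc (\sum_i f i) <= p%:R * (4 * eta).
  move=> hf; apply: le_trans (nc_sum _ _ _) _.
  apply: (@le_trans _ _ (\sum_(i < p) 4 * eta)); first exact: ler_sum.
  by rewrite sumr_const card_ord -[X in X <= _]mulr_natl.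
rewrite cell_sum_boundary; apply: le_trans (ncD _ _) _; rewrite !ncM.
have -> : 8 * p%:R * k * eta = k * (p%:R * (4 * eta)) + k * (p%:R * (4 * eta)).
  by ring.
apply: lerD; apply: ler_pM; rewrite ?nc_ge0 //; apply: hs => i; apply: h4;
  apply: hu => //; have := ltn_ord i; lia.
Qed.

Lemma cell_sum_sub al be u v p q :
  cell_sum al be (fun a b => u a b - v a b) p q = cell_sum al be u p q - cell_sum al be v p q.
Proof.
rewrite /cell_sum -sumrB; apply: eq_bigr => a _.
by rewrite -sumrB; apply: eq_bigr => b _; ring.
Qed.

Lemma cell_sum_affine al be (e : nat -> nat -> C) A B p q :
  (forall a b, al * (e a b + e a.+1 b - e a b.+1 - e a.+1 b.+1)
     + be * (e a.+1 b + e a.+1 b.+1 - e a b - e a b.+1) = 0) ->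
  cell_sum al be (fun a b => A + B * e a b) p q = 0.
Proof.
move=> he; apply: big1 => a _; apply: big1 => b _.
by rewrite -[RHS](mulr0 B) -(he a b); ring.
Qed.

(** Completeness, for families of intervals that meet pairwise. *)
Lemma interval_point (l r : nat -> R) : (forall a b, l a <= r b) ->
  exists x : R, forall j, l j <= x <= r j.
Proof.
move=> lr; exists (sup (range l)) => j; apply/andP; split.
  apply: ub_le_sup; last by exists j.
  by exists (r 0) => _ [a _ <-]; exact: lr.
apply: ge_sup; first by exists (l 0), 0.
by move=> _ [a _ <-]; exact: lr.
Qed.

Lemma nested_dyadic (i : nat -> nat) :
  (forall j, i j.+1 = (i j).*2 \/ i j.+1 = (i j).*2.+1) ->
  exists x : R, forall j, (i j)%:R / 2 ^+ j <= x <= (i j).+1%:R / 2 ^+ j.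
Proof.
move=> hi.
pose l j : R := (i j)%:R / 2 ^+ j; pose r j : R := (i j).+1%:R / 2 ^+ j.
have p2 j : (0 : R) < 2 ^+ j by rewrite exprn_gt0.
have lS j : l j <= l j.+1.
  rewrite /l exprS ler_pdivrMr // mulrAC ler_pdivlMr ?mulr_gt0 //.
  rewrite mulrCA mulrA ler_pM2r // -natrM ler_nat; case: (hi j) => ->; lia.
have rS j : r j.+1 <= r j.
  rewrite /r exprS ler_pdivrMr ?mulr_gt0 // mulrAC ler_pdivlMr //.
  rewrite [leRHS]mulrA ler_pM2r // -natrM ler_nat; case: (hi j) => ->; lia.
have lr j : l j <= r j by rewrite ler_pM2r ?invr_gt0 // ler_nat.
have lm a b : (a <= b)%N -> l a <= l b.
  by move=> /subnK <-; elim: (b - a)%N => // c ih; rewrite addSn (le_trans ih).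
have rm a b : (a <= b)%N -> r b <= r a.
  by move=> /subnK <-; elim: (b - a)%N => // c ih; rewrite addSn (le_trans (rS _)).
apply: (@interval_point l r) => a b.
have [ab|ba] := leqP a b; first by rewrite (le_trans (lm _ _ ab)).
by rewrite (le_trans (lr a)) // rm // ltnW.
Qed.

Variables (h : R -> R -> C) (al be : nat -> C) (e : R -> R -> C) (k : R).

Definition node (g : R -> R -> C) m i0 k0 (a b : nat) : C :=
  g ((i0 + a)%:R / 2 ^+ m) ((k0 + b)%:R / 2 ^+ m).

(** The contour sum at level j + n around the dyadic square of side 2^-j with
    lower corner (i0, k0) / 2^j. *)
Definition block_sum n j i0 k0 : C :=
  cell_sum (al (j + n)) (be (j + n))
    (node h (j + n) (i0 * 2 ^ n) (k0 * 2 ^ n)) (2 ^ n) (2 ^ n).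

Lemma block_sumS n j i0 k0 : block_sum n.+1 j i0 k0 =
  block_sum n j.+1 i0.*2 k0.*2 + block_sum n j.+1 i0.*2 k0.*2.+1
  + block_sum n j.+1 i0.*2.+1 k0.*2 + block_sum n j.+1 i0.*2.+1 k0.*2.+1.
Proof.
rewrite /block_sum addSnnS.
have hsplit (f : nat -> nat -> C) i1 k1 :
  \sum_(a < 2 ^ n.+1) \sum_(b < 2 ^ n.+1) f (i1 * 2 ^ n.+1 + a)%N (k1 * 2 ^ n.+1 + b)%N =
  \sum_(a < 2 ^ n) \sum_(b < 2 ^ n) f (i1.*2 * 2 ^ n + a)%N (k1.*2 * 2 ^ n + b)%N
  + \sum_(a < 2 ^ n) \sum_(b < 2 ^ n) f (i1.*2 * 2 ^ n + a)%N (k1.*2.+1 * 2 ^ n + b)%N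
  + \sum_(a < 2 ^ n) \sum_(b < 2 ^ n) f (i1.*2.+1 * 2 ^ n + a)%N (k1.*2 * 2 ^ n + b)%N
  + \sum_(a < 2 ^ n) \sum_(b < 2 ^ n) f (i1.*2.+1 * 2 ^ n + a)%N (k1.*2.+1 * 2 ^ n + b)%N.
  have h1 (f1 : nat -> C) i2 : \sum_(a < 2 ^ n.+1) f1 (i2 * 2 ^ n.+1 + a)%N =
    \sum_(a < 2 ^ n) f1 (i2.*2 * 2 ^ n + a)%N
    + \sum_(a < 2 ^ n) f1 (i2.*2.+1 * 2 ^ n + a)%N.
    rewrite expnS mul2n -addnn big_split_ord /=; congr (_ + _).
      by apply: eq_bigr => a _; congr f1; lia.
    by apply: eq_bigr => a _; congr f1; lia.
  under eq_bigr => a _ do rewrite (h1 (fun b => f _ b)).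
  rewrite big_split /=.
  rewrite (h1 (fun a => \sum_(b < 2 ^ n) f a (k1.*2 * 2 ^ n + b)%N)).
  rewrite (h1 (fun a => \sum_(b < 2 ^ n) f a (k1.*2.+1 * 2 ^ n + b)%N)).
  by ring.
pose g m a b := h (a%:R / 2 ^+ m) (b%:R / 2 ^+ m).
pose F a b := al (j + n.+1)%N * (g (j + n.+1)%N a b + g (j + n.+1)%N a.+1 b
    - g (j + n.+1)%N a b.+1 - g (j + n.+1)%N a.+1 b.+1)
   + be (j + n.+1)%N * (g (j + n.+1)%N a.+1 b + g (j + n.+1)%N a.+1 b.+1
    - g (j + n.+1)%N a b - g (j + n.+1)%N a b.+1).
have hF (i1 k1 p : nat) :
  \sum_(a < p) \sum_(b < p) F (i1 + a)%N (k1 + b)%N =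
  cell_sum (al (j + n.+1)%N) (be (j + n.+1)%N) (node h (j + n.+1)%N i1 k1) p p.
  apply: eq_bigr => a _; apply: eq_bigr => b _.
  by rewrite /F /g /node !addnS.
by rewrite -!hF hsplit.
Qed.

Hypothesis hal : forall m, (2 <= m)%N -> nc (al m) <= k / 2 ^+ m.
Hypothesis hbe : forall m, (2 <= m)%N -> nc (be m) <= k / 2 ^+ m.
Hypothesis he : forall m i0 k0 a b, (2 <= m)%N ->
  al m * (node e m i0 k0 a b + node e m i0 k0 a.+1 b
    - node e m i0 k0 a b.+1 - node e m i0 k0 a.+1 b.+1)
  + be m * (node e m i0 k0 a.+1 b + node e m i0 k0 a.+1 b.+1
    - node e m i0 k0 a b - node e m i0 k0 a b.+1) = 0.
Hypothesis hloc : forall (x0 y0 ep : R), 0 < ep -> exists2 d : R, 0 < d &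
  exists A B : C, forall x y t : R, t <= d -> `|x - x0| <= t -> `|y - y0| <= t ->
    nc (h x y - (A + B * e x y)) <= ep * t.

(** The contour sums around a square of side 2^-j are eventually small compared
    with its area 4^-j. *)
Definition good (ep : R) j (i : nat * nat) :=
  exists N, forall n, (N <= n)%N -> nc (block_sum n j i.1 i.2) <= ep / 4 ^+ j.

Lemma goodS (ep : R) j i k0 :
  good ep j.+1 (i.*2, k0.*2) -> good ep j.+1 (i.*2, k0.*2.+1) ->
  good ep j.+1 (i.*2.+1, k0.*2) -> good ep j.+1 (i.*2.+1, k0.*2.+1) ->
  good ep j (i, k0).
Proof.
move=> [N1 h1] [N2 h2] [N3 h3] [N4 h4].
exists (N1 + N2 + N3 + N4).+1 => -[//|n hn] /=; rewrite block_sumS.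
have /= := h1 n; have /= := h2 n; have /= := h3 n; have /= := h4 n.
have -> : ep / 4 ^+ j = 4 * (ep / 4 ^+ j.+1).
  by rewrite exprS; field; rewrite expf_neq0.
move: (ep / _) => t.
move=> /(_ ltac:(lia)) g4 /(_ ltac:(lia)) g3 /(_ ltac:(lia)) g2 /(_ ltac:(lia)) g1.
apply: le_trans (ncD _ _) _; apply: le_trans (lerD (ncD _ _) (lexx _)) _.
apply: le_trans (lerD (lerD (ncD _ _) (lexx _)) (lexx _)) _; lra.
Qed.

(** Goursat's bisection. If the sums did not tend to 0, some quarter of the
    square would violate [good], and so on; near the point common to these nested
    squares the function is affine in [e] up to an error small compared with the
    side, the affine part contributes nothing by [he], and the error contributes
    at most a small multiple of side times perimeter. *)
Lemma goursat (ep : R) : 0 < ep ->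
  exists N, forall n, (N <= n)%N -> nc (block_sum n 0 0 0) <= ep.
Proof.
move=> ep0; apply: contrapT => hbad.
have {}hbad : ~ good ep 0 (0, 0)%N.
  by move=> [N hN]; apply: hbad; exists N => n /hN; rewrite expr0 divr1.
pose child (i i' : nat * nat) := (i'.1 = i.1.*2 \/ i'.1 = i.1.*2.+1) /\
   (i'.2 = i.2.*2 \/ i'.2 = i.2.*2.+1).
have hex (ji : nat * (nat * nat)) : exists i', ~ good ep ji.1 ji.2 ->
    ~ good ep ji.1.+1 i' /\ child ji.2 i'.
  case: ji => j [i i2] /=.
  have [hg|hg] := pselect (good ep j (i, i2)); first by exists (0, 0)%N.
  apply: contrapT => hn; apply: hg.
  have hc i' : child (i, i2) i' -> good ep j.+1 i'.
    by move=> hc; apply: contrapT => hg; apply: hn; exists i'.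
  by apply: goodS; apply: hc; rewrite /child /=; tauto.
have [f hf] := choice hex.
pose s := fix s j := if j is j'.+1 then f (j', s j') else (0, 0)%N.
have hs j : ~ good ep j (s j).
  by elim: j => [//|j ih] /=; case: (hf (j, s j) ih).
have hc j : child (s j) (s j.+1) by case: (hf (j, s j) (hs j)).
have [x hx] := @nested_dyadic (fun j => (s j).1) (fun j => (hc j).1).
have [y hy] := @nested_dyadic (fun j => (s j).2) (fun j => (hc j).2).
have k0 : 0 <= k.
  have := le_trans (nc_ge0 _) (hal (leqnn 2)).
  by rewrite pmulr_lge0 // invr_gt0 exprn_gt0.
(* 8 * k is the constant of cell_sum_bound; adding 1 keeps the denominator positive. *)
pose ep' := ep / (8 * k + 1).
have ep'0 : 0 < ep' by rewrite divr_gt0 //; lra.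
have [d d0 [A [B hAB]]] := hloc x y ep'0.
have [j hj] : exists j, (2 ^+ j)^-1 <= d.
  have [j hj] : exists j : nat, d^-1 < j%:R.
    by exists (Num.bound d^-1); rewrite archi_boundP // invr_ge0 ltW.
  exists j; rewrite -[leRHS]invrK lef_pV2 ?posrE ?invr_gt0 ?exprn_gt0 //.
  apply/ltW/(lt_le_trans hj); rewrite -natrX ler_nat.
  exact/ltnW/ltn_expl.
apply: (hs j); exists 2%N => n n2; rewrite /block_sum.
have hnode (z : R) (i a : nat) : (i%:R / 2 ^+ j <= z <= i.+1%:R / 2 ^+ j) -> (a <= 2 ^ n)%N ->
   `|(i * 2 ^ n + a)%:R / 2 ^+ (j + n) - z| <= (2 ^+ j)^-1.
  move=> hz ha.
  have p2 m : (0 : R) < 2 ^+ m by rewrite exprn_gt0.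
  have -> : (i * 2 ^ n + a)%:R / 2 ^+ (j + n) = i%:R / 2 ^+ j + a%:R / 2 ^+ n / 2 ^+ j :> R.
    by rewrite natrD natrM natrX exprD; field; rewrite ?gt_eqF.
  have : (0 : R) <= (a%:R : R) / 2 ^+ n <= 1.
    apply/andP; split; first by rewrite divr_ge0 // ltW.
    by rewrite ler_pdivrMr // mul1r -natrX ler_nat.
  move: (a%:R / _) => w /andP[w0 w1].
  rewrite -(natr1 i) mulrDl mul1r in hz.
  have pj : 0 < (2 ^+ j)^-1 :> R by rewrite invr_gt0.
  have : 0 <= w / 2 ^+ j <= (2 ^+ j)^-1.
    by apply/andP; split; [rewrite mulr_ge0 // ltW | rewrite ler_piMl // ltW].
  move: hz => /andP[z1 z2] /andP[w2 w3]; rewrite ler_norml; apply/andP; split; lra.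
have -> : cell_sum (al (j + n)) (be (j + n)) (node h (j + n) ((s j).1 * 2 ^ n) ((s j).2 * 2 ^ n)) (2 ^ n) (2 ^ n) = cell_sum (al (j + n)) (be (j + n)) (fun a b => node h (j + n) ((s j).1 * 2 ^ n) ((s j).2 * 2 ^ n) a b - (A + B * node e (j + n) ((s j).1 * 2 ^ n) ((s j).2 * 2 ^ n) a b)) (2 ^ n) (2 ^ n).
  rewrite cell_sum_sub cell_sum_affine ?subr0 // => a b; apply: he.
  by rewrite (leq_trans n2) // leq_addl.
have jn2 : (2 <= j + n)%N by rewrite (leq_trans n2) // leq_addl.
apply: le_trans (cell_sum_bound (hal jn2) (hbe jn2) (eta := ep' / 2 ^+ j) _) _.
  move=> a b ha hb; apply: hAB => //; exact: hnode.
have p2 m : (2 : R) ^+ m != 0 by rewrite expf_neq0.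
have -> : 8 * (2 ^ n)%:R * (k / 2 ^+ (j + n)) * (ep' / 2 ^+ j) = (8 * k) * ep' / 4 ^+ j.
  rewrite natrX exprD (_ : 4 = 2 * 2); last by ring.
  by rewrite exprMn; field; rewrite !p2.
rewrite ler_pM2r ?invr_gt0 ?exprn_gt0 //.
have -> : ep = (8 * k + 1) * ep' by rewrite /ep'; field; lra.
by rewrite ler_pM2r //; lra.
Qed.

End Goursat.

(** * The maximum principle at the centre of a disc *)

Section Circle.
Variable R : realType.
Local Notation C := (Cx R).

Lemma mean_value_bound (f df : R -> R) (a b B : R) :
  (forall x : R, is_derive x 1 f (df x)) ->
  (forall x, x \in `[Num.min a b, Num.max a b] -> `|df x| <= B) ->
  `|f b - f a| <= B * `|b - a|.
Proof.
move=> fd hB.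
wlog ab : a b hB / a <= b => [hw|].
  have [ab|ba] := leP a b; first exact: hw.
  rewrite distrC (distrC b); apply: hw; last exact: ltW.
  by move=> x; rewrite minC maxC; exact: hB.
have fc : {within `[a, b], continuous f}.
  apply: continuous_subspaceT => x.
  apply/differentiable_continuous/derivable1_diffP; exact: ex_derive.
have [c cab ->] := MVT_segment ab (fun x _ => fd x) fc.
rewrite normrM ler_wpM2r // hB //.
by rewrite (min_idPl ab) (max_idPr ab).
Qed.

Definition cis (y : R) : C := Complex (cos y) (sin y).

Lemma cisD a b : cis (a + b) = cis a * cis b.
Proof. by rewrite /cis sinD cosD; congr Complex; ring. Qed.
Lemma cis0 : cis 0 = 1.
Proof. by rewrite /cis cos0 sin0. Qed.
Lemma cisX a n : cis (a *+ n) = cis a ^+ n.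
Proof. by elim: n => [|n ih]; rewrite ?cis0 // mulrS cisD ih exprS. Qed.
Lemma nc_cis y : nc (cis y) = 1.
Proof.
by rewrite /nc (normc_def (cis y : R[i])) /= cos2Dsin2 sqrtr1.
Qed.
Lemma cis_pi : cis pi = -1.
Proof. by rewrite /cis cospi sinpi -ofR1 -ofRN. Qed.
Lemma cis_2pi : cis (pi *+ 2) = 1.
Proof. by rewrite cisX cis_pi sqrrN expr1n. Qed.

Lemma cis_near1 y : nc (cis y - 1) <= 2 * `|y|.
Proof.
have hs : `|sin y| <= `|y|.
  have := @mean_value_bound sin cos 0 y 1 _ (fun x _ => cos_max x).
  by rewrite sin0 !subr0 mul1r; apply.
have hc : `|cos y - 1| <= `|y|.
  have := @mean_value_bound cos (fun x => - sin x) 0 y 1 _.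
  rewrite cos0 !subr0 mul1r; apply => x _; rewrite normrN; exact: sin_max.
have -> : cis y - 1 = Complex (cos y - 1) (sin y).
  by rewrite -ofR1 /cis /ofR; apply/eqP; rewrite eq_complex /= subr0 !eqxx.
by apply: le_trans (nc_cplx _ _) _; rewrite mulr_natl mulr2n lerD.
Qed.

Lemma expR_near1 (x : R) : `|expR x - 1| <= `|x| * expR `|x|.
Proof.
have h1 := expR_ge1Dx x; have h2 := expR_ge1Dx (- x).
have e0 := expR_gt0 x.
have e1 : expR x * expR (- x) = 1 by rewrite -expRD subrr expR0.
have [x0|x0] := lerP 0 x.
  rewrite (ger0_norm x0) ger0_norm; last by lra.
  have : expR x * (1 - x) <= 1 by rewrite -[leRHS]e1 ler_pM2l.
  lra.
rewrite (ltr0_norm x0) ler0_norm; last by rewrite -expR0 subr_le0 ler_expR ltW.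
have : 1 <= expR (- x) by rewrite -expR0 ler_expR; lra.
nra.
Qed.

(** Polar coordinates: as x and y run through [0, 1], the point runs through the
    annulus between the radii r and r * exp L. *)
Definition polar (r L x y : R) : C := ofR (r * expR (L * x)) * cis (pi *+ 2 * y).

Lemma polarD r L x y s t :
  polar r L (x + s) (y + t) = polar r L x y * polar 1 L s t.
Proof.
by rewrite /polar !mulrDr cisD expRD !ofRM ofR1; ring.
Qed.

Lemma polar_near r L : exists2 K : R, 0 <= K & forall x y x0 y0 t,
  t <= 1 -> `|x - x0| <= t -> `|y - y0| <= t ->
  nc (polar r L x y - polar r L x0 y0) <= nc (polar r L x0 y0) * (K * t).
Proof.
have pi0 := pi_gt0 R.
exists (`|L| * expR `|L| + 4 * pi).
  by rewrite addr_ge0 // mulr_ge0 ?expR_ge0 // ltW.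
move=> x y x0 y0 t t1 hx hy.
have t0 : 0 <= t by apply: le_trans hx.
rewrite -[x](subrKC x0) -[y](subrKC y0) polarD -[X in _ - X]mulr1 -mulrBr ncM.
apply: ler_wpM2l; first exact: nc_ge0.
move: (x - x0) (y - y0) hx hy => s v hs hv.
rewrite /polar mul1r.
have -> : ofR (expR (L * s)) * cis (pi *+ 2 * v) - 1 =
  (ofR (expR (L * s) - 1)) * cis (pi *+ 2 * v) + (cis (pi *+ 2 * v) - 1).
  by rewrite ofRB ofR1; ring.
apply: le_trans (ncD _ _) _; rewrite ncM nc_cis mulr1 nc_ofR [leRHS]mulrDl.
apply: lerD.
  apply: le_trans (expR_near1 _) _.
  rewrite normrM [leRHS]mulrAC; apply: ler_pM; rewrite ?mulr_ge0 ?expR_ge0 //.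
    by rewrite ler_wpM2l.
  by rewrite ler_expR ler_piMr // (le_trans hs).
apply: le_trans (cis_near1 _) _.
rewrite normrM ger0_norm; last by rewrite mulr2n; lra.
rewrite mulr2n; nra.
Qed.

(** Complex differentiability in terms of real bounds only. *)
Definition cdiff (u : C -> C) (z d : C) := forall e : R, 0 < e ->
  exists2 t : R, 0 < t & forall h, nc h <= t -> nc (u (z + h) - u z - d * h) <= e * nc h.

Definition ccont (u : C -> C) (z : C) := forall e : R, 0 < e ->
  exists2 t : R, 0 < t & forall h, nc h <= t -> nc (u (z + h) - u z) <= e.

(** The hypothesis of [goursat]: in polar coordinates a differentiable function is
    locally affine in the node, not in the coordinates. *)
Lemma polar_local (g : C -> C) (r L : R) : 0 < r ->
  (forall z, z != 0 -> exists d, cdiff g z d) ->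
  forall (x0 y0 ep : R), 0 < ep -> exists2 d : R, 0 < d &
  exists A B : C, forall x y t : R, t <= d -> `|x - x0| <= t -> `|y - y0| <= t ->
    nc (g (polar r L x y) - (A + B * polar r L x y)) <= ep * t.
Proof.
move=> r0 hg x0 y0 ep ep0.
have [K K0 hK] := polar_near r L.
pose z0 := polar r L x0 y0.
have z00 : 0 < nc z0.
  by rewrite ncM nc_cis mulr1 nc_ofR normr_gt0 mulf_neq0 ?gt_eqF ?expR_gt0.
have [d hd] := hg z0 ltac:(by rewrite -nc_gt0).
have c0 : 0 < nc z0 * K + 1 by rewrite ltr_wpDl // mulr_ge0 // ltW.
have [s s0 hs] := hd (ep / (nc z0 * K + 1)) (divr_gt0 ep0 c0).
exists (Num.min 1 (s / (nc z0 * K + 1))).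
  by rewrite lt_min ltr01 divr_gt0.
exists (g z0 - d * z0), d => x y t.
rewrite le_min => /andP[t1 ts] hx hy.
have t0 : 0 <= t by apply: le_trans hx.
have hp : nc (polar r L x y - z0) <= t * (nc z0 * K + 1).
  by apply: le_trans (hK _ _ _ _ _ t1 hx hy) _; rewrite -/z0; lra.
have {}ts : nc (polar r L x y - z0) <= s.
  by apply: le_trans hp _; rewrite -ler_pdivlMr.
have := hs _ ts; rewrite subrKC.
have -> : g (polar r L x y) - (g z0 - d * z0 + d * polar r L x y) =
   g (polar r L x y) - g z0 - d * (polar r L x y - z0) by ring.
move=> h; apply: le_trans h _; rewrite -mulrA ler_pM2l // mulrC ler_pdivrMr //.
Qed.

Lemma cis_add1 m : (2 <= m)%N -> 1 <= nc (cis (pi *+ 2 / 2 ^+ m) + 1).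
Proof.
move=> m2; apply: le_trans (nc_Re _); rewrite /=.
suff : 0 <= cos (pi *+ 2 / 2 ^+ m : R) by move=> h; rewrite ger0_norm; lra.
apply: cos_ge0_pihalf; have pi0 := pi_gt0 R.
have -> : (pi *+ 2 / 2 ^+ m : R) = pi / 2 * (2 ^+ 2 / 2 ^+ m).
  by rewrite mulr2n; field; rewrite expf_neq0.
have : (0 : R) <= (2 ^+ 2 / 2 ^+ m : R) <= 1.
  apply/andP; split; first by rewrite divr_ge0.
  by rewrite ler_pdivrMr ?exprn_gt0 // mul1r ler_eXn2l // ltr1n.
move: (_ / _) => w /andP[w0 w1]; apply/andP; split; nra.
Qed.

(** The roots of unity of order 2^m are not closer to each other than 1 / 2^m up
    to a constant, for 2^(m-1) steps lead from 1 to -1. *)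
Lemma cis_sub1 m : (1 <= m)%N -> 4 <= 2 ^+ m * nc (cis (pi *+ 2 / 2 ^+ m) - 1).
Proof.
case: m => // m _; set w := cis _.
have hk k : nc (w ^+ k - 1) <= k%:R * nc (w - 1).
  elim: k => [|k ih]; first by rewrite subrr nc0 mul0r.
  have -> : w ^+ k.+1 - 1 = w * (w ^+ k - 1) + (w - 1) by rewrite exprS; ring.
  apply: le_trans (ncD _ _) _; rewrite ncM nc_cis mul1r -natr1; lra.
have := hk (2 ^ m)%N.
have -> : w ^+ (2 ^ m) = -1.
  rewrite -cisX -cis_pi; congr cis; rewrite -[LHS]mulr_natr natrX exprS mulr2n.
  by field; rewrite expf_neq0.
have -> : -1 - 1 = - (2%:R : C) by ring.
rewrite ncN nc_nat natrX exprS; lra.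
Qed.

(** On a circle cut into 2^n arcs the mean of [g] is asymptotically independent of
    the radius: this is [goursat] for the annulus between two circles, where the
    two radial sides cancel. Since [g] is continuous at 0, small circles give the
    mean [g 0]; and the mean on the circle of radius [r] has modulus at most [M].
    Continuity at 0 is what a difference quotient provides at its centre. *)
Theorem center_bound (g : C -> C) (r M : R) : 0 < r ->
  (forall z, z != 0 -> exists d, cdiff g z d) -> ccont g 0 ->
  (forall z, nc z = r -> nc (g z) <= M) -> nc (g 0) <= M.
Proof.
move=> r0 hg hc hM.
suff h ep : 0 < ep -> nc (g 0) <= M + 2 * ep.
  apply/ler_addgt0Pr => e e0; have := h (e / 2) ltac:(lra); lra.
move=> ep0.
have [r1 r10 hr1] := hc _ ep0.
pose L := ln (r / r1).
have hL : r1 * expR L = r.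
  by rewrite lnK ?posrE ?divr_gt0 // mulrC divfK ?gt_eqF.
pose q m : C := ofR (expR (L / 2 ^+ m)).
pose w m : C := cis (pi *+ 2 / 2 ^+ m).
(* With these weights the sum around a cell vanishes for z as it does for constants. *)
pose al m := (q m - 1) / (q m + 1).
pose be m := (w m - 1) / (w m + 1).
pose k := `|L| * expR `|L| + 4 * pi.
have pi0 := pi_gt0 R.
have p2 m : (0 : R) < 2 ^+ m by rewrite exprn_gt0.
have hn (x : R) m : `|x / 2 ^+ m| = `|x| / 2 ^+ m.
  by rewrite normrM [X in _ * X]ger0_norm // ltW ?invr_gt0.
have q1 m : 1 <= nc (q m + 1).
  rewrite -ofR1 -ofRD nc_ofR ger0_norm; have := expR_gt0 (L / 2 ^+ m); lra.
have k1 : `|L| * expR `|L| <= k by rewrite /k; lra.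
have k2 : 4 * pi <= k by rewrite /k lerDr mulr_ge0 ?expR_ge0.
have hal m : (2 <= m)%N -> nc (al m) <= k / 2 ^+ m.
  move=> m2; rewrite /al ncM ncV.
  apply: (@le_trans _ _ (nc (q m - 1))).
    rewrite ler_pdivrMr ?(lt_le_trans _ (q1 m)) //.
    by rewrite ler_peMr ?nc_ge0.
  rewrite -ofR1 -ofRB nc_ofR; apply: le_trans (expR_near1 _) _.
  rewrite hn mulrAC ler_pM2r ?invr_gt0 //.
  apply: le_trans k1; rewrite ler_wpM2l // ler_expR ler_piMr //.
  by rewrite invf_le1 // exprn_ege1 // ler1n.
have hbe m : (2 <= m)%N -> nc (be m) <= k / 2 ^+ m.
  move=> m2; rewrite /be ncM ncV.
  have w1 := cis_add1 m2.
  apply: (@le_trans _ _ (nc (w m - 1))).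
    rewrite ler_pdivrMr ?(lt_le_trans _ w1) //.
    by rewrite ler_peMr ?nc_ge0.
  apply: le_trans (cis_near1 _) _.
  rewrite hn mulrA ler_pM2r ?invr_gt0 //.
  by apply: le_trans k2; rewrite ger0_norm mulr2n; lra.
have he m i0 k0 a b : (2 <= m)%N ->
  al m * (node (polar r1 L) m i0 k0 a b + node (polar r1 L) m i0 k0 a.+1 b
    - node (polar r1 L) m i0 k0 a b.+1 - node (polar r1 L) m i0 k0 a.+1 b.+1)
  + be m * (node (polar r1 L) m i0 k0 a.+1 b + node (polar r1 L) m i0 k0 a.+1 b.+1
    - node (polar r1 L) m i0 k0 a b - node (polar r1 L) m i0 k0 a b.+1) = 0.
  move=> m2; rewrite /node.
  have hS x n : (x + n.+1)%:R / 2 ^+ m = (x + n)%:R / 2 ^+ m + 1 / 2 ^+ m :> R.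
    by rewrite addnS -natr1 mulrDl.
  have hq z y : polar r1 L (z + 1 / 2 ^+ m) y = polar r1 L z y * q m.
    rewrite -[y in LHS]addr0 polarD; congr (_ * _).
    by rewrite /polar mulr0 cis0 !mul1r mulr1.
  have hw z y : polar r1 L z (y + 1 / 2 ^+ m) = polar r1 L z y * w m.
    rewrite -[z in LHS]addr0 polarD; congr (_ * _).
    by rewrite /polar mulr0 expR0 !mul1r.
  rewrite !hS !hq !hw; move: (polar _ _ _ _) => z.
  have n1 : q m + 1 != 0 by rewrite -nc_gt0 (lt_le_trans _ (q1 m)).
  have n2 : w m + 1 != 0 by rewrite -nc_gt0 (lt_le_trans _ (cis_add1 m2)).
  by rewrite /al /be; move: (q m) (w m) n1 n2 => qm wm n1 n2; field; rewrite n1 n2.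
have ep2 : 0 < 4 * ep by lra.
pose h x y := g (polar r1 L x y).
have [N hN] := goursat (h := h) hal hbe he (polar_local L r10 hg) ep2.
pose n := (N + 2)%N.
have n2 : (2 <= n)%N by rewrite /n; lia.
have := hN n ltac:(rewrite /n; lia).
rewrite /block_sum add0n !mul0n cell_sum_boundary /node !add0n.
(* The angles 0 and 2 pi give the same nodes. *)
have hper x : h x ((2 ^ n)%:R / 2 ^+ n) = h x (0%:R / 2 ^+ n).
  rewrite /h /polar natrX divff ?gt_eqF // mulr1 cis_2pi.
  by rewrite mul0r mulr0 cis0.
rewrite [X in al n * X]big1 ?mulr0 ?add0r; last first.
  by move=> a _; rewrite !add0n !hper; ring.
have hshift (u : nat -> C) (p : nat) : u p = u 0 ->
    \sum_(b < p) u b.+1 = \sum_(b < p) u b.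
  move=> hu; apply/eqP; rewrite -subr_eq0 -sumrB.
  rewrite -(big_mkord xpredT (fun b => u b.+1 - u b)) telescope_sumr //.
  by rewrite hu subrr.
pose u1 (b : nat) := h (0%:R / 2 ^+ n) (b%:R / 2 ^+ n).
pose u2 (b : nat) := h ((2 ^ n)%:R / 2 ^+ n) (b%:R / 2 ^+ n).
have -> : \sum_(b < 2 ^ n) (h ((2 ^ n)%:R / 2 ^+ n) (b%:R / 2 ^+ n)
   + h ((2 ^ n)%:R / 2 ^+ n) (b.+1%:R / 2 ^+ n)
   - h (0%:R / 2 ^+ n) (b%:R / 2 ^+ n) - h (0%:R / 2 ^+ n) (b.+1%:R / 2 ^+ n))
  = (\sum_(b < 2 ^ n) (u2 b - u1 b)) * 2.
  rewrite -/(u1 _) mulr_natr mulr2n !sumrB.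
  rewrite big_split /= (hshift u1) ?(hshift u2) /u1 /u2 ?hper //.
  ring.
rewrite [nc (be n * _)]ncM [nc (_ * 2)]ncM nc_nat => hb.
(* 2^n * be n is bounded below, like the length of the circle. *)
have hbe2 : 2 <= 2 ^+ n * nc (be n).
  have := cis_sub1 (ltac:(lia) : (1 <= n)%N); rewrite -/(w n).
  have hw : nc (w n + 1) <= 2.
    by apply: le_trans (ncD _ _) _; rewrite nc_cis nc1.
  have hw1 := cis_add1 n2; rewrite -/(w n) in hw1.
  have -> : nc (w n - 1) = nc (be n) * nc (w n + 1).
    by rewrite -ncM /be divfK // -nc_gt0 (lt_le_trans _ hw1).
  have := nc_ge0 (be n); have := p2 n; move=> h1 h2 h3.
  have : 0 <= 2 ^+ n * nc (be n) by rewrite mulr_ge0 // ltW.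
  nra.
have hS : nc (\sum_(b < 2 ^ n) (u2 b - u1 b)) <= ep * 2 ^+ n.
  have := nc_ge0 (\sum_(b < 2 ^ n) (u2 b - u1 b)); move: hb hbe2 (p2 n).
  move: (nc (\sum_(b < _) _)) (nc (be n)) (2 ^+ n) => S b P hb hbe2 P0 S0.
  have : b * S * P <= 2 * ep * P by rewrite ler_wpM2r ?(ltW P0) //; lra.
  have : 2 * S <= P * b * S by rewrite ler_wpM2r.
  lra.
have hu1 b : nc (g 0 - u1 b) <= ep.
  rewrite ncC -[u1 b](_ : g (0 + polar r1 L (0%:R / 2 ^+ n) (b%:R / 2 ^+ n)) = _) ?add0r //.
  have := hr1 (polar r1 L (0%:R / 2 ^+ n) (b%:R / 2 ^+ n)); rewrite add0r; apply.
  by rewrite /polar mul0r mulr0 expR0 mulr1 ncM nc_cis mulr1 nc_ofR ger0_norm // ltW.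
have hu2 b : nc (u2 b) <= M.
  apply: hM; rewrite /polar natrX divff ?gt_eqF // mulr1 hL ncM nc_cis mulr1 nc_ofR.
  by rewrite ger0_norm // ltW.
have hsum (F : 'I_(2 ^ n) -> C) (B : R) : (forall b, nc (F b) <= B) ->
  nc (\sum_b F b) <= B * 2 ^+ n.
  move=> hF; apply: le_trans (nc_sum _ _ _) _.
  apply: (@le_trans _ _ (\sum_(b < 2 ^ n) B)); first exact: ler_sum.
  by rewrite sumr_const card_ord -[X in X <= _]mulr_natr natrX.
have : (2 ^ n)%:R * g 0 = \sum_(b < 2 ^ n) (g 0 - u1 b)
   - \sum_(b < 2 ^ n) (u2 b - u1 b) + \sum_(b < 2 ^ n) u2 b.
  rewrite !sumrB sumr_const card_ord mulr_natl; ring.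
move/(congr1 (@nc R)); rewrite ncM nc_nat natrX => heq.
have : 2 ^+ n * nc (g 0) <= 2 ^+ n * (M + 2 * ep).
  rewrite heq; apply: le_trans (ncD _ _) _.
  have := hsum _ _ (fun b : 'I_(2^n) => hu1 b); have := hsum _ _ (fun b : 'I_(2^n) => hu2 b).
  have := ncB (\sum_(b < 2 ^ n) (g 0 - u1 b)) (\sum_(b < 2 ^ n) (u2 b - u1 b)).
  move: (nc _) (nc _) (nc _) (nc _) hS => a1 a2 a3 a4; lra.
by rewrite ler_pM2l.
Qed.

End Circle.

(** * Complex derivatives and Cauchy estimates *)

Section Derivative.
Variable R : realType.
Local Notation C := (Cx R).

Lemma gt0_ofR (e : C) : 0 < e -> exists2 a : R, 0 < a & e = ofR a.
Proof.
move=> e0; exists (nc e); first by rewrite nc_gt0 gt_eqF.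
by rewrite -ncE gtr0_norm.
Qed.

(** Punctured neighbourhoods of 0, whose radii are positive elements of [Cx R],
    in terms of real radii. *)
Lemma dnbhs0P (P : C -> Prop) : (\forall h \near (0 : C)^', P h) <->
  exists2 t : R, 0 < t & forall h, h != 0 -> nc h <= t -> P h.
Proof.
split.
  move=> /nbhs_ballP[e /= /gt0_ofR[a a0 ->] he]; exists (a / 2) => [|h h0 hn].
    by rewrite divr_gt0.
  by apply: he => //; rewrite -ball_normE /= sub0r normrN normC_lt; lra.
move=> [t t0 ht]; apply/nbhs_ballP; exists (ofR t) => /=.
  by rewrite -ofR0 ofR_lt.
move=> h; rewrite -ball_normE /= sub0r normrN normC_lt => hn h0.
by apply: ht => //; exact: ltW.
Qed.

Lemma cvg_dnbhs0P (f : C -> C) (l : C) : f h @[h --> 0^'] --> l <->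
  forall e : R, 0 < e -> exists2 t : R, 0 < t &
    forall h, h != 0 -> nc h <= t -> nc (f h - l) <= e.
Proof.
split.
  move=> /cvgrPdist_le hf e e0.
  have /dnbhs0P[t t0 ht] := hf (ofR e) ltac:(by rewrite -ofR0 ofR_lt).
  by exists t => // h h0 hn; have := ht h h0 hn; rewrite normC_le ncC.
move=> hf; apply/cvgrPdist_le => e /gt0_ofR[a a0 ->]; apply/dnbhs0P.
have [t t0 ht] := hf a a0; exists t => // h h0 hn.
by rewrite normC_le ncC ht.
Qed.

(** The library derivative along [v] is the derivative of the restriction to a line. *)
Lemma cdiffP (V : normedModType C) (G : V -> C) (p v : V) (d : C) :
  is_derive p v G d <-> cdiff (fun t => G (p + t *: v)) 0 d.
Proof.
have hq (h : C) : h != 0 -> nc (h^-1 *: (G (h *: v + p) - G p) - d) * nc h =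
   nc (G (p + (0 + h) *: v) - G (p + 0 *: v) - d * h).
  move=> h0; rewrite -ncM; congr nc.
  rewrite add0r scale0r addr0 [h *: v + p]addrC /GRing.scale /=.
  by rewrite mulrBl mulrAC mulVf // mul1r.
split.
  move=> [dG dE] e e0.
  have : h^-1 *: (G (h *: v + p) - G p) @[h --> 0^'] --> d by rewrite -dE.
  move/cvg_dnbhs0P => /(_ e e0)[t t0 ht]; exists t => // h hn.
  have [->|h0] := eqVneq h 0.
    by rewrite addr0 subrr sub0r mulr0 ncN nc0 mulr0.
  by rewrite -hq // ler_wpM2r ?nc_ge0 // ht.
move=> hd; have hc : h^-1 *: (G (h *: v + p) - G p) @[h --> 0^'] --> d.
  apply/cvg_dnbhs0P => e e0; have [t t0 ht] := hd e e0; exists t => // h h0 hn.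
  by have := ht h hn; rewrite -hq // ler_pM2r // nc_gt0.
split; first by apply/cvg_ex; exists d.
exact: cvg_lim.
Qed.

Lemma cdiff1P (u : C -> C) (z d : C) : is_derive z 1 u d <-> cdiff u z d.
Proof.
rewrite cdiffP; split=> h e e0; have [t t0 ht] := h e e0; exists t => // x hx;
  have := ht x hx; by rewrite add0r scale0r addr0 /GRing.scale /= mulr1.
Qed.

Lemma cdiff_near (u v : C -> C) (z d : C) (t : R) : 0 < t ->
  (forall h, nc h <= t -> u (z + h) = v (z + h)) -> cdiff u z d -> cdiff v z d.
Proof.
move=> t0 huv hu e e0; have [s s0 hs] := hu e e0.
exists (Num.min s t) => [|h]; first by rewrite lt_min s0.
rewrite le_min => /andP[h1 h2]; rewrite -huv //.
have /(_ _)/esym := huv 0; rewrite addr0 nc0 => -> //; last exact: ltW.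
exact: hs.
Qed.

Lemma cdiff_ext (u v : C -> C) (z d : C) : u =1 v -> cdiff u z d -> cdiff v z d.
Proof. by move=> huv; apply: (@cdiff_near _ _ _ _ 1) => // h _; exact: huv. Qed.

Lemma cdiff_cont (u : C -> C) (z d : C) : cdiff u z d -> ccont u z.
Proof.
move=> hu e e0; have [t t0 ht] := hu 1 ltr01.
have c0 : 0 < 1 + nc d by rewrite ltr_pwDl // nc_ge0.
exists (Num.min t (e / (1 + nc d))); first by rewrite lt_min t0 divr_gt0.
move=> h; rewrite le_min => /andP[h1 h2].
have := ht h h1; rewrite mul1r => h3.
apply: le_trans (nc_dist _ (d * h)) _; rewrite ncM.
move: h2; rewrite ler_pdivlMr // => h2; lra.
Qed.

Lemma cdiff_cst (c z : C) : cdiff (fun=> c) z 0.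
Proof. by apply/cdiff1P; exact: is_derive_cst. Qed.

Lemma cdiff_id (z : C) : cdiff id z 1.
Proof. by apply/cdiff1P; exact: is_derive_id. Qed.

Lemma cdiffD (u v : C -> C) (z d e : C) : cdiff u z d -> cdiff v z e ->
  cdiff (fun x => u x + v x) z (d + e).
Proof. by move=> /cdiff1P hu /cdiff1P hv; apply/cdiff1P; exact: is_deriveD. Qed.

Lemma cdiffB (u v : C -> C) (z d e : C) : cdiff u z d -> cdiff v z e ->
  cdiff (fun x => u x - v x) z (d - e).
Proof. by move=> /cdiff1P hu /cdiff1P hv; apply/cdiff1P; exact: is_deriveB. Qed.

Lemma cdiffM (u v : C -> C) (z d e : C) : cdiff u z d -> cdiff v z e ->
  cdiff (fun x => u x * v x) z (d * v z + u z * e).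
Proof.
move=> /cdiff1P hu /cdiff1P hv; apply/cdiff1P.
have := is_deriveM hu hv; rewrite /GRing.scale /= => h.
by apply: is_derive_eq h _; rewrite addrC mulrC; congr (_ + _); rewrite mulrC.
Qed.

Lemma cdiffZ (c : C) (u : C -> C) (z d : C) : cdiff u z d -> cdiff (fun x => c * u x) z (c * d).
Proof. by move=> hu; have := cdiffM (cdiff_cst c z) hu; rewrite mul0r add0r. Qed.

Lemma cdiffV (u : C -> C) (z d : C) : u z != 0 -> cdiff u z d ->
  cdiff (fun x => (u x)^-1) z (- d / u z ^+ 2).
Proof.
move=> u0 hu e e0; set a := u z; have a0 : 0 < nc a by rewrite nc_gt0.
have d1 : 0 < nc d + 1 by rewrite ltr_wpDl // nc_ge0.
have [t t0 ht] := hu (e * nc a ^+ 2 / 4) ltac:(by rewrite divr_gt0 // mulr_gt0 // exprn_gt0).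
have c0 : 0 < e * nc a ^+ 3 / (4 * (nc d + 1)).
  by rewrite divr_gt0 ?mulr_gt0 ?exprn_gt0.
have [s s0 hs] := cdiff_cont hu c0.
have [r r0 hr] := cdiff_cont hu (divr_gt0 a0 (ltr0Sn _ 1)).
exists (Num.min t (Num.min s r)) => [|h]; first by rewrite !lt_min t0 s0.
rewrite !le_min => /and3P[/ht ht' /hs hs' /hr hr'] {ht hs hr}.
move: ht' hs' hr'; rewrite -/a; move: (u (z + h)) => b ht hs hr.
have hb : nc a / 2 <= nc b by have := nc_dist a b; rewrite ncC; lra.
have b0 : b != 0 by rewrite -nc_gt0; lra.
have -> : b^-1 - a^-1 - (- d / a ^+ 2) * h =
   (d * h * (b - a) - a * (b - a - d * h)) / (a ^+ 2 * b).
  by field; rewrite b0.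
rewrite ncM ncV ler_pdivrMr; last first.
  by rewrite nc_gt0 mulf_neq0 ?expf_neq0.
apply: le_trans (ncB _ _) _; rewrite !ncM.
have h0 := nc_ge0 h.
have hA : nc d * nc h * nc (b - a) <= e * nc h * (nc a ^+ 3 / 4).
  apply: (@le_trans _ _ ((nc d + 1) * nc h * (e * nc a ^+ 3 / (4 * (nc d + 1))))).
    apply: ler_pM; rewrite ?mulr_ge0 ?nc_ge0 //.
    by rewrite ler_wpM2r //; lra.
  by rewrite le_eqVlt; apply/orP; left; apply/eqP; field; lra.
have hB : nc a * nc (b - a - d * h) <= e * nc h * (nc a ^+ 3 / 4).
  have -> : e * nc h * (nc a ^+ 3 / 4) = nc a * (e * nc a ^+ 2 / 4 * nc h) by ring.
  by rewrite ler_pM2l.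
have hC : e * nc h * (nc a ^+ 3 / 2) <= e * nc h * (nc a ^+ 2 * nc b).
  apply: ler_wpM2l; first by rewrite mulr_ge0 // ltW.
  have -> : nc a ^+ 3 / 2 = nc a ^+ 2 * (nc a / 2) by ring.
  by rewrite ler_pM2l // exprn_gt0.
lra.
Qed.

Lemma cdiff_affine (u : C -> C) (a b z d : C) : cdiff u (a + z * b) d ->
  cdiff (fun x => u (a + x * b)) z (d * b).
Proof.
have [->|b0] := eqVneq b 0.
  move=> _; rewrite mulr0; apply: (cdiff_ext _ (cdiff_cst (u a) z)) => x.
  by rewrite mulr0 addr0.
have nb : 0 < nc b by rewrite nc_gt0.
move=> hu e e0; have [t t0 ht] := hu (e / nc b) (divr_gt0 e0 nb).
exists (t / nc b) => [|h hh]; first by rewrite divr_gt0.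
have := ht (h * b); rewrite [nc (h * b)]ncM -ler_pdivlMr // => /(_ hh).
have -> : a + (z + h) * b = a + z * b + h * b by ring.
have -> : d * b * h = d * (h * b) by ring.
by have -> : e * nc h = e / nc b * (nc h * nc b) by field; rewrite gt_eqF.
Qed.

Lemma cdiff_shift (u : C -> C) (a z d : C) : cdiff u (a + z) d ->
  cdiff (fun x => u (a + x)) z d.
Proof.
move=> hu e e0; have [t t0 ht] := hu e e0; exists t => // h hh.
by rewrite addrA ht.
Qed.

Lemma real_derive_eps (f : R -> R) (x df : R) :
  (forall e : R, 0 < e -> exists2 t : R, 0 < t &
     forall h, `|h| <= t -> `|f (x + h) - f x - df * h| <= e * `|h|) ->
  is_derive x 1 f df.
Proof.
move=> hd; have hc : h^-1 *: (f (h *: 1 + x) - f x) @[h --> (0 : R)^'] --> df.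
  apply/cvgrPdist_le => e e0; have [t t0 ht] := hd e e0.
  apply/nbhs_ballP; exists t => //= h; rewrite -ball_normE /= sub0r normrN => hn h0.
  have nh : 0 < `|h| by rewrite normr_gt0.
  rewrite -(ler_pM2r nh) -normrM.
  rewrite /GRing.scale /= mulr1 [h + x]addrC.
  have -> : (df - h^-1 * (f (x + h) - f x)) * h = - (f (x + h) - f x - df * h).
    by field.
  by rewrite normrN; exact: ht (ltW hn).
split; first by apply/cvg_ex; exists df.
exact: cvg_lim.
Qed.

(** The real mean value inequality, applied to the real part of u along the
    segment multiplied by the conjugate of u b - u a. *)
Lemma complex_mean_value (u u' : C -> C) (a b : C) (B : R) :
  (forall z, cdiff u z (u' z)) ->
  (forall t : R, 0 <= t <= 1 -> nc (u' (a + ofR t * (b - a))) <= B) ->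
  nc (u b - u a) <= B * nc (b - a).
Proof.
move=> hu hB.
pose c := Num.conj (u b - u a).
pose f t := complex.Re (c * u (a + ofR t * (b - a)) : R[i]).
pose df t := complex.Re (c * (u' (a + ofR t * (b - a)) * (b - a)) : R[i]).
have hRe (x y : C) : complex.Re (x - y : R[i]) = complex.Re (x : R[i]) - complex.Re (y : R[i]).
  by case: x => ? ?; case: y.
have hReZ (x : C) (t : R) : complex.Re (x * ofR t : R[i]) = complex.Re (x : R[i]) * t.
  by case: x => x1 x2 /=; rewrite mulr0 subr0.
have hf (t : R) : is_derive t 1 f (df t).
  apply: real_derive_eps => e e0.
  have hd := cdiffZ c (cdiff_affine (hu (a + ofR t * (b - a)))).
  have [s s0 hs] := hd e e0; exists s => // h hh.
  have := hs (ofR h); rewrite nc_ofR => /(_ hh) {}hs.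
  apply: le_trans hs; rewrite /f /df -hReZ -!hRe ofRD.
  exact: nc_Re.
have hb (t : R) : t \in `[Num.min 0 1, Num.max 0 1] -> `|df t| <= nc c * (B * nc (b - a)).
  rewrite min_l ?ler01 // max_r ?ler01 // in_itv /= => ht.
  apply: le_trans (nc_Re _) _; rewrite !ncM ler_wpM2l ?nc_ge0 // ler_wpM2r ?nc_ge0 //.
  exact: hB.
have := mean_value_bound hf hb.
rewrite /f ofR0 ofR1 mul0r mul1r addr0 subrKC -hRe -mulrBr subr0 normr1 mulr1.
have -> : c * (u b - u a) = ofR (nc (u b - u a) ^+ 2).
  by rewrite /c mulrC -normCK ncE ofRX.
rewrite /= ger0_norm ?sqr_ge0 // /c nc_conj expr2.
have [->|] := eqVneq (nc (u b - u a)) 0.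
  move=> _; apply: mulr_ge0; last exact: nc_ge0.
  by apply: le_trans (nc_ge0 _) (hB 0 _); rewrite lexx ler01.
by move=> n0; rewrite ler_pM2l // lt_neqAle eq_sym n0 nc_ge0.
Qed.

(** The difference quotient of [u] at [w], with the value [d] at the removable point. *)
Definition slope (u : C -> C) (w d z : C) : C :=
  if z == 0 then d else (u (w + z) - u w) / z.

Lemma slope0 (u : C -> C) (w d : C) : slope u w d 0 = d.
Proof. by rewrite /slope eqxx. Qed.

Lemma slopeE (u : C -> C) (w d z : C) : u (w + z) = u w + z * slope u w d z.
Proof.
rewrite /slope; case: eqVneq => [->|z0]; first by rewrite addr0 mul0r addr0.
by rewrite mulrCA divff // mulr1 subrKC.
Qed.

Lemma slope_ccont (u : C -> C) (w d : C) : cdiff u w d -> ccont (slope u w d) 0.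
Proof.
move=> hu e e0; have [t t0 ht] := hu e e0; exists t => // h hh.
rewrite add0r slope0 /slope; case: eqVneq => [_|h0]; first by rewrite subrr nc0 ltW.
have nh : 0 < nc h by rewrite nc_gt0.
rewrite -(ler_pM2r nh) -ncM mulrBl divfK //; exact: ht.
Qed.

Lemma slope_cdiff (u : C -> C) (w d z e : C) : z != 0 -> cdiff u (w + z) e ->
  exists d', cdiff (slope u w d) z d'.
Proof.
move=> z0 hu.
have h1 := cdiffB (cdiff_shift hu) (cdiff_cst (u w) z).
have h2 := cdiffM h1 (@cdiffV id z 1 z0 (cdiff_id z)).
have t0 : 0 < nc z / 2 by rewrite divr_gt0 // nc_gt0.
eexists; apply: (cdiff_near t0 _ h2) => h hh /=.
rewrite /slope; case: eqP => // /eqP; rewrite addr_eq0 => /eqP zh.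
exfalso; move: hh; rewrite zh ncN; have : 0 < nc h by rewrite -ncN -zh nc_gt0.
lra.
Qed.

(** [center_bound] for the difference quotient, which is continuous at the centre
    with the derivative as its value there. *)
Theorem cauchy_estimate (u u' : C -> C) (w : C) (r B : R) : 0 < r ->
  (forall z, cdiff u z (u' z)) ->
  (forall z, nc z = r -> nc (u (w + z) - u w) <= B) -> nc (u' w) <= B / r.
Proof.
move=> r0 hu hB; rewrite -[u' w](slope0 u w (u' w)).
apply: (center_bound (r := r)) => //.
- by move=> z z0; exact: slope_cdiff (hu _).
- exact: slope_ccont.
move=> z zr; rewrite /slope.
have z0 : z != 0 by rewrite -nc_gt0 zr.
by rewrite (negbTE z0) ncM ncV zr ler_pM2r ?invr_gt0 // hB.
Qed.

(** The Cauchy estimate for u bounds u' and makes u Lipschitz; applied to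
    u (w + z) - u z it then shows that u' is Lipschitz, and the mean
    value inequality on the segment from 0 to h gives the remainder. *)
Theorem second_order (u u' : C -> C) (M : R) :
  (forall z, cdiff u z (u' z)) -> (forall z, nc z <= 4 -> nc (u z) <= M) ->
  forall h, nc h <= 1 -> nc (u h - u 0 - u' 0 * h) <= 4 * M * nc h ^+ 2.
Proof.
move=> hu hM h h1.
have d1 s : nc s <= 3 -> nc (u' s) <= 2 * M.
  move=> s3; rewrite -[leRHS]divr1; apply: (cauchy_estimate ltr01 hu) => z z1.
  have := ncB (u (s + z)) (u s); have := hM (s + z); have := hM s; have := ncD s z.
  rewrite z1 => a1 /(_ ltac:(lra)) a2 /(_ ltac:(lra)) a3; lra.
have hseg (a b : C) (r t : R) : nc a <= r -> nc b <= r -> 0 <= t <= 1 ->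
    nc (a + ofR t * (b - a)) <= r.
  move=> ha hb /andP[t0 t1].
  have -> : a + ofR t * (b - a) = ofR (1 - t) * a + ofR t * b.
    by rewrite ofRB ofR1; ring.
  apply: le_trans (ncD _ _) _; rewrite !ncM !nc_ofR !ger0_norm ?subr_ge0 //; nra.
have lip a b : nc a <= 3 -> nc b <= 3 -> nc (u b - u a) <= 2 * M * nc (b - a).
  by move=> ha hb; apply: (complex_mean_value hu) => t ht; apply: d1; exact: hseg.
have d2 w : nc w <= 1 -> nc (u' w - u' 0) <= 4 * M * nc w.
  move=> w1.
  have hv z : cdiff (fun x => u (w + x) - u x) z (u' (w + z) - u' z).
    by apply: cdiffB => //; apply: cdiff_shift.
  rewrite -[w in u' w]addr0 -[leRHS]divr1.
  apply: (cauchy_estimate (w := 0) ltr01 hv) => z z1; rewrite add0r addr0.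
  have l1 := lip z (w + z); have l2 := lip 0 w.
  rewrite addrK subr0 nc0 in l1 l2.
  have := ncD w z; rewrite z1 => wz.
  have := ncB (u (w + z) - u z) (u w - u 0).
  move: (l1 ltac:(lra) ltac:(lra)) (l2 ltac:(lra) ltac:(lra)); lra.
have hphi z : cdiff (fun x => u x - u' 0 * x) z (u' z - u' 0).
  by apply: cdiffB => //; have := cdiffZ (u' 0) (cdiff_id z); rewrite mulr1.
have := @complex_mean_value _ _ 0 h (4 * M * nc h) hphi.
rewrite !subr0 mulr0 subr0 => H; rewrite expr2 mulrA.
rewrite (_ : u h - u 0 - u' 0 * h = u h - u' 0 * h - u 0); last by ring.
apply: H => t /andP[t0 t1]; rewrite add0r.
have nt : nc (ofR t * h) <= nc h.
  by rewrite ncM nc_ofR ger0_norm // ler_piMl // nc_ge0.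
apply: le_trans (d2 _ (le_trans nt h1)) _.
rewrite ler_wpM2l // mulr_ge0 //.
by apply: le_trans (nc_ge0 _) (hM 0 _); rewrite nc0.
Qed.

End Derivative.

(** * Entire functions on a normed space *)

Section Entire.
Variable R : realType.
Local Notation C := (Cx R).

Definition invS (n : nat) : R := n.+1%:R^-1.

(** Completeness, with the rate of convergence kept. *)
Lemma complex_complete (x : nat -> C) (K : R) :
  (forall n m, nc (x n - x m) <= K * (invS n + invS m)) ->
  exists d, forall n, nc (x n - d) <= 2 * K * invS n.
Proof.
move=> hx.
have hr (f : C -> R) : (forall y z, f (y - z) = f y - f z) ->
    (forall z, `|f z| <= nc z) -> exists d, forall n, `|f (x n) - d| <= K * invS n.
  move=> fB fN.
  have hab a b : f (x a) - K * invS a <= f (x b) + K * invS b.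
    by have := le_trans (fN _) (hx a b); rewrite fB ler_norml => /andP[_]; lra.
  have [d hd] := interval_point hab.
  by exists d => n; have /andP[h1 h2] := hd n; rewrite ler_norml; apply/andP; split; lra.
have [a ha] := hr (fun z => complex.Re (z : R[i])) ltac:(by case=> ? ? [? ?]) (@nc_Re R).
have [b hb] := hr (fun z => complex.Im (z : R[i])) ltac:(by case=> ? ? [? ?]) (@nc_Im R).
exists (Complex a b) => n.
have -> : x n - Complex a b =
   Complex (complex.Re (x n : R[i]) - a) (complex.Im (x n : R[i]) - b).
  by case: (x n).
by apply: le_trans (nc_cplx _ _) _; have := ha n; have := hb n; lra.
Qed.

Variable V : normedModType C.
Implicit Types (p v w : V) (G : V -> C).

(** The norm as a real number, as for [nc]. *)
Definition nv (p : V) : R := nc `|p|.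

Lemma nvE p : `|p| = ofR (nv p).
Proof. by rewrite /nv -ncE normr_id. Qed.
Lemma nv_ge0 p : 0 <= nv p. Proof. exact: nc_ge0. Qed.
Lemma nvD p q : nv (p + q) <= nv p + nv q.
Proof. by rewrite -ofR_le ofRD -!nvE ler_normD. Qed.
Lemma nvZ (t : C) p : nv (t *: p) = nc t * nv p.
Proof. by apply: ofR_inj; rewrite ofRM -!nvE -ncE normrZ. Qed.
Lemma nv_line (t : C) p v (r s : R) : nv p <= r -> nc t <= s ->
  nv (p + t *: v) <= r + s * nv v.
Proof.
move=> hp ht; apply: le_trans (nvD _ _) _; rewrite nvZ lerD // ler_wpM2r ?nv_ge0 //.
Qed.

(** Holomorphy in the sense of Gateaux with local boundedness: a class stable under
    restriction to lines and under locally uniform limits. *)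
Definition entire G := (forall r : R, exists M : R, forall p, nv p <= r -> nc (G p) <= M)
  /\ (forall p v, derivable G p v).

Lemma entire_line G p v (t : C) : entire G ->
  cdiff (fun s => G (p + s *: v)) t ('D_v G (p + t *: v)).
Proof.
move=> [_ hG]; have /cdiffP hd := derivableP (hG (p + t *: v) v).
move=> e e0; have [s s0 hs] := hd e e0; exists s => // h hh.
have := hs h hh; rewrite add0r scale0r addr0.
by rewrite (_ : p + t *: v + h *: v = p + (t + h) *: v) // -addrA -scalerDl.
Qed.

Lemma entireP G : (forall r : R, exists M : R, forall p, nv p <= r -> nc (G p) <= M) ->
  (forall p v, exists d, cdiff (fun s => G (p + s *: v)) 0 d) -> entire G.
Proof.
move=> hb hd; split => // p v; have [d /cdiffP[]] := hd p v; by [].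
Qed.

Lemma derive_cdiff G p v d : cdiff (fun s => G (p + s *: v)) 0 d -> 'D_v G p = d.
Proof. by move=> /cdiffP[]. Qed.

Lemma entire_bound G : entire G -> forall r : R, exists2 M : R, 0 <= M &
  forall p, nv p <= r -> nc (G p) <= M.
Proof.
move=> [hG _] r; have [M hM] := hG r; exists `|M| => // p /hM h.
exact: le_trans h (ler_norm _).
Qed.

(** The Cauchy estimate on circles of radius 1, along the line of direction [v]. *)
Lemma derive_bound G v (r M : R) : entire G ->
  (forall p, nv p <= r + nv v -> nc (G p) <= M) ->
  forall p, nv p <= r -> nc ('D_v G p) <= 2 * M.
Proof.
move=> hG hM p hp; rewrite -[leRHS]divr1 -[in 'D_v G p](addr0 p) -(scale0r v).
apply: (cauchy_estimate ltr01 (fun t => entire_line p v t hG)) => z z1.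
rewrite add0r scale0r addr0.
have h1 := hM (p + z *: v); have h2 := hM p.
have := nv_line v hp (lexx (nc z)); rewrite z1 mul1r => /h1 {}h1.
have {}h2 := h2 ltac:(by rewrite (le_trans hp) // lerDl nv_ge0).
have := ncB (G (p + z *: v)) (G p); lra.
Qed.

(** The constant of [second_order] involves only the supremum on a ball, whence the
    uniformity in the point. *)
Lemma quotient_near G v (r : R) : entire G -> exists2 K : R, 0 <= K &
  forall p h, nv p <= r -> h != 0 -> nc h <= 1 ->
   nc (h^-1 * (G (p + h *: v) - G p) - 'D_v G p) <= K * nc h.
Proof.
move=> hG; have [M M0 hM] := entire_bound hG (r + 4 * nv v).
exists (4 * M); first by rewrite mulr_ge0.
move=> p h hp h0 h1.
have := second_order (fun t => entire_line p v t hG)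
  (fun z hz => hM _ (nv_line v hp hz)) h1.
rewrite scale0r addr0 => hs.
rewrite -(ler_pM2r (_ : 0 < nc h)); last by rewrite nc_gt0.
rewrite -ncM mulrBl mulrAC mulVf // mul1r; apply: le_trans hs _.
by rewrite expr2 mulrA.
Qed.

(** Along a line of direction [w], the derivative along [v] is a uniform limit of
    difference quotients, which are entire. By the Cauchy estimate their
    derivatives along [w] form a Cauchy family, and the second order remainder,
    uniform over the family, passes to the limit. The bound on the difference
    quotient of the derivative along [w] gives the symmetry of second
    derivatives. *)
Lemma derive_line G v w p : entire G -> exists d K, [/\ 0 <= K,
  cdiff (fun t => 'D_v G (p + t *: w)) 0 d &
  forall h, h != 0 -> nc h <= 1 ->
    nc (h^-1 * ('D_w G (p + h *: v) - 'D_w G p) - d) <= K * nc h].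
Proof.
move=> hG.
have hsum (M K T x1 x2 x3 x4 : R) : x4 <= 4 * (2 * M + K) * T -> x1 <= K * T ->
    x2 <= K * T -> x3 <= 8 * K * T -> 0 <= T ->
    x4 + x1 + x2 + x3 <= (4 * (2 * M + K) + 10 * K + 1) * T by move=> *; lra.
pose r := nv p + 4 * nv w.
have hring (a b x y z d t : C) : a - b - d * t =
  (x - y - z * t) - (x - a) + (y - b) + (z - d) * t by ring.
have [K K0 hK] := quotient_near v r hG.
have [M M0 hM] := entire_bound hG (r + nv v).
have hD := derive_bound hG hM.
pose u t := 'D_v G (p + t *: w).
pose uh h t := h^-1 * (G (p + t *: w + h *: v) - G (p + t *: w)).
pose uh' h t := h^-1 * ('D_w G (p + t *: w + h *: v) - 'D_w G (p + t *: w)).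
have huh h t : cdiff (uh h) t (uh' h t).
  apply: cdiffZ; apply: cdiffB; last exact: entire_line.
  have := entire_line (p + h *: v) w t hG; rewrite addrAC.
  by apply: cdiff_ext => s; rewrite addrAC.
have hr t : nc t <= 4 -> nv (p + t *: w) <= r by move=> ht; apply: nv_line.
have hux h t : h != 0 -> nc h <= 1 -> nc t <= 4 -> nc (uh h t - u t) <= K * nc h.
  by move=> h0 h1 ht; apply: hK => //; exact: hr.
have hhk h k : h != 0 -> nc h <= 1 -> k != 0 -> nc k <= 1 ->
    nc (uh' h 0 - uh' k 0) <= 2 * K * (nc h + nc k).
  move=> h0 h1 k0 k1.
  have hd t : cdiff (fun s => uh h s - uh k s) t (uh' h t - uh' k t) by apply: cdiffB.
  have hb t : nc t <= 4 -> nc (uh h t - uh k t) <= K * (nc h + nc k).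
    move=> ht; apply: le_trans (nc_tri _ (u t) _) _.
    by rewrite mulrDr lerD // ?hux // ncC hux.
  rewrite -[leRHS]divr1; apply: (cauchy_estimate (w := 0) ltr01 hd) => z z1.
  rewrite add0r; apply: le_trans (ncB _ _) _.
  have := hb z ltac:(rewrite z1; lra); have := hb 0 ltac:(rewrite nc0; lra); lra.
pose hn n : C := ofR (invS n).
have hn_nc n : nc (hn n) = invS n by rewrite nc_ofR ger0_norm // invr_ge0.
have hn0 n : hn n != 0 by rewrite -nc_gt0 hn_nc invr_gt0.
have hn1 n : nc (hn n) <= 1 by rewrite hn_nc /invS invf_le1 // ler1n.
have [d hd] := @complex_complete (fun n => uh' (hn n) 0) (2 * K)
   ltac:(by move=> n m /=; rewrite -!hn_nc; apply: hhk).
have hlim h : h != 0 -> nc h <= 1 -> nc (uh' h 0 - d) <= 8 * K * nc h.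
  move=> h0 h1; have nh : 0 < nc h by rewrite nc_gt0.
  pose n := Num.bound (nc h)^-1.
  have hnn : nc (hn n) <= nc h.
    rewrite hn_nc /invS -[leRHS]invrK lef_pV2 ?posrE ?invr_gt0 //.
    have := archi_boundP (ltac:(by rewrite invr_ge0 ltW) : 0 <= (nc h)^-1).
    by rewrite -/n => /ltW/le_trans; apply; rewrite ler_nat.
  apply: le_trans (nc_tri _ (uh' (hn n) 0) _) _.
  have := hhk h (hn n) h0 h1 (hn0 n) (hn1 n); have := hd n; rewrite -hn_nc; nra.
exists d, (8 * K); split; first by rewrite mulr_ge0.
  move=> e e0; pose L := 4 * (2 * M + K) + 10 * K + 1.
  have L0 : 0 < L by rewrite /L; lra.
  exists (Num.min 1 (e / L)); first by rewrite lt_min ltr01 divr_gt0.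
  move=> t; rewrite le_min => /andP[t1 te]; rewrite add0r.
  have [->|t0] := eqVneq t 0; first by rewrite subrr mulr0 subrr nc0 mulr0.
  have nt : 0 < nc t by rewrite nc_gt0.
  (* An increment quadratic in t makes the error of uh h, linear in h, of second order. *)
  pose h := t * t.
  have h0 : h != 0 by rewrite mulf_neq0.
  have hh : nc h = nc t * nc t by rewrite ncM.
  have h1 : nc h <= 1 by rewrite hh; nra.
  have hM' s : nc s <= 4 -> nc (uh h s) <= 2 * M + K.
    move=> hs; have := nc_dist (uh h s) (u s); have := hux h s h0 h1 hs.
    have := hD _ (hr s hs); rewrite -/(u s); nra.
  have := second_order (huh h) hM' t1.
  have b1 := hux h t h0 h1 ltac:(lra); have b2 := hux h 0 h0 h1 ltac:(rewrite nc0; lra).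
  have b3 := hlim h h0 h1; move=> b4.
  rewrite -/(u t) -/(u 0).
  rewrite (hring (u t) (u 0) (uh h t) (uh h 0) (uh' h 0) d t).
  have b5 : nc ((uh' h 0 - d) * t) <= 8 * K * nc h.
    by rewrite [leLHS]ncM; apply: le_trans b3; rewrite ler_piMr // nc_ge0.
  apply: (@le_trans _ _ (L * (nc t * nc t))).
    apply: le_trans (ncD _ _) _; apply: le_trans (lerD (ncD _ _) (lexx _)) _.
    apply: le_trans (lerD (lerD (ncB _ _) (lexx _)) (lexx _)) _.
    rewrite hh in b1 b2 b5; rewrite /L.
    have : 0 <= nc t * nc t by rewrite mulr_ge0 // ltW.
    rewrite expr2 in b4; move: b1 b2 b4 b5 => {}b1 {}b2 {}b4 {}b5 T0.
    exact: hsum b4 b1 b2 b5 T0.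
  rewrite mulrA ler_pM2r // mulrC -ler_pdivlMr //.
move=> h h0 h1; have := hlim h h0 h1.
by rewrite /uh' scale0r addr0.
Qed.

Theorem entire_derive G v : entire G -> entire ('D_v G).
Proof.
move=> hG; apply: entireP.
  move=> r; have [M _ hM] := entire_bound hG (r + nv v).
  by exists (2 * M); exact: derive_bound hG hM.
by move=> p w; have [d [K [_ h _]]] := derive_line v w p hG; exists d.
Qed.

(** Both sides are the limit that [derive_line] provides. *)
Theorem derive_comm G v w p : entire G -> 'D_v ('D_w G) p = 'D_w ('D_v G) p.
Proof.
move=> hG; have [d [K [K0 h1 h2]]] := derive_line v w p hG.
have e1 : 'D_w ('D_v G) p = d by exact: (@derive_cdiff ('D_v G)).
apply: (eq_trans _ (esym e1)).
have [K' K'0 h3] := quotient_near v (nv p) (entire_derive w hG).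
apply/eqP; rewrite -subr_eq0; apply/eqP/nc_eps => e e0.
pose t := Num.min 1 (e / (K + K' + 1)).
have L0 : 0 < K + K' + 1 by lra.
have t0 : 0 < t by rewrite lt_min ltr01 divr_gt0.
have [t1 te] : t <= 1 /\ t * (K + K' + 1) <= e.
  by rewrite -ler_pdivlMr // /t ge_min ge_min !lexx orbT.
have nt : nc (ofR t) = t by rewrite nc_ofR gtr0_norm.
have n0 : ofR t != 0 by rewrite -nc_gt0 nt.
pose q := (ofR t)^-1 * ('D_w G (p + ofR t *: v) - 'D_w G p).
have b2 : nc (q - d) <= K * t by rewrite -nt; apply: h2; rewrite ?nt.
have b1 : nc ('D_v ('D_w G) p - q) <= K' * t.
  by rewrite ncC -nt; apply: h3; rewrite ?nt.
by apply: le_trans (nc_tri _ q _) _; move: b1 b2 te; clear -t0; move=> *; lra.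
Qed.

Lemma entire_cst (c : C) : entire (fun=> c).
Proof.
apply: entireP => [r|p v]; first by exists (nc c).
by exists 0; exact: cdiff_cst.
Qed.

Lemma entireD G H : entire G -> entire H -> entire (fun p => G p + H p).
Proof.
move=> hG hH; apply: entireP => [r|p v].
  have [M _ hM] := entire_bound hG r; have [N _ hN] := entire_bound hH r.
  by exists (M + N) => p hp; apply: le_trans (ncD _ _) _; rewrite lerD ?hM ?hN.
eexists; apply: cdiffD; exact: entire_line.
Qed.

Lemma entireM G H : entire G -> entire H -> entire (fun p => G p * H p).
Proof.
move=> hG hH; apply: entireP => [r|p v].
  have [M M0 hM] := entire_bound hG r; have [N N0 hN] := entire_bound hH r.
  by exists (M * N) => p hp; rewrite ncM ler_pM ?nc_ge0 ?hM ?hN.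
eexists; apply: cdiffM; exact: entire_line.
Qed.

Lemma entire_sum (I : Type) (s : seq I) (F : I -> V -> C) :
  (forall i, entire (F i)) -> entire (fun p => \sum_(i <- s) F i p).
Proof.
move=> hF; elim: s => [|i s ih].
  by rewrite (_ : (fun _ => _) = (fun=> 0)); [exact: entire_cst | apply/funext => p; rewrite big_nil].
rewrite (_ : (fun _ => _) = (fun p => F i p + \sum_(j <- s) F j p)).
  exact: (entireD (hF i) ih).
by apply/funext => p; rewrite big_cons.
Qed.

Lemma deriveD_entire G H v p : entire G -> entire H ->
  'D_v (fun q => G q + H q) p = 'D_v G p + 'D_v H p.
Proof. by move=> [_ hG] [_ hH]; exact: deriveD. Qed.

Lemma derive_sum_entire (I : Type) (s : seq I) (F : I -> V -> C) v p :
  (forall i, entire (F i)) ->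
  'D_v (fun p => \sum_(i <- s) F i p) p = \sum_(i <- s) 'D_v (F i) p.
Proof.
move=> hF; elim: s => [|i s ih].
  rewrite big_nil; apply: derive_cdiff.
  by apply: cdiff_ext (cdiff_cst 0 0) => t; rewrite big_nil.
rewrite big_cons -ih; have <- := deriveD_entire v p (hF i) (entire_sum s hF).
by congr ('D_v _ p); apply/funext => q; rewrite big_cons.
Qed.

End Entire.

Lemma entire_comp (R : realType) (V W : normedModType (Cx R)) (G : W -> Cx R)
    (A A' : V -> W) :
  (forall p v t, A (p + t *: v) = A p + t *: A' v) ->
  (forall r : R, exists r' : R, forall p, nv p <= r -> nv (A p) <= r') ->
  entire G -> entire (G \o A).
Proof.
move=> hA hr hG; apply: entireP => [r|p v].
  have [r' hr'] := hr r; have [M _ hM] := entire_bound hG r'.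
  by exists M => p /hr' /hM.
exists ('D_(A' v) G (A p + 0 *: A' v)).
by apply: cdiff_ext (entire_line (A p) (A' v) 0 hG) => t /=; rewrite hA.
Qed.

(** * Taylor expansion in one variable *)

Section OneVariable.
Variable R : realType.
Local Notation C := (Cx R).
Implicit Types (u : C -> C) (z : C).

Definition der u : C -> C := 'D_(1 : C) u.

Lemma nvC (z : C) : nv (z : C) = nc z.
Proof. by rewrite /nv ncE nc_ofR ger0_norm // nc_ge0. Qed.

Lemma entire_cdiff u z : entire u -> cdiff u z (der u z).
Proof.
move=> hu; have := entire_line (0 : C) (1 : C) z hu; rewrite /GRing.scale /= mulr1 add0r.
by apply: cdiff_ext => t; rewrite add0r mulr1.
Qed.

Lemma der_eq u z d : cdiff u z d -> der u z = d.
Proof. by move=> /cdiff1P[]. Qed.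

Lemma entire1P u : (forall r : R, exists M : R, forall z, nc z <= r -> nc (u z) <= M) ->
  (forall z, exists d, cdiff u z d) -> entire u.
Proof.
move=> hb hd; apply: entireP => [r|z v].
  by have [M hM] := hb r; exists M => z; rewrite nvC; exact: hM.
have [d hd'] := hd z; exists (d * v).
by apply: cdiff_affine; rewrite mul0r addr0.
Qed.

(** The difference quotient at 0, which shifts the Taylor coefficients by one. *)
Definition zslope u : C -> C := slope u 0 (der u 0).

Lemma zslopeE u z : u z = u 0 + z * zslope u z.
Proof. by have := slopeE u 0 (der u 0) z; rewrite add0r. Qed.

Lemma zslope_neq0 u (z : C) : z != 0 -> zslope u z = (u z - u 0) / z.
Proof. by move=> /negbTE z0; rewrite /zslope /slope z0 add0r. Qed.

Lemma seg_le (h : C) (t : R) : 0 <= t <= 1 -> nc (0 + ofR t * (h - 0)) <= nc h.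
Proof.
move=> /andP[t0 t1]; rewrite add0r subr0 ncM nc_ofR (ger0_norm t0); apply: ler_piMl => //; exact: nc_ge0.
Qed.

(** The removable singularity: differentiability at 0 comes from the second order
    expansion of u, its derivative being u''(0) / 2. *)
Lemma entire_zslope u : entire u -> entire (zslope u).
Proof.
move=> hu; have hd z := entire_cdiff z hu.
apply: entire1P => [r|z].
  have [M M0 hM] := entire_bound (entire_derive (1 : C) hu) r; exists M => z hz.
  have hM' t : nc t <= r -> nc (der u t) <= M by move=> ht; apply: hM; rewrite nvC.
  have [->|z0] := eqVneq z 0.
    rewrite /zslope slope0; apply: hM'; rewrite nc0; exact: le_trans (nc_ge0 z) hz.
  rewrite zslope_neq0 // ncM ncV ler_pdivrMr ?nc_gt0 // -[X in _ * nc X]subr0.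
  apply: (complex_mean_value hd) => t /(@seg_le z) ht.
  by apply: hM'; exact: le_trans ht hz.
have [->|z0] := eqVneq z 0; last first.
  by apply: (@slope_cdiff _ u 0 _ z (der u z)) => //; rewrite add0r.
have hd2 := entire_cdiff 0 (entire_derive (1 : C) hu); rewrite -/(der u) in hd2.
exists (der (der u) 0 / 2) => e e0.
have [t t0 ht] := hd2 e e0; exists t => // h hh; rewrite add0r /zslope slope0 -/(zslope u).
have [->|h0] := eqVneq h 0.
  by rewrite /zslope slope0 subrr mulr0 subrr nc0 mulr0.
have nh : 0 < nc h by rewrite nc_gt0.
pose phi x := u x - u 0 - der u 0 * x - der (der u) 0 / 2 * (x * x).
have hphi x : cdiff phi x (der u x - 0 - der u 0 * 1 - der (der u) 0 / 2 * (1 * x + x * 1)).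
  apply: cdiffB; last by apply: cdiffZ; exact: cdiffM (cdiff_id x) (cdiff_id x).
  apply: cdiffB; last by apply: cdiffZ; exact: cdiff_id.
  by apply: cdiffB; [exact: hd | exact: cdiff_cst].
have := @complex_mean_value _ phi _ 0 h (e * nc h) hphi.
rewrite subr0 => hmv.
rewrite -(ler_pM2r nh) -ncM zslope_neq0 //.
have alg (a b c d x : C) : x != 0 -> ((a - b) / x - c - d / 2 * x) * x =
    (a - b - c * x - d / 2 * (x * x)) - (b - b - c * 0 - d / 2 * (0 * 0)).
  by move=> x0; field.
rewrite (alg _ _ _ _ _ h0) -/(phi h) -/(phi 0).
apply: hmv => s hs; have := seg_le h hs; rewrite subr0 => hx.
set x := (0 + _) in hx *.
have := ht x (le_trans hx hh); rewrite add0r.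
have alg2 (a b c y : C) : a - 0 - b * 1 - c / 2 * (1 * y + y * 1) = a - b - c * y.
  by field.
by rewrite alg2 => hx'; apply: le_trans hx' _; rewrite ler_wpM2l // ltW.
Qed.

(** Away from 0 one divides by a quantity of order [r]; near 0 the maximum
    principle reduces to that case. Thus no radius is lost, and the bound can be
    iterated. *)
Lemma zslope_growth u (r M : R) : 0 < r -> entire u ->
  (forall z, nc z <= 2 * r -> nc (u z) <= M) ->
  forall z, nc z <= 2 * r -> nc (zslope u z) <= 4 / r * M.
Proof.
move=> r0 hu hM z hz.
have M0 : 0 <= M by apply: le_trans (nc_ge0 _) (hM 0 _); rewrite nc0 mulr_ge0 // ltW.
have far (s : R) x : 0 < s -> s <= nc x -> nc x <= 2 * r -> nc (zslope u x) <= 2 * M / s.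
  move=> s0 sx hx; have x0 : 0 < nc x by apply: lt_le_trans sx.
  rewrite zslope_neq0 -?nc_gt0 // ncM ncV; apply: ler_pM; rewrite ?nc_ge0 ?invr_ge0 ?nc_ge0 //.
    have := ncB (u x) (u 0); have := hM x hx; have := hM 0; rewrite nc0.
    move=> /(_ ltac:(lra)); lra.
  by rewrite lef_pV2.
have [zr|zr] := leP (r / 2) (nc z).
  have -> : 4 / r * M = 2 * M / (r / 2) by field; rewrite gt_eqF.
  by apply: far => //; lra.
have hs : forall y, exists d, cdiff (fun t => zslope u (z + t)) y d.
  by move=> y; exists (der (zslope u) (z + y)); apply: cdiff_shift; exact: entire_cdiff (entire_zslope hu).
rewrite -[in zslope u z](addr0 z).
(* As nc z < r / 2, this circle lies in the annulus of radii r and 2 * r. *)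
apply: (@center_bound _ (fun t => zslope u (z + t)) (3 / 2 * r)).
- by rewrite mulr_gt0.
- by move=> y _.
- by have [d hd] := hs 0; exact: cdiff_cont hd.
move=> y hy; have y1 := ncD z y; have y2 := nc_dist y (- z).
rewrite ncN opprK [y + z]addrC in y2.
apply: le_trans (far r _ r0 _ _) _; try by move: y1 y2 zr hy; clear; lra.
by rewrite [leRHS]mulrAC ler_pM2r ?invr_gt0 // ler_wpM2r //; lra.
Qed.

Lemma entire_iter_zslope u N : entire u -> entire (iter N zslope u).
Proof. by move=> hu; elim: N => [|N ih]; [exact: hu | rewrite iterS]; exact: (entire_zslope ih). Qed.

Lemma entire_iter_derive (V : normedModType C) (G : V -> C) v N : entire G ->
  entire (iter N (fun H => 'D_v H) G).
Proof. by move=> hu; elim: N => [|N ih]; [exact: hu | rewrite iterS]; exact: (entire_derive v ih). Qed.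

Lemma iter_zslope_growth u (r M : R) N : 0 < r -> entire u ->
  (forall z, nc z <= 2 * r -> nc (u z) <= M) ->
  forall z, nc z <= 2 * r -> nc (iter N zslope u z) <= (4 / r) ^+ N * M.
Proof.
move=> r0 hu hM; elim: N => [|N ih] z hz; first by rewrite mul1r hM.
rewrite exprS -mulrA; apply: (zslope_growth r0 (entire_iter_zslope N hu)) => //.
Qed.

Lemma iter_zslope_sum u z N :
  u z = \sum_(0 <= a < N) z ^+ a * iter a zslope u 0 + z ^+ N * iter N zslope u z.
Proof.
elim: N => [|N ih]; first by rewrite big_nil add0r mul1r.
by rewrite big_nat_recr //= [LHS]ih [in LHS](zslopeE (iter N zslope u) z) exprSr; ring.
Qed.

(** Leibniz' rule for the product with the variable. *)
Lemma iter_der_mulX (v : C -> C) (c : C) n : entire v ->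
  iter n.+1 der (fun z => c + z * v z) =
  fun z => n.+1%:R * iter n der v z + z * iter n.+1 der v z.
Proof.
move=> hv; have hn k z := entire_cdiff z (entire_iter_derive (1 : C) k hv).
elim: n => [|n ih].
  apply/funext => z; apply: der_eq.
  have := cdiffD (cdiff_cst c z) (cdiffM (cdiff_id z) (hn 0%N z)).
  by rewrite add0r.
rewrite iterS ih; apply/funext => z; apply: der_eq.
have := cdiffD (cdiffZ n.+1%:R (hn n z)) (cdiffM (cdiff_id z) (hn n.+1 z)).
have alg (a b k x : C) : k * a + (1 * a + x * b) = (k + 1) * a + x * b by ring.
by rewrite alg natr1.
Qed.

Lemma iter_der_zslope u n : entire u -> iter n der u 0 = n`!%:R * iter n zslope u 0.
Proof.
elim: n u => [|n ih] u hu; first by rewrite mul1r.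
have e : (fun z => u 0 + z * zslope u z) = u by apply/funext => z; rewrite -zslopeE.
have := iter_der_mulX (u 0) n (entire_zslope hu); rewrite e => ->.
by rewrite mul0r addr0 (ih _ (entire_zslope hu)) mulrA -natrM -factS iterSr.
Qed.

(** The remainder z^N * iter N zslope u z is controlled by [zslope_growth]; it
    tends to 0 once the radius [r] is more than 4 times the modulus of z. *)
Lemma taylor1 u (r M : R) N z : 0 < r -> entire u ->
  (forall x, nc x <= 2 * r -> nc (u x) <= M) -> nc z <= 2 * r ->
  nc (\sum_(0 <= a < N) z ^+ a * (iter a der u 0 / a`!%:R) - u z) <=
    nc z ^+ N * ((4 / r) ^+ N * M).
Proof.
move=> r0 hu hM hz; rewrite [u z](iter_zslope_sum u z N).
rewrite (eq_bigr (fun a => z ^+ a * iter a zslope u 0)); last first.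
  move=> a _; rewrite (iter_der_zslope a hu); congr (_ * _).
  have f0 : (a`!%:R : C) != 0 by rewrite pnatr_eq0 -lt0n fact_gt0.
  by rewrite mulrAC divff // mul1r.
rewrite opprD addrA subrr sub0r ncN ncM ncX ler_wpM2l ?exprn_ge0 ?nc_ge0 //.
exact: iter_zslope_growth.
Qed.

Lemma entire_on_line (V : normedModType C) (G : V -> C) p v : entire G ->
  entire (fun x : C => G (p + x *: v)).
Proof.
apply: (@entire_comp _ _ _ G (fun x : C => p + x *: v) (fun x : C => x *: v)).
  by move=> x w t; rewrite scalerDl addrA scalerA.
move=> r; exists (nv p + r * nv v) => x; rewrite nvC => hx.
exact: nv_line.
Qed.

End OneVariable.

(** * Taylor expansion in several variables *)

Section SeveralVariables.
Variable R : realType.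
Local Notation C := (Cx R).
Variables (V : normedModType C) (n : nat) (e : 'I_n -> V) (l : 'I_n -> V -> C).
Hypothesis lD : forall i p v t, l i (p + t *: v) = l i p + t * l i v.
Hypothesis le : forall i j, l i (e j) = (i == j)%:R.
Hypothesis l_bound : forall i p, nc (l i p) <= nv p.
Hypothesis e_bound : forall i, nv (e i) <= 1.
Implicit Types (G : V -> C) (a : multi_index n) (s : seq 'I_n).

(** The projection along [e i] onto the hyperplane where the coordinate [i] vanishes. *)
Definition slice i (p : V) : V := p + (- l i p) *: e i.

Definition dirD (v : V) G : V -> C := 'D_v G.

Definition dir_iter i c G : V -> C := iter c (dirD (e i)) G.

(** The Taylor polynomial of degree below [N] in the coordinate [i] alone. *)
Definition taylor_op i N G (p : V) : C :=
  \sum_(0 <= c < N) l i p ^+ c * (dir_iter i c G (slice i p) / c`!%:R).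

Lemma entire_dir_iter i c G : entire G -> entire (dir_iter i c G).
Proof. by move=> hG; exact: (entire_iter_derive (e i) c hG). Qed.

Lemma l_entire i : entire (l i).
Proof.
apply: entireP => [r|p v].
  by exists r => p; apply: le_trans (l_bound i p).
exists (l i v); apply: (cdiff_ext (u := fun t => l i p + t * l i v)).
  by move=> t; rewrite lD.
have := cdiffD (cdiff_cst (l i p) 0) (cdiffM (cdiff_id 0) (cdiff_cst (l i v) 0)).
by rewrite mul1r mulr0 addr0 add0r.
Qed.

Lemma l_entireX i c : entire (fun p => l i p ^+ c).
Proof.
elim: c => [|c ih]; first exact: (entire_cst _ (1 : C)).
rewrite (_ : (fun _ => _) = (fun p => l i p * l i p ^+ c)).
  exact: (entireM (l_entire i) ih).
by apply/funext => p; rewrite exprS.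
Qed.

Lemma slice_nv i p : nv (slice i p) <= 2 * nv p.
Proof.
apply: le_trans (nvD _ _) _; rewrite nvZ ncN mulr_natl mulr2n lerD2l.
rewrite -[leRHS]mulr1 ler_pM ?nc_ge0 //; exact: nv_ge0.
Qed.

Lemma sliceD i p v t : slice i (p + t *: v) = slice i p + t *: slice i v.
Proof.
rewrite /slice lD opprD scalerDl scalerDr addrACA -mulrN scalerA.
by rewrite -!addrA; congr (_ + _); rewrite addrCA.
Qed.

Lemma slice_e i j : i != j -> slice i (e j) = e j.
Proof. by move=> /negbTE ij; rewrite /slice le ij oppr0 scale0r addr0. Qed.

Lemma l_slice i j p : i != j -> l i (slice j p) = l i p.
Proof. by move=> /negbTE ij; rewrite /slice lD le ij mulr0 addr0. Qed.

Lemma entire_slice i G : entire G -> entire (fun p => G (slice i p)).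
Proof.
apply: (@entire_comp _ _ _ G (slice i) (slice i)); first exact: sliceD.
move=> r; exists (2 * r) => p hp; apply: le_trans (slice_nv i p) _.
by rewrite ler_wpM2l.
Qed.

Lemma entire_taylor_op i N G : entire G -> entire (taylor_op i N G).
Proof.
move=> hG; apply: (@entire_sum _ _ _ _
  (fun c p => l i p ^+ c * (dir_iter i c G (slice i p) / c`!%:R))) => c.
apply: (entireM (l_entireX i c)).
exact: (entireM (entire_slice i (entire_dir_iter i c hG)) (entire_cst _ (c`!%:R^-1 : C))).
Qed.

Lemma dir_iter_line i c G p (t : C) : entire G ->
  iter c (@der R) (fun x : C => G (p + x *: e i)) t = dir_iter i c G (p + t *: e i).
Proof.
move=> hG; elim: c t => [//|c ih] t.
have {}ih : iter c (@der R) (fun x : C => G (p + x *: e i)) =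
   fun x : C => dir_iter i c G (p + x *: e i) by apply/funext => x; exact: ih.
rewrite iterS ih; apply: der_eq.
exact: (entire_line p (e i) t (entire_dir_iter i c hG)).
Qed.

(** [taylor1] on the line through p of direction [e i], with r = 8 * rho, so that
    each further term gains a factor 1 / 2. The line is used up to the parameter
    2 * r = 16 * rho from a point of norm at most 2 * rho, whence the factor 18. *)
Lemma taylor_op_close i N G (rho M : R) p : 0 < rho -> entire G ->
  (forall q, nv q <= 18 * rho -> nc (G q) <= M) -> nv p <= rho ->
  nc (taylor_op i N G p - G p) <= M / 2 ^+ N.
Proof.
move=> rho0 hG hM hp.
pose u (x : C) := G (slice i p + x *: e i).
have hu : entire u by exact: entire_on_line.
have r0 : 0 < 8 * rho by rewrite mulr_gt0.
have hMu x : nc x <= 2 * (8 * rho) -> nc (u x) <= M.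
  move=> hx; apply: hM; apply: le_trans (nvD _ _) _; rewrite nvZ.
  have : nc x * nv (e i) <= 2 * (8 * rho) * 1 by rewrite ler_pM ?nc_ge0 ?nv_ge0.
  have := slice_nv i p; lra.
have hl : nc (l i p) <= 2 * (8 * rho).
  have := l_bound i p; lra.
have := taylor1 N r0 hu hMu hl.
have -> : u (l i p) = G p.
  by rewrite /u /slice -addrA -scalerDl addNr scale0r addr0.
rewrite (eq_bigr (fun c => l i p ^+ c * (dir_iter i c G (slice i p) / c`!%:R))); last first.
  by move=> c _; rewrite dir_iter_line // scale0r addr0.
move=> h; apply: le_trans h _.
have M0 : 0 <= M by apply: le_trans (nc_ge0 _) (hMu 0 _); rewrite nc0; lra.
rewrite mulrA -exprMn mulrC ler_wpM2l // -exprVn.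
apply: lerXn2r; rewrite ?nnegrE ?mulr_ge0 ?nc_ge0 ?invr_ge0 //; try lra.
rewrite mulrA ler_pdivrMr //; have := l_bound i p; lra.
Qed.

Definition taylor_ops s N G : V -> C := foldr (fun i H => taylor_op i N H) G s.

Lemma entire_taylor_ops s N G : entire G -> entire (taylor_ops s N G).
Proof.
move=> hG; elim: s => [|i s ih]; first exact: hG.
exact: (entire_taylor_op i N ih).
Qed.

(** Expanding in one coordinate keeps the function bounded on a smaller ball, so
    the errors of the successive expansions add up. The rank N0 depends on the
    function only through its bound, for in the application the function is itself
    a truncated expansion. *)
Theorem taylor_ops_close s (rho M ep : R) : 0 < rho -> 0 <= M -> 0 < ep ->
  exists N0, forall N, (N0 <= N)%N -> forall G, entire G ->
    (forall q, nv q <= 18 ^+ size s * rho -> nc (G q) <= M) ->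
    forall p, nv p <= rho -> nc (taylor_ops s N G p - G p) <= ep.
Proof.
move=> rho0 M0; elim: s rho ep rho0 => [|i s ih] rho ep rho0 ep0.
  by exists 0%N => N _ G _ _ p _; rewrite subrr nc0 ltW.
have [N0 hN0] := ih (18 * rho) (Num.min 1 (ep / 2)) ltac:(lra)
  ltac:(by rewrite lt_min ltr01 divr_gt0).
have c0 : 0 < 2 * (M + 1) / ep by rewrite divr_gt0 // mulr_gt0 // ltr_wpDl.
pose N1 := Num.bound (2 * (M + 1) / ep).
exists (maxn N0 N1) => N; rewrite geq_max => /andP[hN hN'] G hG hM p hp.
have hM18 q : nv q <= 18 ^+ size s * (18 * rho) -> nc (G q) <= M.
  by move=> hq; apply: hM; rewrite /= exprSr -mulrA.
have hN00 := hN0 N hN G hG hM18.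
have b1 q : nv q <= 18 * rho -> nc (taylor_ops s N G q) <= M + 1.
  move=> hq; have := hN00 q hq; rewrite le_min => /andP[h1 _].
  apply: le_trans (nc_dist _ (G q)) _; rewrite lerD //; apply: hM18.
  by apply: le_trans hq _; rewrite ler_peMl // ?exprn_ege1 ?ler1n // mulr_ge0 // ltW.
have := taylor_op_close i N rho0 (entire_taylor_ops s N hG) b1 hp.
rewrite -/(taylor_ops (i :: s) N G) => b2.
have := hN00 p ltac:(lra); rewrite le_min => /andP[_ b3].
apply: le_trans (nc_tri _ (taylor_ops s N G p) _) _.
suff : (M + 1) / 2 ^+ N <= ep / 2 by move: b2 b3; clear; lra.
rewrite ler_pdivrMr ?exprn_gt0 // mulrAC ler_pdivlMr // mulrC -ler_pdivrMl //.
have := archi_boundP (ltW c0); rewrite -/N1 => h1.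
apply: le_trans (_ : N1%:R <= _); first by rewrite [leLHS]mulrC; exact: ltW h1.
rewrite -natrX ler_nat; apply: leq_trans hN' _; exact/ltnW/ltn_expl.
Qed.

Definition set_index i c a : multi_index n := [ffun j => if j == i then c else a j].

Definition multi_indices s N : seq (multi_index n) :=
  foldr (fun i r => [seq set_index i c a | c <- index_iota 0 N, a <- r])
    [:: [ffun=> 0%N]] s.

Lemma multi_indices_out s N a j : a \in multi_indices s N -> j \notin s -> a j = 0%N.
Proof.
elim: s a => [|i s ih] a /=; first by rewrite inE => /eqP-> _; rewrite ffunE.
move=> /allpairsP[[c b] /= [_ hb ->]]; rewrite inE negb_or ffunE => /andP[/negbTE-> hj].
exact: ih.
Qed.

Lemma multi_indices_uniq s N : uniq s -> uniq (multi_indices s N).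
Proof.
elim: s => [//|i s ih] /= /andP[his us].
apply: allpairs_uniq; [exact: iota_uniq | exact: ih | ].
move=> [c a] [c' a'] /allpairsP[[x y] /= [_ hy [-> ->]]]
  /allpairsP[[x' y'] /= [_ hy' [-> ->]]] heq.
have hc : x = x' by have := congr1 (fun f : multi_index n => f i) heq; rewrite /= !ffunE eqxx.
congr pair => //; apply/ffunP => j.
have [->|ji] := eqVneq j i.
  by rewrite (multi_indices_out hy his) (multi_indices_out hy' his).
by have := congr1 (fun f : multi_index n => f j) heq; rewrite /= !ffunE (negbTE ji).
Qed.

Definition taylor_monomial s a (p : V) : C := \prod_(i <- s) (l i p ^+ a i / (a i)`!%:R).

Definition multiD s a G : V -> C := foldr (fun i H => dir_iter i (a i) H) G s.

Definition slices s (p : V) : V := foldl (fun q i => slice i q) p s.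

Lemma entire_multiD s a G : entire G -> entire (multiD s a G).
Proof.
move=> hG; elim: s => [|i s ih]; first exact: hG.
exact: (entire_dir_iter i (a i) ih).
Qed.

Lemma entire_taylor_monomial s a : entire (taylor_monomial s a).
Proof.
elim: s => [|i s ih].
  rewrite (_ : taylor_monomial _ _ = fun=> 1); first exact: entire_cst.
  by apply/funext => p; rewrite /taylor_monomial big_nil.
rewrite (_ : taylor_monomial _ _ = fun p => (l i p ^+ a i * (a i)`!%:R^-1) * taylor_monomial s a p).
  exact: (entireM (entireM (l_entireX i (a i)) (entire_cst _ ((a i)`!%:R^-1 : C))) ih).
by apply/funext => p; rewrite /taylor_monomial big_cons.
Qed.

Lemma entire_slices s G : entire G -> entire (fun p => G (slices s p)).
Proof.
move=> hG; elim: s => [|i s ih]; first exact: hG.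
exact: (entire_slice i ih).
Qed.

Lemma dirD_dir_iter (v : V) i c G : entire G -> dirD v (dir_iter i c G) = dir_iter i c (dirD v G).
Proof.
move=> hG; elim: c => [//|c ih]; rewrite /dir_iter !iterS -/(dir_iter i c G) -/(dir_iter i c _) -ih.
by apply/funext => p; exact: (derive_comm v (e i) p (entire_dir_iter i c hG)).
Qed.

Lemma dirD_multiD (v : V) s a G : entire G -> dirD v (multiD s a G) = multiD s a (dirD v G).
Proof.
move=> hG; elim: s => [//|i s ih] /=.
by rewrite (dirD_dir_iter v i (a i) (entire_multiD s a hG)) ih.
Qed.

(** Derivatives along [v] pass through factors constant along [v] and through maps
    commuting with the translations along [v]. *)
Lemma iter_dirD_sum (v : V) c (K : Type) (r : seq K) (m : K -> V -> C) (H : K -> V -> C)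
    (P : V -> V) :
  (forall k, entire (m k)) -> (forall k, entire (H k)) ->
  (forall G, entire G -> entire (fun p => G (P p))) ->
  (forall k p t, m k (p + t *: v) = m k p) ->
  (forall p t, P (p + t *: v) = P p + t *: v) ->
  iter c (dirD v) (fun q => \sum_(k <- r) m k q * H k (P q)) =
  (fun q => \sum_(k <- r) m k q * iter c (dirD v) (H k) (P q)).
Proof.
move=> hm hH hP mv Pv; elim: c => [//|c ih]; rewrite iterS ih.
have hn k : entire (iter c (dirD v) (H k)) by exact: (entire_iter_derive v c (hH k)).
pose F k q := m k q * iter c (dirD v) (H k) (P q).
have hF k : entire (F k) by exact: (entireM (hm k) (hP _ (hn k))).
apply/funext => q; rewrite {1}/dirD.
have -> := @derive_sum_entire _ _ _ r F v q hF.
apply: eq_bigr => k _; apply: derive_cdiff.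
apply: (cdiff_ext (u := fun t => m k q * iter c (dirD v) (H k) (P q + t *: v))).
  by move=> t; rewrite /F mv Pv.
apply: cdiffZ; have := entire_line (P q) v 0 (hn k).
by rewrite scale0r addr0.
Qed.

Lemma slicesD s j p (t : C) : j \notin s ->
  slices s (p + t *: e j) = slices s p + t *: e j.
Proof.
elim: s p => [//|i s ih] p; rewrite inE negb_or => /andP[ji js] /=.
by rewrite sliceD slice_e 1?eq_sym // ih.
Qed.

Lemma taylor_monomial_dir s a j p (t : C) : j \notin s -> taylor_monomial s a (p + t *: e j) = taylor_monomial s a p.
Proof.
move=> js; apply: eq_big_seq => i hi.
have ij : i != j by apply: contraNneq js => <-.
by rewrite lD le (negbTE ij) mulr0 addr0.
Qed.

Lemma l_slices s j p : l j (slices s p) = if j \in s then 0 else l j p.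
Proof.
elim: s p => [//|i s ih] p /=; rewrite ih inE; case: eqVneq => [->|ji] /=.
  by case: ifP => // _; rewrite /slice lD le eqxx mulr1 subrr.
by rewrite l_slice.
Qed.

(** The coefficients come out as derivatives taken in the order of the list [s],
    since each expansion is applied to the result of the later ones. *)
Theorem taylor_ops_sum s N G p : uniq s -> entire G ->
  taylor_ops s N G p =
    \sum_(a <- multi_indices s N) taylor_monomial s a p * multiD s a G (slices s p).
Proof.
move=> us hG; elim: s us p => [_|i s ih /= /andP[his us]] p.
  by rewrite /= big_cons big_nil addr0 /taylor_monomial big_nil mul1r.
have {ih}-> : taylor_ops s N G = fun q =>
    \sum_(a <- multi_indices s N) taylor_monomial s a q * multiD s a G (slices s q).
  by apply/funext => q; exact: ih.
rewrite big_allpairs_dep /= /taylor_op; apply: eq_bigr => c _.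
rewrite /dir_iter (@iter_dirD_sum (e i) c _ (multi_indices s N) (taylor_monomial s)
  (fun a => multiD s a G) (slices s)); first last.
- by move=> q t; exact: slicesD.
- by move=> a q t; exact: taylor_monomial_dir.
- by move=> H; exact: entire_slices.
- by move=> a; exact: entire_multiD.
- by move=> a; exact: entire_taylor_monomial.
rewrite mulr_suml mulr_sumr; apply: eq_big_seq => a ha.
have hs j : j \in s -> j == i = false by move=> js; apply: contraNF his => /eqP<-.
have -> : multiD s (set_index i c a) G = multiD s a G.
  rewrite /multiD; elim: (s) hs => //= j s' ihs hs; rewrite ihs; last first.
    by move=> k ks; apply: hs; rewrite inE ks orbT.
  by rewrite ffunE hs // inE eqxx.
have -> : taylor_monomial (i :: s) (set_index i c a) p = l i p ^+ c / c`!%:R * taylor_monomial s a p.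
  rewrite /taylor_monomial big_cons !ffunE eqxx; congr (_ * _).
  by apply: eq_big_seq => j js; rewrite ffunE hs.
have -> : taylor_monomial s a (slice i p) = taylor_monomial s a p.
  by apply: eq_big_seq => j js; rewrite l_slice ?hs.
rewrite /= ffunE eqxx /dir_iter.
move: (iter _ _ _ _) (taylor_monomial _ _ _) (l i p ^+ c) (_^-1).
by move=> x y z w; ring.
Qed.

End SeveralVariables.

(** * Quotients of entire functions *)

Section Quotient.
Variable R : realType.
Local Notation C := (Cx R).

(** By continuity. *)
Lemma le_at0 (u v : C -> C) (c : R) : entire u -> entire v -> 0 <= c ->
  (forall z, z != 0 -> nc (v z) <= c * nc (u z)) -> nc (v 0) <= c * nc (u 0).
Proof.
move=> hu hv c0 h; apply/ler_addgt0Pr => e e0.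
have e1 : 0 < e / (c + 1) by rewrite divr_gt0 // ltr_wpDl.
have [s s0 hs] := cdiff_cont (entire_cdiff 0 hu) e1.
have [t t0 ht] := cdiff_cont (entire_cdiff 0 hv) e1.
pose x : C := ofR (Num.min s t).
have m0 : 0 < Num.min s t by rewrite lt_min s0.
have nx : nc x = Num.min s t by rewrite nc_ofR gtr0_norm.
have := hs x; have := ht x; rewrite nx !ge_min !lexx orbT !add0r.
move=> /(_ isT) h1 /(_ isT) h2.
have h3 := h x ltac:(by rewrite -nc_gt0 nx).
have h4 := nc_dist (v 0) (v x); have h5 := nc_dist (u x) (u 0).
rewrite ncC in h4.
have h6 : c * nc (u x) <= c * (nc (u 0) + e / (c + 1)) by rewrite ler_wpM2l //; lra.
have h7 : e = c * (e / (c + 1)) + e / (c + 1) by field; lra.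
lra.
Qed.

Lemma iter_zslope_le (u v : C -> C) (c : R) m : entire u -> entire v -> 0 <= c ->
  (forall z, nc (v z) <= c * nc (u z)) ->
  (forall j, (j < m)%N -> iter j (@zslope R) u 0 = 0) ->
  forall z, nc (iter m (@zslope R) v z) <= c * nc (iter m (@zslope R) u z).
Proof.
move=> hu hv c0 h; elim: m => [|m ih] h0; first exact: h.
have {}ih := ih (fun j hj => h0 j (ltnW hj)).
have um := h0 m (ltnSn m).
have vm : iter m (@zslope R) v 0 = 0.
  by apply/eqP; rewrite -nc_eq0; apply/eqP/le_anti; rewrite nc_ge0 andbT;
    have := ih 0; rewrite um nc0 mulr0.
have off z : z != 0 -> nc (iter m.+1 (@zslope R) v z) <= c * nc (iter m.+1 (@zslope R) u z).
  move=> z0; rewrite !iterS !zslope_neq0 // um vm !subr0 !ncM mulrA.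
  by rewrite ler_wpM2r ?nc_ge0.
move=> z; have [->|z0] := eqVneq z 0; last exact: off.
exact: (le_at0 (entire_iter_zslope m.+1 hu) (entire_iter_zslope m.+1 hv) c0 off).
Qed.

(** Then u = z^N * iter N zslope u for all N, which [iter_zslope_growth] on a large disc
    makes arbitrarily small. *)
Lemma iter_zslope_vanish (u : C -> C) : entire u ->
  (forall j, iter j (@zslope R) u 0 = 0) -> forall z, u z = 0.
Proof.
move=> hu h z; apply: nc_eps => e e0.
pose r := 8 * (nc z + 1); have r0 : 0 < r by rewrite mulr_gt0 // ltr_wpDl ?nc_ge0.
have [M M0 hM] := entire_bound hu (2 * r).
have hM' x : nc x <= 2 * r -> nc (u x) <= M by move=> hx; apply: hM; rewrite nvC.
have hz : nc z <= 2 * r by rewrite /r; have := nc_ge0 z; lra.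
pose N := Num.bound (M / e).
have := iter_zslope_growth N r0 hu hM' hz.
rewrite (iter_zslope_sum u z N) big1 ?add0r; last by move=> a _; rewrite h mulr0.
move=> h1; rewrite ncM ncX.
apply: (@le_trans _ _ (M / 2 ^+ N)).
  apply: (@le_trans _ _ (nc z ^+ N * ((4 / r) ^+ N * M))).
    by rewrite ler_wpM2l // exprn_ge0 // nc_ge0.
  rewrite mulrA -exprMn mulrC ler_wpM2l // -exprVn.
  apply: lerXn2r; rewrite ?nnegrE ?mulr_ge0 ?nc_ge0 ?invr_ge0 ?(ltW r0) //.
  by rewrite mulrA ler_pdivrMr // /r; have := nc_ge0 z; lra.
rewrite ler_pdivrMr ?exprn_gt0 // mulrC -ler_pdivrMr //.
have := archi_boundP (divr_ge0 M0 (ltW e0)); rewrite -/N => h2.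
apply: le_trans (ltW h2) _; rewrite -natrX ler_nat; exact/ltnW/ltn_expl.
Qed.

(** If f vanishes to the order m at [a], the bound forces g to vanish to that order
    too. Dividing both by the m-th power of the coordinate leaves a quotient of
    entire functions whose denominator does not vanish at [a]. *)
Lemma local_quotient (f g : C -> C) (c : R) (a : C) : entire f -> entire g -> 0 <= c ->
  (forall z, nc (g z) <= c * nc (f z)) -> (exists z, f z != 0) ->
  exists q : C -> C, [/\ exists d, cdiff q a d, nc (q a) <= c,
    f a != 0 -> q a = g a / f a &
    exists2 t : R, 0 < t & forall h, h != 0 -> nc h <= t ->
       f (a + h) != 0 /\ q (a + h) = g (a + h) / f (a + h)].
Proof.
move=> hf hg c0 hgf [z0 fz0].
pose fa x := f (a + x); pose ga x := g (a + x).
have nfa : entire fa.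
  have := entire_on_line a (1 : C) hf; congr (entire _).
  by apply/funext => x; rewrite /GRing.scale /= mulr1.
have nga : entire ga.
  have := entire_on_line a (1 : C) hg; congr (entire _).
  by apply/funext => x; rewrite /GRing.scale /= mulr1.
have [m0 hm0] : exists j, iter j (@zslope R) fa 0 != 0.
  apply: contrapT => hn; move/eqP: fz0; apply.
  have := @iter_zslope_vanish fa nfa; rewrite /fa => h.
  rewrite -(subrKC a z0); apply: h => j; apply/eqP/negPn/negP => hj.
  by apply: hn; exists j.
have hex : exists j, (fun j => iter j (@zslope R) fa 0 != 0) j by exists m0.
case: (ex_minnP hex) => m hm hmin {m0 hm0 hex}.
have hlt j : (j < m)%N -> iter j (@zslope R) fa 0 = 0.
  by move=> jm; apply/eqP/negPn/negP => /hmin; rewrite leqNgt jm.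
pose fm := iter m (@zslope R) fa; pose gm := iter m (@zslope R) ga.
have hle z : nc (gm z) <= c * nc (fm z).
  by apply: iter_zslope_le => // x; exact: hgf.
have hltg j : (j < m)%N -> iter j (@zslope R) ga 0 = 0.
  move=> jm; apply/eqP; rewrite -nc_eq0; apply/eqP/le_anti; rewrite nc_ge0 andbT.
  have := @iter_zslope_le fa ga c j nfa nga c0 (fun x => hgf _)
     (fun k hk => hlt k (ltn_trans hk jm)) 0.
  by rewrite hlt // nc0 mulr0.
have ef x : fa x = x ^+ m * fm x.
  by rewrite (iter_zslope_sum fa x m) big_nat big1 ?add0r // => j /andP[_ /hlt->]; rewrite mulr0.
have eg x : ga x = x ^+ m * gm x.
  by rewrite (iter_zslope_sum ga x m) big_nat big1 ?add0r // => j /andP[_ /hltg->]; rewrite mulr0.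
have nfm : entire fm by exact: entire_iter_zslope.
have ngm : entire gm by exact: entire_iter_zslope.
exists (fun z => gm (- a + z) / fm (- a + z)); split.
- have h1 : fm (- a + a) != 0 by rewrite addNr.
  have hq := cdiffM (cdiff_shift (entire_cdiff (- a + a) ngm))
    (cdiffV (u := fun z => fm (- a + z)) h1 (cdiff_shift (entire_cdiff (- a + a) nfm))).
  by eexists; exact: hq.
- by rewrite addNr ncM ncV ler_pdivrMr ?nc_gt0.
- rewrite addNr => fa0.
  have e0 : fa 0 = f a by rewrite /fa addr0.
  have m0 : m = 0%N.
    by apply/eqP; rewrite -leqn0; apply: hmin; rewrite /= e0.
  by rewrite /fm /gm m0 /= /ga /fa addr0.
have hm' : 0 < nc (fm 0) / 2 by rewrite divr_gt0 // nc_gt0.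
have [t t0 ht] := cdiff_cont (entire_cdiff 0 nfm) hm'.
exists t => // h h0 /ht; rewrite add0r => hh.
have fh : fm h != 0.
  rewrite -nc_gt0; have := nc_dist (fm 0) (fm h); rewrite ncC; lra.
rewrite addKr -/(fa h) -/(ga h) ef eg mulf_neq0 ?expf_neq0 //; split => //.
by rewrite -mulf_div divff ?mul1r // expf_neq0.
Qed.

(** Liouville: the Cauchy estimate on arbitrarily large circles. *)
Lemma bounded_entire_cst (u : C -> C) (c : R) :
  (forall z, exists d, cdiff u z d) -> (forall z, nc (u z) <= c) ->
  forall z w, u z = u w.
Proof.
move=> hd hc.
have [u' hu] := choice hd.
have u'0 z : u' z = 0.
  have c0 : 0 <= c by apply: le_trans (nc_ge0 _) (hc 0).
  apply: nc_eps => e e0.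
  have r0 : 0 < 2 * c / e + 1 by rewrite ltr_wpDl // divr_ge0 ?(ltW e0) ?mulr_ge0.
  have hb x : nc x = 2 * c / e + 1 -> nc (u (z + x) - u z) <= 2 * c.
    by move=> _; apply: le_trans (ncB _ _) _; rewrite mulr_natl mulr2n lerD.
  apply: le_trans (cauchy_estimate r0 hu hb) _.
  rewrite ler_pdivrMr //.
  have -> : e * (2 * c / e + 1) = 2 * c + e by field; rewrite gt_eqF.
  by rewrite lerDl ltW.
move=> z w; apply/eqP; rewrite -subr_eq0 -nc_eq0; apply/eqP/le_anti.
rewrite nc_ge0 andbT; have := @complex_mean_value _ u u' w z 0 hu.
by rewrite mul0r; apply => t _; rewrite u'0 nc0.
Qed.

(** The local quotients glue, as they agree where f does not vanish, and the result
    is bounded. *)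
Theorem entire_quotient1 (f g : C -> C) (c : R) : entire f -> entire g -> 0 <= c ->
  (forall z, nc (g z) <= c * nc (f z)) -> f 0 != 0 ->
  forall z, g z = g 0 / f 0 * f z.
Proof.
move=> hf hg c0 hgf f0.
have [Q hQ] := choice (fun a => @local_quotient f g c a hf hg c0 hgf (ex_intro _ 0 f0)).
pose psi a := Q a a.
have psiE z : f z != 0 -> psi z = g z / f z by case: (hQ z) => _ _ h _; exact: h.
have hpsi z w : psi z = psi w.
  apply: (@bounded_entire_cst psi c) => [a|a]; last by case: (hQ a).
  case: (hQ a) => [[d hd] _ _ [t t0 ht]]; exists d.
  apply: (cdiff_near t0 _ hd) => h hh; have [->|h0] := eqVneq h 0; first by rewrite addr0.
  by have [fh ->] := ht h h0 hh; rewrite psiE.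
move=> z; have [fz|fz] := eqVneq (f z) 0.
  rewrite fz mulr0; apply/eqP; rewrite -nc_eq0; apply/eqP/le_anti.
  by rewrite nc_ge0 andbT; have := hgf z; rewrite fz nc0 mulr0.
by rewrite -(psiE 0 f0) (hpsi 0 z) (psiE z fz) divfK.
Qed.

Theorem entire_quotient (V : normedModType C) (f g : V -> C) (c : R) (p0 : V) :
  entire f -> entire g -> 0 <= c -> (forall p, nc (g p) <= c * nc (f p)) ->
  f p0 != 0 -> forall p, g p = g p0 / f p0 * f p.
Proof.
move=> hf hg c0 hgf f0 p.
have := @entire_quotient1 (fun x : C => f (p0 + x *: (p - p0)))
  (fun x : C => g (p0 + x *: (p - p0))) c (entire_on_line _ _ hf) (entire_on_line _ _ hg) c0
  (fun z => hgf _).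
by rewrite scale0r addr0 => /(_ f0 1); rewrite scale1r subrKC.
Qed.

End Quotient.

(** * Hermitian kernels with finitely many positive squares *)

Section Kernels.
Variable R : realType.
Local Notation C := (Cx R).
Variable V : normedModType C.
Implicit Types (K : V -> V -> C) (la mu nu : seq (C * V)).

Definition hermitian_kernel K := forall z w, K z w = Num.conj (K w z).

(** A sequence of pairs (coefficient, point) stands for a finitely supported
    measure; this is the value of the sesquilinear form of [K] on two measures. *)
Definition kform K la mu : C :=
  \sum_(p <- la) \sum_(q <- mu) p.1 * Num.conj q.1 * K p.2 q.2.

(** The measure [la] paired with the second variable of [K]. *)
Definition column K la (z : V) : C := \sum_(q <- la) Num.conj q.1 * K z q.2.

Definition scale (c : C) la : seq (C * V) := [seq (c * p.1, p.2) | p <- la].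

Lemma form_catl K la mu nu : kform K (la ++ mu) nu = kform K la nu + kform K mu nu.
Proof. by rewrite /kform big_cat. Qed.

Lemma form_catr K la mu nu : kform K nu (la ++ mu) = kform K nu la + kform K nu mu.
Proof. by rewrite /kform -big_split; apply: eq_bigr => p _; rewrite big_cat. Qed.

Lemma form_scalel K c la nu : kform K (scale c la) nu = c * kform K la nu.
Proof.
rewrite /kform big_map mulr_sumr; apply: eq_bigr => p _.
by rewrite mulr_sumr; apply: eq_bigr => q _ /=; rewrite !mulrA.
Qed.

Lemma form_scaler K c la nu : kform K nu (scale c la) = Num.conj c * kform K nu la.
Proof.
rewrite /kform mulr_sumr; apply: eq_bigr => p _.
rewrite big_map mulr_sumr; apply: eq_bigr => q _ /=.
by rewrite rmorphM /=; ring.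
Qed.

Lemma form_column K la mu : kform K mu la = \sum_(p <- mu) p.1 * column K la p.2.
Proof.
apply: eq_bigr => p _; rewrite /column mulr_sumr; apply: eq_bigr => q _.
by rewrite [RHS]mulrA.
Qed.

Lemma form_herm K la mu : hermitian_kernel K -> kform K la mu = Num.conj (kform K mu la).
Proof.
move=> hK; rewrite /kform exchange_big rmorph_sum; apply: eq_bigr => p _.
rewrite rmorph_sum; apply: eq_bigr => q _.
by rewrite !rmorphM /= conjCK -hK; congr (_ * _); rewrite mulrC.
Qed.

Lemma column_herm K la w : hermitian_kernel K ->
  \sum_(p <- la) p.1 * K p.2 w = Num.conj (column K la w).
Proof.
move=> hK; rewrite /column rmorph_sum; apply: eq_bigr => p _.
by rewrite rmorphM /= conjCK -hK.
Qed.

Lemma form1 K z : kform K [:: (1, z)] [:: (1, z)] = K z z.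
Proof. by rewrite /kform !big_cons !big_nil /= conjC1 !addr0 !mul1r. Qed.

Lemma form2 K z w (x y : C) : kform K [:: (x, z); (y, w)] [:: (x, z); (y, w)] =
  x * Num.conj x * K z z + x * Num.conj y * K z w
  + y * Num.conj x * K w z + y * Num.conj y * K w w.
Proof. by rewrite /kform !big_cons !big_nil /= !addr0 !addrA. Qed.

(** The Schur complement of the line spanned by [la]: the form of this kernel is
    the form of [K] on the orthogonal complement of [la]. *)
Definition schur K la z w : C :=
  K z w - column K la z * Num.conj (column K la w) / kform K la la.

Lemma form_schur K la mu nu : kform (schur K la) mu nu =
  kform K mu nu - kform K mu la * Num.conj (kform K nu la) / kform K la la.
Proof.
have -> : kform K mu la * Num.conj (kform K nu la) / kform K la la =
    \sum_(p <- mu) \sum_(q <- nu) p.1 * Num.conj q.1 *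
      (column K la p.2 * Num.conj (column K la q.2) / kform K la la).
  rewrite [kform K mu la]form_column [kform K nu la]form_column rmorph_sum !mulr_suml.
  apply: eq_bigr => p _; rewrite mulr_sumr mulr_suml.
  by apply: eq_bigr => q _; rewrite rmorphM /=; ring.
rewrite /kform -sumrB; apply: eq_bigr => p _; rewrite -sumrB.
by apply: eq_bigr => q _; rewrite /schur mulrBr.
Qed.

Lemma form_real K la : hermitian_kernel K -> kform K la la \is Num.real.
Proof. by move=> hK; apply/CrealP; rewrite -form_herm. Qed.

Lemma schur_herm K la : hermitian_kernel K -> hermitian_kernel (schur K la).
Proof.
move=> hK z w; rewrite /schur rmorphB rmorphM rmorphM /= conjCK -hK.
rewrite fmorphV /= -form_herm //; congr (_ - _ * _); exact: mulrC.
Qed.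

Lemma column_entire K la : (forall w, entire (K^~ w)) -> entire (column K la).
Proof.
move=> hK; apply: (@entire_sum _ _ _ la (fun q z => Num.conj q.1 * K z q.2)) => q.
exact: (entireM (entire_cst _ (Num.conj q.1 : C)) (hK q.2)).
Qed.

Lemma schur_entire K la : (forall w, entire (K^~ w)) -> forall w, entire ((schur K la)^~ w).
Proof.
move=> hK w.
have h := entireD (hK w) (entireM (column_entire la hK)
  (entire_cst _ (- (Num.conj (column K la w) / kform K la la) : C))).
by congr (entire _): h; apply/funext => z; rewrite /schur mulrN mulrA.
Qed.

(** The class P_k in terms of measures. *)
Definition psd_upto k K := forall la, (size la <= k)%N -> 0 <= kform K la la.

(** An orthonormal family of [m] measures, that is an [m]-dimensional positive
    definite space of measures. *)
Definition positive_squares m K := exists L : 'I_m -> seq (C * V),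
  forall i j, kform K (L i) (L j) = (i == j)%:R.

(** Gram-Schmidt: the component of [mu] orthogonal to [la]. *)
Definition strip K la mu := mu ++ scale (- (kform K mu la / kform K la la)) la.

Lemma form_strip_la K la mu : kform K la la != 0 -> kform K (strip K la mu) la = 0.
Proof.
by move=> h; rewrite /strip form_catl form_scalel mulNr divfK // subrr.
Qed.

Lemma form_strip K la mu nu : kform K la la != 0 ->
  hermitian_kernel K ->
  kform K (strip K la mu) (strip K la nu) = kform (schur K la) mu nu.
Proof.
move=> h hK; rewrite {2}/strip form_catr form_scaler form_strip_la // mulr0 addr0.
rewrite /strip form_catl form_scalel form_schur -[kform K la nu]conjCK -form_herm //.
by rewrite mulNr mulrAC.
Qed.

Lemma positive_squares_schur m K la : hermitian_kernel K -> 0 < kform K la la ->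
  positive_squares m (schur K la) -> positive_squares m.+1 K.
Proof.
move=> hK b0 [L hL]; have bn : kform K la la != 0 by rewrite gt_eqF.
pose s := sqrtC (kform K la la).
have s0 : 0 < s by rewrite sqrtC_gt0.
have sc : Num.conj s^-1 = s^-1 by apply/CrealP; rewrite rpredV gtr0_real.
exists (fun i => if unlift ord0 i is Some j then strip K la (L j) else scale s^-1 la).
move=> i j; case: unliftP => [i' ->|->]; case: unliftP => [j' ->|->].
- by rewrite form_strip // hL (inj_eq (@lift_inj _ _)).
- by rewrite form_scaler form_strip_la // mulr0.
- rewrite form_scalel form_herm // form_strip_la // conjC0 mulr0.
  by rewrite (negbTE (neq_lift _ _)).
rewrite form_scalel form_scaler sc eqxx mulrA -[kform K la la]sqrtCK -/s.
by rewrite expr2 mulrACA mulVf ?mulr1 // gt_eqF.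
Qed.

Lemma positive_squares1 K la : hermitian_kernel K -> 0 < kform K la la -> positive_squares 1 K.
Proof.
move=> hK h; apply: (positive_squares_schur hK h).
by exists (fun=> [::]) => -[].
Qed.

(** A positive semidefinite 2 x 2 matrix with zero diagonal is zero. *)
Lemma psd2_zero K : hermitian_kernel K -> psd_upto 2 K -> (forall z, K z z = 0) ->
  forall z w, K z w = 0.
Proof.
move=> hK h h0 z w; have := h [:: (1, z); (- K z w, w)] isT.
rewrite form2 !h0 !mulr0 add0r addr0 conjC1 mul1r mulr1 rmorphN /= [K w z]hK.
rewrite !mulNr -opprD oppr_ge0 mulrC -mulr2n -normCK pmulrn_lle0 //.
move=> h1; apply/eqP; rewrite -normr_eq0 -sqrf_eq0; apply/eqP/le_anti.
by rewrite h1 exprn_ge0.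
Qed.

(** The discriminant inequality, in the form that the Cauchy-Schwarz inequality for
    a possibly degenerate form requires. *)
Lemma quadratic_discr (a d B : R) : 0 <= a -> 0 <= d -> 0 <= B ->
  (forall t : R, 0 <= t ^+ 2 * a - 2 * t * B + B * d) -> B <= a * d.
Proof.
move=> a0 d0 B0 h; have [a_eq|an] := eqVneq a 0.
  have Bd : 0 <= B * d by rewrite mulr_ge0.
  by rewrite a_eq mul0r; have := h (d + 1); rewrite a_eq mulr0; lra.
have {}a0 : 0 < a by rewrite lt_neqAle eq_sym an.
have := h (B / a); have -> : (B / a) ^+ 2 * a - 2 * (B / a) * B + B * d =
   B / a * (a * d - B) by field.
have [->|Bn] := eqVneq B 0; first by move=> _; rewrite mulr_ge0 // ltW.
by rewrite pmulr_rge0 ?subr_ge0 // divr_gt0 // lt_neqAle eq_sym Bn.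
Qed.

Lemma nsd_cauchy_schwarz S : hermitian_kernel S -> (forall mu, kform S mu mu <= 0) ->
  forall z w, nc (S z w) ^+ 2 <= nc (S z z) * nc (S w w).
Proof.
move=> hS h z w.
have diag x : S x x = - ofR (nc (S x x)).
  by rewrite -ncE ler0_norm ?opprK // -form1.
apply: quadratic_discr; rewrite ?nc_ge0 ?exprn_ge0 ?nc_ge0 // => t.
have tc : Num.conj (ofR t) = ofR t by apply/CrealP; apply/complex_realP; exists t.
have h2 := h [:: (ofR t, z); (S z w, w)].
rewrite form2 tc [S w z]hS (diag z) (diag w) in h2.
rewrite -ofR_le ofR0 -oppr_le0; apply: le_trans h2.
have hn : S z w * Num.conj (S z w) = ofR (nc (S z w)) * ofR (nc (S z w)).
  by rewrite -normCK ncE expr2.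
rewrite ofRD ofRB !ofRM ofR_nat -hn le_eqVlt; apply/orP; left; apply/eqP.
by ring.
Qed.

(** The end of the induction. The remainder S = [schur K la] is negative
    semidefinite, or K would have two positive squares, and K (z, z) >= 0 bounds S
    on the diagonal by the square of f = [column K la] up to a constant. By
    Cauchy-Schwarz and [entire_quotient], S (., w) is a multiple of f; as it
    vanishes on [la] and f does not, the multiple is 0. *)
Lemma rank_one_kernel K : hermitian_kernel K -> (forall w, entire (K^~ w)) ->
  (forall z, 0 <= K z z) -> ~ positive_squares 2 K -> forall la, 0 < kform K la la ->
  forall z w, schur K la z w = 0.
Proof.
move=> hK nK dK h2 la b0 z w.
have bn : kform K la la != 0 by rewrite gt_eqF.
pose S := schur K la; pose f := column K la.
have hS : hermitian_kernel S by exact: schur_herm.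
have nsd mu : kform S mu mu <= 0.
  rewrite real_leNgt ?form_real //; apply/negP => h.
  exact: h2 (positive_squares_schur hK b0 (positive_squares1 hS h)).
pose b := nc (kform K la la).
have bE : kform K la la = ofR b by rewrite -ncE gtr0_norm.
have b1 : 0 < b by rewrite nc_gt0.
have dS x : nc (S x x) <= nc (f x) ^+ 2 / b.
  rewrite -ofR_le -ncE ler0_norm; last by rewrite -form1.
  rewrite /S /schur opprB lerBlDr -/(f x) bE -normCK ncE -ofRX -[_ / _]/(_ * _) -ofRV -ofRM.
  by rewrite lerDl dK.
have hb x y : nc (S x y) <= nc (f y) / b * nc (f x).
  rewrite -ler_sqr ?nnegrE ?nc_ge0 ?mulr_ge0 ?nc_ge0 ?invr_ge0 ?(ltW b1) //.
  apply: le_trans (nsd_cauchy_schwarz hS nsd x y) _.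
  apply: le_trans (_ : (nc (f x) ^+ 2 / b) * (nc (f y) ^+ 2 / b) <= _).
    by rewrite ler_pM ?nc_ge0.
  by rewrite le_eqVlt; apply/orP; left; apply/eqP; ring.
have [p0 fp0] : exists p0, f p0 != 0.
  apply: contrapT => hn; move/eqP: bn; apply; rewrite form_column big1 // => p _.
  have [h|h] := eqVneq (f p.2) 0; first by rewrite -/(f _) h mulr0.
  by case: hn; exists p.2.
have hq := @entire_quotient _ _ f (S^~ w) (nc (f w) / b) p0 (column_entire la nK)
  (schur_entire la nK w) (divr_ge0 (nc_ge0 _) (ltW b1)) (fun x => hb x w) fp0.
have hsum : \sum_(p <- la) p.1 * S p.2 w = 0.
  rewrite /S /schur; under eq_bigr => p _ do rewrite mulrBr !mulrA.
  rewrite sumrB -!mulr_suml -form_column mulrAC divff // mul1r.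
  by rewrite column_herm // subrr.
rewrite -/(S z w); have := hq z; rewrite /= => ->.
suff -> : S p0 w / f p0 = 0 by rewrite mul0r.
move: hsum; under eq_bigr => p _ do rewrite [S p.2 w]hq mulrCA.
rewrite -mulr_sumr -form_column => /eqP.
by rewrite mulf_eq0 (negbTE bn) orbF => /eqP.
Qed.

Lemma schur_add K la : hermitian_kernel K -> 0 < kform K la la -> exists f : V -> C,
  [/\ (forall w, entire (K^~ w)) -> entire f &
   forall z w, K z w = f z * Num.conj (f w) + schur K la z w].
Proof.
move=> hK b0; pose s := sqrtC (kform K la la).
have s0 : 0 < s by rewrite sqrtC_gt0.
have sc : Num.conj s^-1 = s^-1 by apply/CrealP; rewrite rpredV gtr0_real.
exists (fun z => column K la z * s^-1); split.
  move=> nK; exact: (entireM (column_entire la nK) (entire_cst _ (s^-1 : C))).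
move=> z w; rewrite /schur rmorphM /= sc -[kform K la la]sqrtCK -/s.
have sn : s != 0 by rewrite gt_eqF.
by field.
Qed.

(** Induction on k, removing the rank one kernel of a point z with K (z, z) > 0. If
    there is no such point, the diagonal vanishes. For k > 1 this makes K zero by
    positivity on pairs of points; for k = 1 it does not by itself, but if K (z, w) is
    not 0 the measure delta_z + K (z, w) delta_w is positive and [rank_one_kernel]
    applies to it. *)
Theorem finite_rank k K : hermitian_kernel K -> (forall w, entire (K^~ w)) ->
  psd_upto k.+1 K -> ~ positive_squares k.+2 K ->
  exists m (f : 'I_m -> V -> C), (forall i, entire (f i)) /\
    forall z w, K z w = \sum_(i < m) f i z * Num.conj (f i w).
Proof.
elim: k K => [|k ih] K hK nK pK oK.
  have dK z : 0 <= K z z by rewrite -form1; exact: pK.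
  have [[la b0]|hn] := pselect (exists la, 0 < kform K la la).
    have [f [nf hf]] := schur_add hK b0.
    exists 1%N, (fun=> f); split => [_|z w]; first exact: nf.
    by rewrite big_ord1 hf (rank_one_kernel hK nK dK oK b0) addr0.
  exists 0%N, (fun=> fun=> 0); split => [[]//|z w]; rewrite big_ord0.
  have d0 x : K x x = 0.
    apply/eqP/negPn/negP => h; apply: hn; exists [:: (1, x)].
    by rewrite form1 lt_neqAle eq_sym h dK.
  apply/eqP/negPn/negP => h; apply: hn; exists [:: (1, z); (K z w, w)].
  rewrite form2 !d0 !mulr0 add0r addr0 conjC1 mul1r mulr1 [K w z]hK mulrC.
  by rewrite -normCK addr_gt0 // exprn_gt0 // normr_gt0.
have dK z : 0 <= K z z by rewrite -form1; exact: pK.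
have [[z1 b0]|hn] := pselect (exists z1, 0 < kform K [:: (1, z1)] [:: (1, z1)]).
  have [f [nf hf]] := schur_add hK b0.
  set la := [:: (1, z1)] in b0 hf.
  have [m [g [ng hg]]] : exists m (g : 'I_m -> V -> C), (forall i, entire (g i)) /\
    forall z w, schur K la z w = \sum_(i < m) g i z * Num.conj (g i w).
    apply: ih; [exact: schur_herm | exact: schur_entire | | ].
      move=> mu hmu; rewrite -form_strip //; last by rewrite gt_eqF.
      by apply: pK; rewrite size_cat size_map addn1.
    by move=> h; apply: oK; exact: positive_squares_schur h.
  exists m.+1, (fun i => if unlift ord0 i is Some j then g j else f); split.
    by move=> i; case: unliftP => [j _|_]; [exact: ng | exact: nf].
  move=> z w; rewrite big_ord_recl unlift_none hf hg; congr (_ + _).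
  by apply: eq_bigr => i _; rewrite liftK.
exists 0%N, (fun=> fun=> 0); split => [[]//|z w]; rewrite big_ord0.
apply: psd2_zero => //; first by move=> la hla; apply: pK; exact: leq_trans hla _.
move=> x; apply/eqP/negPn/negP => h; apply: hn; exists x.
by rewrite form1 lt_neqAle eq_sym h dK.
Qed.

End Kernels.

(** * Eigenvalues of Hermitian matrices *)

Section Inertia.
Variable R : realType.
Local Notation C := (Cx R).

Local Notation "M ^t*" := (map_mx Num.conj (trmx M)) (at level 30).

Lemma eigenvalues_prod m (A : 'M[C]_m) :
  char_poly A = \prod_(x <- eigenvalues A) ('X - x%:P).
Proof.
rewrite /eigenvalues; case: closed_field_poly_normal => s /= hs.
by rewrite {1}hs (monicP (char_poly_monic A)) scale1r.
Qed.

Lemma char_poly_conj m (P A : 'M[C]_m) : P \in unitmx ->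
  char_poly (invmx P *m A *m P) = char_poly A.
Proof.
move=> uP; rewrite /char_poly /char_poly_mx.
pose Q := map_mx (@polyC C) P; pose Q' := map_mx (@polyC C) (invmx P).
have QQ : Q' *m Q = 1%:M by rewrite -map_mxM mulVmx // map_mx1.
have -> : 'X%:M - map_mx (@polyC C) (invmx P *m A *m P) =
    Q' *m ('X%:M - map_mx (@polyC C) A) *m Q.
  rewrite !map_mxM mulmxBr mulmxBl; congr (_ - _).
  by rewrite mul_mx_scalar -scalemxAl QQ scalemx1.
by rewrite !det_mulmx mulrC mulrA -det_mulmx (mulmx1C QQ) det1 mul1r.
Qed.

Lemma hermitian_diagonal m (A : 'M[C]_m) : A^t* = A ->
  exists (P : 'M[C]_m) (d : 'rV[C]_m), [/\ P \in unitmx,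
   forall i, d 0 i \is Num.real, perm_eq (eigenvalues A) [seq d 0 i | i <- enum 'I_m] &
   A = P^t* *m diag_mx d *m P].
Proof.
move=> hA.
have hs : A \is hermsymmx by apply/is_hermitianmxP; rewrite expr0 scale1r hA.
have uP := spectral_unitarymx A.
have eA := orthomx_spectralP (hermitian_normalmx hs).
exists (spectralmx A), (spectral_diag A); split.
- exact: unitarymx_unit.
- by move=> i; have /mxOverP := hermitian_spectral_diag_real hs; exact.
- apply: prod_XsubC_eq; rewrite -eigenvalues_prod {1}eA.
  rewrite char_poly_conj ?unitarymx_unit // char_poly_trig ?diag_mx_is_trig //.
  rewrite big_map -big_enum /=; apply: eq_bigr => i _.
  by rewrite mxE eqxx mulr1n.
by rewrite -invmx_unitary.
Qed.

(** If fewer than [k] eigenvalues were positive, some nonzero vector of the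
    [k]-dimensional space would be orthogonal to all their eigenvectors, and the form
    would be nonpositive on it. *)
Lemma num_pos_eigen_ge m k (A : 'M[C]_m) (X : 'M[C]_(k, m)) : A^t* = A ->
  (forall y : 'rV[C]_k, y != 0 -> ~~ ((y *m X *m A *m (y *m X)^t*) 0 0 <= 0)) ->
  (k <= num_pos_eigen A)%N.
Proof.
move=> hA hX; have [P [d [uP dR pe eA]]] := hermitian_diagonal hA.
rewrite /num_pos_eigen (permP pe) count_map.
pose S := [pred i | 0 < d 0 i].
have -> : count (preim (fun i => d 0 i) (fun x => 0 < x)) (enum 'I_m) = #|S|.
  by rewrite -sum1_count -sum1_card big_enum_cond.
rewrite leqNgt; apply/negP => hlt.
pose Y := X *m P^t*.
pose Z : 'M[C]_(k, #|S|) := colsub (@enum_val _ (mem S)) Y.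
have hZ : kermx Z != 0.
  rewrite kermx_eq0 /row_free neq_ltn; apply/orP; left.
  exact: leq_ltn_trans (rank_leq_col Z) hlt.
have [y yZ y0] : exists2 y : 'rV_k, y *m Z = 0 & y != 0.
  exists (nz_row (kermx Z)); last by rewrite nz_row_eq0.
  by apply/sub_kermxP; exact: nz_row_sub.
move/negP: (hX y y0); apply.
pose v := y *m Y.
have vS i : 0 < d 0 i -> v 0 i = 0.
  move=> hi; have iS : i \in S by rewrite inE.
  have := congr1 (fun M : 'rV_#|S| => M 0 (enum_rank_in iS i)) yZ.
  rewrite [LHS]mxE [RHS]mxE => <-; rewrite [LHS]mxE.
  by apply: eq_bigr => j _; rewrite [Z _ _]mxE enum_rankK_in.
have -> : y *m X *m A *m (y *m X)^t* = v *m diag_mx d *m v^t*.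
  have -> : v^t* = P *m (y *m X)^t*.
    by rewrite /v /Y mulmxA [in LHS]trmx_mul map_mxM [in LHS]trmxCK.
  by rewrite eA /v /Y !mulmxA.
move: v vS => v vS; rewrite mxE; apply: sumr_le0 => i _; rewrite mul_mx_diag !mxE.
have [di|di] := boolP (0 < d 0 i); first by rewrite vS // !mul0r.
rewrite mulrAC -normCK mulrC mulr_le0_ge0 ?exprn_ge0 //.
by rewrite real_leNgt // real0.
Qed.

(** An eigenvalue is a quotient of values of the form, and these are squared norms. *)
Lemma num_neg_eigen_psd m p (A : 'M[C]_m) (G : 'M[C]_(m, p)) : A = G *m G^t* ->
  num_neg_eigen A = 0%N.
Proof.
move=> hA; apply/eqP; rewrite -leqn0 leqNgt -has_count; apply/hasPn => x hx.
have : root (char_poly A) x by rewrite eigenvalues_prod root_prod_XsubC.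
rewrite -eigenvalue_root_char => /eigenvalueP[v hv v0].
have sq q (w : 'rV[C]_q) : (w *m w^t*) 0 0 = \sum_i `|w 0 i| ^+ 2.
  by rewrite mxE; apply: eq_bigr => i _; rewrite !mxE -normCK.
have v1 : 0 < (v *m v^t*) 0 0.
  rewrite sq lt_neqAle sumr_ge0 ?andbT; last by move=> i _; rewrite exprn_ge0.
  rewrite eq_sym; apply: contra v0 => /eqP/psumr_eq0P h; apply/eqP/rowP => i.
  rewrite mxE; apply/eqP; rewrite -normr_eq0 -sqrf_eq0; apply/eqP/h => //.
suff x0 : 0 <= x by rewrite /= le_gtF.
have : x * (v *m v^t*) 0 0 = ((v *m G) *m (v *m G)^t*) 0 0.
  have -> : v *m G *m (v *m G)^t* = v *m A *m v^t*.
    by rewrite hA trmx_mul map_mxM !mulmxA.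
  by rewrite hv -scalemxAl [RHS]mxE.
move=> h; rewrite -(pmulr_lge0 _ v1) h sq.
by apply: sumr_ge0 => i _; rewrite exprn_ge0.
Qed.

(** The perturbation changes the form by at most half the squared norm. *)
Lemma near_identity_posdef m (M : 'M[C]_m) :
  (forall i j, nc (M i j - (i == j)%:R) <= (2 * m.+1%:R)^-1) ->
  forall y : 'rV[C]_m, y != 0 -> ~~ ((y *m M *m y^t*) 0 0 <= 0).
Proof.
move=> hM y y0; apply/negP => h.
pose q : R := \sum_i nc (y 0 i) ^+ 2.
have q0 : 0 < q.
  have [i hi] : exists i, y 0 i != 0.
    apply: contrapT => hn; move/eqP: y0; apply; apply/rowP => i; rewrite mxE.
    by apply/eqP/negPn/negP => hi; apply: hn; exists i.
  rewrite /q (bigD1 i) //= ltr_pwDl ?exprn_gt0 ?nc_gt0 //.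
  by apply: sumr_ge0 => j _; rewrite exprn_ge0 // nc_ge0.
have e1 : (y *m M *m y^t*) 0 0 = ofR q +
   \sum_i \sum_j y 0 j * (M j i - (j == i)%:R) * Num.conj (y 0 i).
  have -> : ofR q = \sum_i \sum_j y 0 j * (j == i)%:R * Num.conj (y 0 i).
    rewrite /q; elim/big_rec2: _ => [//|i a b _ ih]; rewrite ofRD ih; congr (_ + _).
    rewrite (bigD1 i) //= eqxx mulr1 big1 ?addr0; last first.
      by move=> j /negbTE ->; rewrite mulr0 mul0r.
    by rewrite -normCK ncE ofRX.
  rewrite -big_split mxE; apply: eq_bigr => i _; rewrite -big_split !mxE mulr_suml.
  by apply: eq_bigr => j _ /=; ring.
have e2 : nc (\sum_i \sum_j y 0 j * (M j i - (j == i)%:R) * Num.conj (y 0 i)) <= q / 2.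
  apply: le_trans (nc_sum _ _ _) _.
  apply: (@le_trans _ _ (\sum_i \sum_j (nc (y 0 j) ^+ 2 + nc (y 0 i) ^+ 2) / 2 * (2 * m.+1%:R)^-1)).
    apply: ler_sum => i _; apply: le_trans (nc_sum _ _ _) _; apply: ler_sum => j _.
    rewrite !ncM nc_conj mulrAC ler_pM ?mulr_ge0 ?nc_ge0 //.
    have := sqr_ge0 (nc (y 0 j) - nc (y 0 i)); lra.
  have -> : \sum_i \sum_j (nc (y 0 j) ^+ 2 + nc (y 0 i) ^+ 2) / 2 * (2 * m.+1%:R)^-1 =
     m%:R * q * (2 * m.+1%:R)^-1.
    under eq_bigr => i _ do rewrite -!mulr_suml big_split /= sumr_const card_ord.
    rewrite -!mulr_suml big_split /= sumr_const card_ord -/q sumrMnl -/q -[q *+ m]mulr_natl.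
    by field.
  have -> : m%:R * q * (2 * m.+1%:R)^-1 = q / 2 * (m%:R / m.+1%:R).
    have : (m.+1%:R : R) != 0 by rewrite pnatr_eq0.
    by move: (m.+1%:R : R) => t t0; field.
  rewrite ler_piMr //; first by rewrite divr_ge0 // ltW.
  by rewrite ler_pdivrMr // mul1r ler_nat.
move: h; rewrite e1; move: (\sum_i _) e2 => E e2 h.
have qE : ofR q <= - E by rewrite -subr_le0 opprK.
have : ofR q <= `|E|.
  rewrite -normrN ger0_norm //; apply: le_trans qE.
  by rewrite -ofR0 ofR_le ltW.
rewrite ncE ofR_le; lra.
Qed.

End Inertia.

(** * Continuous functions are bounded on balls *)

Section Bounded.
Variable R : realType.
Local Notation C := (Cx R).

Lemma nc_continuous : continuous (@nc R).
Proof.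
move=> z; apply/(@cvgrPdist_le _ _ _ (nbhs z)) => e e0; apply/nbhs_ballP; exists (ofR e) => /=.
  by rewrite -ofR0 ofR_lt.
move=> x hx; have {hx} : `|z - x| < ofR e by move: hx; rewrite -ball_normE.
rewrite normC_lt => h; rewrite ler_norml; have := nc_dist z x; have := nc_dist x z; rewrite (ncC x).
by move=> h1 h2; apply/andP; split; lra.
Qed.

Lemma Complex_continuous : continuous (fun p : R * R => (Complex p.1 p.2 : C)).
Proof.
move=> p; apply/(@cvgrPdist_le _ _ _ (nbhs p)) => e /gt0_ofR[a a0 ->].
apply/nbhs_ballP; exists (a / 2) => /=; first by rewrite divr_gt0.
move=> q [/= h1 h2]; rewrite -ball_normE /= in h1; rewrite -ball_normE /= in h2.
rewrite normC_le; have -> : Complex p.1 p.2 - Complex q.1 q.2 =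
  (Complex (p.1 - q.1) (p.2 - q.2) : C) by [].
apply: le_trans (nc_cplx _ _) _; lra.
Qed.

Definition square (r : R) : set C :=
  (fun p : R * R => (Complex p.1 p.2 : C)) @` (`[- r, r] `*` `[- r, r]).

Lemma square_compact r : compact (square r).
Proof.
apply: continuous_compact; first exact: continuous_subspaceT Complex_continuous.
by apply: compact_setX; exact: segment_compact.
Qed.

Lemma square_mem (r : R) z : nc z <= r -> square r z.
Proof.
move=> h; exists (complex.Re (z : R[i]), complex.Im (z : R[i])); last by case: z h.
split; rewrite /= in_itv /= -ler_norml; apply: le_trans h; [exact: nc_Re | exact: nc_Im].
Qed.

Variable n : nat.
Local Notation W := 'rV[C]_n.

Lemma ball_nv (V : normedModType C) (x : V) (e : R) :
  ball (0 : V) (ofR e) x <-> nv x < e.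
Proof. by rewrite -ball_normE /= sub0r normrN nvE ofR_lt. Qed.

Lemma nv_coord (x : W) j : nc (x 0 j) <= nv x.
Proof.
apply/ler_addgt0Pr => e e0.
have : ball (0 : W) (ofR (nv x + e)) x by apply/ball_nv; rewrite ltrDl.
by move=> [_ /(_ 0 j)]; rewrite mxE => /ball_nv; rewrite nvC => /ltW.
Qed.

Lemma nv_row (x : W) (r : R) : 0 <= r -> (forall j, nc (x 0 j) <= r) -> nv x <= r.
Proof.
move=> r0 h; apply/ler_addgt0Pr => e e0; apply/ltW/ball_nv; split.
  by rewrite -ofR0 ofR_lt; lra.
move=> i j; rewrite mxE; apply/ball_nv; rewrite nvC (ord1 i).
by have := h j; lra.
Qed.

Lemma nv_delta j : nv (delta_mx 0 j : W) <= 1.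
Proof.
apply: nv_row => // i; rewrite mxE eqxx /=; case: (i == j); rewrite ?nc0 ?nc1 //.
Qed.

Lemma nv_pair (U V : normedModType C) (x : U) (y : V) (r : R) :
  (nv ((x, y) : (U * V)%type) <= r) <-> (nv x <= r /\ nv y <= r).
Proof.
have lt (s : R) : (nv ((x, y) : (U * V)%type) < s) <-> (nv x < s /\ nv y < s).
  by rewrite -!ball_nv; split => -[].
split=> [h|[h1 h2]]; last first.
  apply/ler_addgt0Pr => e e0; apply/ltW/lt; split; lra.
have h' (e : R) : 0 < e -> nv x < r + e /\ nv y < r + e by move=> e0; apply/lt; lra.
by split; apply/ler_addgt0Pr => e /h'[] /ltW h1 /ltW h2.
Qed.

(** Balls are contained in products of compact squares of the complex plane. *)
Lemma continuous_bounded (G : W * W -> C) : continuous G ->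
  forall r : R, exists M : R, forall p, nv p <= r -> nc (G p) <= M.
Proof.
move=> cG r.
pose A : set W := [set v : W | forall i, square r (v ord0 i)].
have cA : compact A by apply: (@rV_compact C n (fun=> square r)) => i; exact: square_compact.
have cI : compact ((fun p => nc (G p)) @` (A `*` A)).
  apply: continuous_compact; last exact: compact_setX.
  apply: continuous_subspaceT => p; apply: continuous_comp; first exact: cG.
  exact: nc_continuous.
have [M [_ hM]] := compact_bounded cI.
exists (M + 1) => -[x y] /nv_pair[hx hy].
have : `|nc (G (x, y))| <= M + 1.
  apply: hM; first by rewrite ltrDl.
  exists (x, y) => //; split => /= i; apply: square_mem.
    exact: le_trans (nv_coord x i) hx.
  exact: le_trans (nv_coord y i) hy.
by apply: le_trans; exact: ler_norm.
Qed.

Lemma differentiable_entire (G : W * W -> C) : (forall p, differentiable G p) -> entire G.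
Proof.
move=> hG; split; last by move=> p v; exact: diff_derivable.
by apply: continuous_bounded => p; exact: differentiable_continuous (hG p).
Qed.

End Bounded.

(** * Conjugation *)

Section Conjugation.
Variable R : realType.
Local Notation C := (Cx R).

Lemma cdiff_conj (u : C -> C) (d : C) : cdiff u 0 d ->
  cdiff (fun t => Num.conj (u (Num.conj t))) 0 (Num.conj d).
Proof.
move=> hu e e0; have [t t0 ht] := hu e e0; exists t => // h hh.
have := ht (Num.conj h); rewrite nc_conj => /(_ hh).
by rewrite !add0r conjC0 -nc_conj !rmorphB rmorphM /= conjCK.
Qed.

Lemma conj_div_nat (x : C) k : Num.conj (x / k%:R) = Num.conj x / k%:R.
Proof. by rewrite rmorphM fmorphV rmorph_nat. Qed.

Lemma cdiff_sum (m : nat) (u : 'I_m -> C -> C) (d : 'I_m -> C) z :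
  (forall i, cdiff (u i) z (d i)) ->
  cdiff (fun t => \sum_i u i t) z (\sum_i d i).
Proof.
elim: m u d => [|m ih] u d h.
  rewrite big_ord0; apply: cdiff_ext (cdiff_cst 0 z) => t; by rewrite big_ord0.
rewrite big_ord_recl.
apply: cdiff_ext (cdiffD (h ord0) (ih (fun i => u (lift ord0 i)) _ (fun i => h (lift ord0 i)))) => t.
by rewrite big_ord_recl.
Qed.

Variable n : nat.
Local Notation W := 'rV[C]_n.

Lemma conj_vecD (z v : W) (t : C) :
  conj_vec (z + t *: v) = conj_vec z + Num.conj t *: conj_vec v.
Proof. by apply/rowP => i; rewrite !mxE rmorphD rmorphM. Qed.

Lemma conj_vecK : involutive (@conj_vec R n).
Proof. by move=> z; apply/rowP => i; rewrite !mxE conjCK. Qed.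

Lemma conj_vec0 : conj_vec (0 : W) = 0.
Proof. by apply/rowP => i; rewrite !mxE conjC0. Qed.

Lemma conj_vec_delta j : conj_vec (delta_mx 0 j : W) = delta_mx 0 j.
Proof. by apply/rowP => i; rewrite !mxE conjC_nat. Qed.

Lemma nv_conj_vec (w : W) : nv (conj_vec w) <= nv w.
Proof.
apply: nv_row; first exact: nv_ge0.
by move=> j; rewrite mxE nc_conj nv_coord.
Qed.

End Conjugation.

(** * Partial derivatives of a function of two vectors *)

Section Blocks.
Variables (R : realType) (n : nat).
Local Notation C := (Cx R).
Local Notation W := 'rV[C]_n.
Local Notation V2 := (W * W)%type.
Implicit Types (G : W -> W -> C) (a b : multi_index n) (s : seq 'I_n).

(** The uncurried function, on which the theory in one vector variable applies. *)
Definition joint G (p : V2) : C := G p.1 p.2.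
Definition dir1 j : V2 := (delta_mx 0 j, 0).
Definition dir2 j : V2 := (0, delta_mx 0 j).
Definition crd1 j (p : V2) : C := p.1 0 j.
Definition crd2 j (p : V2) : C := p.2 0 j.

Lemma crd1D i (p v : V2) (t : C) : crd1 i (p + t *: v) = crd1 i p + t * crd1 i v.
Proof. by rewrite /crd1 /= !mxE. Qed.
Lemma crd2D i (p v : V2) (t : C) : crd2 i (p + t *: v) = crd2 i p + t * crd2 i v.
Proof. by rewrite /crd2 /= !mxE. Qed.
Lemma crd1_dir1 i j : crd1 i (dir1 j) = (i == j)%:R.
Proof. by rewrite /crd1 /= mxE. Qed.
Lemma crd2_dir2 i j : crd2 i (dir2 j) = (i == j)%:R.
Proof. by rewrite /crd2 /= mxE. Qed.
Lemma crd1_bound i (p : V2) : nc (crd1 i p) <= nv p.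
Proof. by case: p => x y; have [+ _] := (nv_pair x y _).1 (lexx _); apply: le_trans; exact: nv_coord. Qed.
Lemma crd2_bound i (p : V2) : nc (crd2 i p) <= nv p.
Proof. by case: p => x y; have [_ +] := (nv_pair x y _).1 (lexx _); apply: le_trans; exact: nv_coord. Qed.
Lemma nv_zero (U : normedModType C) : nv (0 : U) = 0.
Proof. by rewrite -(scale0r 0) nvZ nc0 mul0r. Qed.
Lemma dir1_bound i : nv (dir1 i) <= 1.
Proof. by apply/nv_pair; rewrite nv_delta nv_zero. Qed.
Lemma dir2_bound i : nv (dir2 i) <= 1.
Proof. by apply/nv_pair; rewrite nv_delta nv_zero. Qed.

Lemma partial1_cdiff j G z w : entire (joint G) ->
  cdiff (fun t => G (z + t *: delta_mx 0 j) w) 0 (dirD (dir1 j) (joint G) (z, w)).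
Proof.
move=> hG; have := entire_line (z, w) (dir1 j) 0 hG; rewrite scale0r addr0.
by apply: cdiff_ext => t; rewrite /joint /= scaler0 addr0.
Qed.

Lemma partial2_cdiff j G z w : entire (joint G) ->
  cdiff (fun t => G z (w + t *: delta_mx 0 j)) 0 (dirD (dir2 j) (joint G) (z, w)).
Proof.
move=> hG; have := entire_line (z, w) (dir2 j) 0 hG; rewrite scale0r addr0.
by apply: cdiff_ext => t; rewrite /joint /= scaler0 addr0.
Qed.

Lemma partial1_eq j G z w d : cdiff (fun t => G (z + t *: delta_mx 0 j) w) 0 d ->
  partial1 j G z w = d.
Proof. exact: (@derive_cdiff _ _ (fun x : W => G x w) z (delta_mx 0 j) d). Qed.

Lemma partial2_eq j G z w d : cdiff (fun t => G z (w + t *: delta_mx 0 j)) 0 d ->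
  partial2 j G z w = d.
Proof. exact: (@derive_cdiff _ _ (fun y : W => G z y) w (delta_mx 0 j) d). Qed.

Lemma joint_partial1 j G : entire (joint G) -> joint (partial1 j G) = dirD (dir1 j) (joint G).
Proof.
by move=> hG; apply/funext => -[z w]; apply: partial1_eq; exact: partial1_cdiff.
Qed.

Lemma joint_partial2 j G : entire (joint G) -> joint (partial2 j G) = dirD (dir2 j) (joint G).
Proof.
by move=> hG; apply/funext => -[z w]; apply: partial2_eq; exact: partial2_cdiff.
Qed.

(** The iterated partial derivatives of the Taylor coefficients, for an arbitrary
    list of coordinates so that induction applies. *)
Definition partials1 s a G := foldr (fun j H => iter (a j) (partial1 j) H) G s.
Definition partials2 s a G := foldr (fun j H => iter (a j) (partial2 j) H) G s.

Lemma joint_partials1 s a G : entire (joint G) -> joint (partials1 s a G) = multiD dir1 s a (joint G).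
Proof.
move=> hG; elim: s => [//|j s ih] /=.
have hn : entire (joint (partials1 s a G)) by rewrite ih; exact: (entire_multiD dir1 s a hG).
rewrite -ih; elim: (a j) => [//|c ihc]; rewrite /dir_iter !iterS -/(dir_iter dir1 j c _) -ihc.
by apply: joint_partial1; rewrite ihc; exact: (entire_dir_iter dir1 j c hn).
Qed.

Lemma joint_partials2 s a G : entire (joint G) -> joint (partials2 s a G) = multiD dir2 s a (joint G).
Proof.
move=> hG; elim: s => [//|j s ih] /=.
have hn : entire (joint (partials2 s a G)) by rewrite ih; exact: (entire_multiD dir2 s a hG).
rewrite -ih; elim: (a j) => [//|c ihc]; rewrite /dir_iter !iterS -/(dir_iter dir2 j c _) -ihc.
by apply: joint_partial2; rewrite ihc; exact: (entire_dir_iter dir2 j c hn).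
Qed.

Lemma entire_partials1 s a G : entire (joint G) -> entire (joint (partials1 s a G)).
Proof. by move=> hG; rewrite (joint_partials1 s a hG); exact: (entire_multiD dir1 s a hG). Qed.
Lemma entire_partials2 s a G : entire (joint G) -> entire (joint (partials2 s a G)).
Proof. by move=> hG; rewrite (joint_partials2 s a hG); exact: (entire_multiD dir2 s a hG). Qed.

Lemma multiD_comm (V : normedModType C) (e e' : 'I_n -> V) s s' a b (H : V -> C) :
  entire H -> multiD e s a (multiD e' s' b H) = multiD e' s' b (multiD e s a H).
Proof.
move=> hH; elim: s => [//|i s ih] /=; rewrite ih.
have hn : entire (multiD e s a H) by exact: (entire_multiD e s a hH).
elim: (a i) => [//|c ihc]; rewrite /dir_iter !iterS -/(dir_iter e i c _) ihc.
exact: (dirD_multiD e' (e i) s' b (entire_dir_iter e i c hn)).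
Qed.

(** Hermitian symmetry of R is invariance under this reflection. *)
Definition reflect_kernel G : W -> W -> C :=
  fun z w => Num.conj (G (conj_vec w) (conj_vec z)).

Lemma partial1_reflect j G : entire (joint G) ->
  partial1 j (reflect_kernel G) = reflect_kernel (partial2 j G).
Proof.
move=> hG; apply/funext => z; apply/funext => w; apply: partial1_eq.
rewrite /reflect_kernel -[partial2 j G _ _]/(joint (partial2 j G) (_, _)) (joint_partial2 j hG).
have := cdiff_conj (partial2_cdiff j (conj_vec w) (conj_vec z) hG).
by apply: cdiff_ext => t; rewrite conj_vecD conj_vec_delta.
Qed.

Lemma partial2_reflect j G : entire (joint G) ->
  partial2 j (reflect_kernel G) = reflect_kernel (partial1 j G).
Proof.
move=> hG; apply/funext => z; apply/funext => w; apply: partial2_eq.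
rewrite /reflect_kernel -[partial1 j G _ _]/(joint (partial1 j G) (_, _)) (joint_partial1 j hG).
have := cdiff_conj (partial1_cdiff j (conj_vec w) (conj_vec z) hG).
by apply: cdiff_ext => t; rewrite conj_vecD conj_vec_delta.
Qed.

Lemma entire_iter_partial1 j c G : entire (joint G) -> entire (joint (iter c (partial1 j) G)).
Proof.
move=> hG; elim: c => [|c ih]; first exact: hG.
by rewrite iterS (joint_partial1 j ih); exact: (entire_derive (dir1 j) ih).
Qed.

Lemma entire_iter_partial2 j c G : entire (joint G) -> entire (joint (iter c (partial2 j) G)).
Proof.
move=> hG; elim: c => [|c ih]; first exact: hG.
by rewrite iterS (joint_partial2 j ih); exact: (entire_derive (dir2 j) ih).
Qed.

Lemma partials1_reflect s a G : entire (joint G) ->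
  partials1 s a (reflect_kernel G) = reflect_kernel (partials2 s a G).
Proof.
move=> hG; elim: s => [//|j s ih] /=; rewrite ih.
have hn := entire_partials2 s a hG.
elim: (a j) => [|c ihc]; first exact: erefl.
exact: (eq_trans (congr1 (partial1 j) ihc)
  (partial1_reflect j (entire_iter_partial2 j c hn))).
Qed.

Lemma partials2_reflect s a G : entire (joint G) ->
  partials2 s a (reflect_kernel G) = reflect_kernel (partials1 s a G).
Proof.
move=> hG; elim: s => [//|j s ih] /=; rewrite ih.
have hn := entire_partials1 s a hG.
elim: (a j) => [|c ihc]; first exact: erefl.
exact: (eq_trans (congr1 (partial2 j) ihc)
  (partial2_reflect j (entire_iter_partial1 j c hn))).
Qed.

Lemma taylor_coefE G a b : taylor_coef G a b =
  joint (partials1 (enum 'I_n) a (partials2 (enum 'I_n) b G)) 0 / (mfact a * mfact b)%N%:R.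
Proof. by []. Qed.

Lemma partials_comm s s' a b G : entire (joint G) ->
  joint (partials2 s a (partials1 s' b G)) = joint (partials1 s' b (partials2 s a G)).
Proof.
move=> hG; apply: (eq_trans (joint_partials2 s a (entire_partials1 s' b hG))).
apply: (eq_trans (congr1 (multiD dir2 s a) (joint_partials1 s' b hG))).
apply: (eq_trans (multiD_comm dir2 dir1 s s' a b hG)).
apply: (eq_trans (congr1 (multiD dir1 s' b) (esym (joint_partials2 s a hG)))).
exact: (esym (joint_partials1 s' b (entire_partials2 s a hG))).
Qed.

(** The reflection exchanges the derivatives in the two variables, which commute. *)
Lemma taylor_coef_herm G a b : entire (joint G) -> reflect_kernel G = G ->
  taylor_coef G a b = Num.conj (taylor_coef G b a).
Proof.
move=> hG rG; rewrite !taylor_coefE conj_div_nat mulnC.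
congr (_ / _).
have -> : joint (partials1 (enum 'I_n) a (partials2 (enum 'I_n) b G)) 0 =
  Num.conj (joint (partials2 (enum 'I_n) a (partials1 (enum 'I_n) b G)) 0).
  rewrite -{1}rG (partials2_reflect _ b hG) (partials1_reflect _ a (entire_partials1 _ b hG)).
  by rewrite /joint /reflect_kernel /= conj_vec0.
exact: (congr1 (fun H => Num.conj (H 0)) (partials_comm (enum 'I_n) (enum 'I_n) a b hG)).
Qed.

(** The kernel is written as a function holomorphic in both variables, whence the
    two conjugations. *)
Definition rank_kernel m (f g : 'I_m -> W -> C) : W -> W -> C :=
  fun z w => \sum_i f i z * Num.conj (g i (conj_vec w)).

Definition unit_row j : W := delta_mx 0 j.

Lemma partial1_rank m (f g : 'I_m -> W -> C) j : (forall i, entire (f i)) ->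
  partial1 j (rank_kernel f g) = rank_kernel (fun i => dirD (unit_row j) (f i)) g.
Proof.
move=> hf; apply/funext => z; apply/funext => w; apply: partial1_eq.
apply: cdiff_sum => i.
have h := entire_line z (unit_row j) 0 (hf i); rewrite scale0r addr0 in h.
have := cdiffM h (cdiff_cst (Num.conj (g i (conj_vec w))) 0).
by rewrite mulr0 addr0.
Qed.

Lemma partial2_rank m (f g : 'I_m -> W -> C) j : (forall i, entire (g i)) ->
  partial2 j (rank_kernel f g) = rank_kernel f (fun i => dirD (unit_row j) (g i)).
Proof.
move=> hg; apply/funext => z; apply/funext => w; apply: partial2_eq.
apply: cdiff_sum => i; apply: cdiffZ.
have h := entire_line (conj_vec w) (unit_row j) 0 (hg i); rewrite scale0r addr0 in h.
apply: cdiff_ext (cdiff_conj h) => t.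
by rewrite conj_vecD conj_vec_delta.
Qed.

Lemma partials1_rank m (f g : 'I_m -> W -> C) s a : (forall i, entire (f i)) ->
  partials1 s a (rank_kernel f g) = rank_kernel (fun i => multiD unit_row s a (f i)) g.
Proof.
move=> hf; elim: s => [//|j s ih] /=; rewrite ih.
have hn i : entire (multiD unit_row s a (f i)) by exact: (entire_multiD unit_row s a (hf i)).
elim: (a j) => [|c ihc]; first exact: erefl.
exact: (eq_trans (congr1 (partial1 j) ihc)
  (partial1_rank _ j (fun i => entire_dir_iter unit_row j c (hn i)))).
Qed.

Lemma partials2_rank m (f g : 'I_m -> W -> C) s a : (forall i, entire (g i)) ->
  partials2 s a (rank_kernel f g) = rank_kernel f (fun i => multiD unit_row s a (g i)).
Proof.
move=> hf; elim: s => [//|j s ih] /=; rewrite ih.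
have hn i : entire (multiD unit_row s a (g i)) by exact: (entire_multiD unit_row s a (hf i)).
elim: (a j) => [|c ihc]; first exact: erefl.
exact: (eq_trans (congr1 (partial2 j) ihc)
  (partial2_rank _ j (fun i => entire_dir_iter unit_row j c (hn i)))).
Qed.

(** The matrix of Taylor coefficients is the Gram matrix of the Taylor coefficients
    of the functions [f i]. *)
Lemma num_neg_eigen_rank p (f : 'I_p -> W -> C) m (s : 'I_m -> multi_index n) :
  (forall i, entire (f i)) ->
  num_neg_eigen (\matrix_(i < m, j < m) taylor_coef (rank_kernel f f) (s i) (s j)) = 0%N.
Proof.
move=> hf.
pose X := \matrix_(r < m, i < p) (multiD unit_row (enum 'I_n) (s r) (f i) 0 / (mfact (s r))%:R).
apply: (@num_neg_eigen_psd _ _ _ _ X); apply/matrixP => r q; rewrite !mxE taylor_coefE.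
rewrite (partials2_rank f _ (s q) hf) (partials1_rank _ _ (s r) hf) /joint /rank_kernel conj_vec0 mulr_suml.
apply: eq_bigr => i _; rewrite !mxE conj_div_nat natrM invfM.
by rewrite mulrACA.
Qed.

End Blocks.

(** * From measures to Taylor coefficients *)

Section Transfer.
Variables (R : realType) (n : nat).
Local Notation C := (Cx R).
Local Notation W := 'rV[C]_n.
Local Notation V2 := (W * W)%type.
Implicit Types (F : W -> W -> C) (a b : multi_index n).
Let E := enum 'I_n.

Local Notation "M ^t*" := (map_mx Num.conj (trmx M)) (at level 30).

Lemma multiD_sum (V : normedModType C) (e : 'I_n -> V) s a (K : Type) (r : seq K)
    (m : K -> V -> C) (H : K -> V -> C) (P : V -> V) :
  (forall k, entire (m k)) -> (forall k, entire (H k)) ->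
  (forall G, entire G -> entire (fun p => G (P p))) ->
  (forall k j p t, m k (p + t *: e j) = m k p) ->
  (forall j p t, P (p + t *: e j) = P p + t *: e j) ->
  multiD e s a (fun q => \sum_(k <- r) m k q * H k (P q)) =
  (fun q => \sum_(k <- r) m k q * multiD e s a (H k) (P q)).
Proof.
move=> hm hH hP me Pe; elim: s => [//|j s ih] /=; rewrite ih.
exact: (iter_dirD_sum (a j) r hm (fun k => entire_multiD e s a (hH k)) hP
  (fun k => me k j) (Pe j)).
Qed.

Lemma slices_ortho (V : normedModType C) (e : 'I_n -> V) (l : 'I_n -> V -> C) s p v (t : C) :
  (forall i p v t, l i (p + t *: v) = l i p + t * l i v) -> (forall i, l i v = 0) ->
  slices e l s (p + t *: v) = slices e l s p + t *: v.
Proof.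
move=> lD lv; elim: s p => [//|i s ih] p /=; rewrite -ih; congr slices.
by rewrite /slice lD lv mulr0 addr0 addrAC.
Qed.

Definition trunc F N : V2 -> C :=
  taylor_ops (@dir1 R n) (@crd1 R n) E N (taylor_ops (@dir2 R n) (@crd2 R n) E N (joint F)).

Definition monomial a (z : W) : C := \prod_i z 0 i ^+ a i.

Lemma taylor_monomialE (l : 'I_n -> V2 -> C) a p (z : W) : (forall i, l i p = z 0 i) ->
  taylor_monomial l E a p = monomial a z / (mfact a)%:R.
Proof.
move=> hl; rewrite /taylor_monomial /E big_enum /= /monomial /mfact natr_prod -prodf_div.
by apply: eq_bigr => i _; rewrite hl.
Qed.

Lemma crd2_dir1 i j : crd2 i (@dir1 R n j) = 0.
Proof. by rewrite /crd2 /= mxE. Qed.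

Lemma slices1_2 s (p : V2) : (slices (@dir1 R n) (@crd1 R n) s p).2 = p.2.
Proof.
by elim: s p => [//|i s ih] p /=; rewrite ih /slice /= scaler0 addr0.
Qed.

Lemma slices_all (p : V2) :
  slices (@dir2 R n) (@crd2 R n) E (slices (@dir1 R n) (@crd1 R n) E p) = 0.
Proof.
have h2 s (q : V2) : (slices (@dir2 R n) (@crd2 R n) s q).1 = q.1.
  by elim: s q => [//|i s ih] q /=; rewrite ih /slice /= scaler0 addr0.
apply/eqP; rewrite -pair_eqE /pair_eq /=; apply/andP; split; apply/eqP/rowP => i; rewrite mxE.
  rewrite h2.
  have := l_slices (@crd1D R n) (@crd1_dir1 R n) E i p.
  by rewrite mem_enum.
have := l_slices (@crd2D R n) (@crd2_dir2 R n) E i (slices (@dir1 R n) (@crd1 R n) E p).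
by rewrite mem_enum.
Qed.

Lemma trunc_sum F N z w : entire (joint F) -> trunc F N (z, w) =
  \sum_(a <- multi_indices E N) \sum_(b <- multi_indices E N) monomial a z * monomial b w * taylor_coef F a b.
Proof.
move=> hF; have uE : uniq E by exact: enum_uniq.
have nT := entire_taylor_ops (@crd2D R n) (@crd2_bound R n) (@dir2_bound R n) E N hF.
rewrite /trunc (taylor_ops_sum (@crd1D R n) (@crd1_dir1 R n) (@crd1_bound R n)
  (@dir1_bound R n) N _ uE nT).
have eT : taylor_ops (@dir2 R n) (@crd2 R n) E N (joint F) = fun q =>
    \sum_(b <- multi_indices E N) taylor_monomial (@crd2 R n) E b q *
      multiD (@dir2 R n) E b (joint F) (slices (@dir2 R n) (@crd2 R n) E q).
  by apply/funext => q; exact: (taylor_ops_sum (@crd2D R n) (@crd2_dir2 R n)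
    (@crd2_bound R n) (@dir2_bound R n) N q uE hF).
apply: eq_bigr => a _; rewrite eT.
rewrite (@multiD_sum _ (@dir1 R n) E a _ (multi_indices E N) (taylor_monomial (@crd2 R n) E)
  (fun b => multiD (@dir2 R n) E b (joint F)) (slices (@dir2 R n) (@crd2 R n) E));
  first last.
- by move=> j p t; apply: slices_ortho; [exact: crd2D | move=> i; exact: crd2_dir1].
- move=> b j p t; apply: eq_bigr => i _.
  by rewrite (@crd2D R n) crd2_dir1 mulr0 addr0.
- move=> G hG; exact: (entire_slices (@crd2D R n) (@crd2_bound R n) (@dir2_bound R n) E hG).
- by move=> b; exact: (entire_multiD (@dir2 R n) E b hF).
- by move=> b; exact: (entire_taylor_monomial (@crd2D R n) (@crd2_bound R n) E b).
rewrite mulr_sumr; apply: eq_bigr => b _.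
rewrite slices_all (@taylor_monomialE _ a _ z) // (@taylor_monomialE _ b _ w); last first.
  by move=> i; rewrite /crd2 slices1_2.
have -> : multiD (@dir1 R n) E a (multiD (@dir2 R n) E b (joint F)) = joint (partials1 E a (partials2 E b F)).
  apply: (eq_trans (congr1 (multiD (@dir1 R n) E a) (esym (joint_partials2 E b hF)))).
  exact: (esym (joint_partials1 E a (entire_partials2 E b hF))).
rewrite taylor_coefE natrM invfM -/E.
move: (joint _ _) (monomial a z) (monomial b w) (_^-1) (_^-1) => x1 x2 x3 x4 x5; ring.
Qed.

Lemma trunc_close F (rho ep : R) : 0 < rho -> 0 < ep -> entire (joint F) ->
  exists N, forall p, nv p <= rho -> nc (trunc F N p - joint F p) <= ep.
Proof.
move=> rho0 ep0 hF.
have k0 : 0 < (18 : R) ^+ size E by rewrite exprn_gt0.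
have k1 : 1 <= (18 : R) ^+ size E by rewrite exprn_ege1 // ler1n.
pose r2 := 18 ^+ size E * rho.
have r20 : 0 < r2 by rewrite mulr_gt0.
have [M M0 hM] := entire_bound hF (18 ^+ size E * r2).
have e2 : 0 < Num.min 1 (ep / 2) by rewrite lt_min ltr01 divr_gt0.
have m1 : Num.min 1 (ep / 2) <= 1 by rewrite ge_min lexx.
have m2 : Num.min 1 (ep / 2) <= ep / 2 by rewrite ge_min lexx orbT.
have [N2 h2] := taylor_ops_close (@crd2D R n) (@crd2_bound R n) (@dir2_bound R n)
  E r20 M0 e2.
have [N1 h1] := taylor_ops_close (@crd1D R n) (@crd1_bound R n) (@dir1_bound R n)
  E rho0 (addr_ge0 M0 ler01) (divr_gt0 ep0 (ltr0Sn R 1)).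
pose N := maxn N1 N2; exists N => p hp.
have h2' q : nv q <= r2 -> nc (taylor_ops (@dir2 R n) (@crd2 R n) E N (joint F) q - joint F q)
    <= Num.min 1 (ep / 2).
  exact: (h2 N (leq_maxr _ _) _ hF hM).
have hb q : nv q <= r2 -> nc (taylor_ops (@dir2 R n) (@crd2 R n) E N (joint F) q) <= M + 1.
  move=> hq; apply: le_trans (nc_dist _ (joint F q)) _; rewrite lerD //.
    by apply: hM; apply: le_trans hq _; rewrite ler_peMl // ltW.
  exact: le_trans (h2' q hq) m1.
have hp' : nv p <= r2 by apply: le_trans hp _; rewrite ler_peMl // ltW.
have b2 := le_trans (h2' p hp') m2.
have b1 := h1 N (leq_maxl _ _) _
  (entire_taylor_ops (@crd2D R n) (@crd2_bound R n) (@dir2_bound R n) E N hF) hb p hp.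
apply: le_trans (nc_tri _ (taylor_ops (@dir2 R n) (@crd2 R n) E N (joint F) p) _) _.
by rewrite [leRHS]splitr; exact: lerD b1 b2.
Qed.

Definition kernel_of F : W -> W -> C := fun z w => F z (conj_vec w).

Lemma le_sum_mem (T : eqType) (s : seq T) (f : T -> R) x :
  (forall y, 0 <= f y) -> x \in s -> f x <= \sum_(y <- s) f y.
Proof.
by move=> f0 xs; rewrite (big_rem x) //= lerDl sumr_ge0.
Qed.

Lemma form_close (K1 K2 : W -> W -> C) (la mu : seq (C * W)) (ep : R) :
  (forall p q, p \in la -> q \in mu -> nc (K1 p.2 q.2 - K2 p.2 q.2) <= ep) ->
  nc (kform K1 la mu - kform K2 la mu) <=
    (\sum_(p <- la) nc p.1) * (\sum_(q <- mu) nc q.1) * ep.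
Proof.
move=> h; rewrite /kform -sumrB; apply: le_trans (nc_sum _ _ _) _.
rewrite -mulrA mulr_suml big_seq [leRHS]big_seq; apply: ler_sum => p hp.
rewrite -sumrB; apply: le_trans (nc_sum _ _ _) _.
rewrite mulr_suml mulr_sumr big_seq [leRHS]big_seq; apply: ler_sum => q hq.
by rewrite -mulrBr !ncM nc_conj -mulrA ler_wpM2l ?nc_ge0 // ler_wpM2l ?nc_ge0 // h.
Qed.

Lemma form_trunc F N (la mu : seq (C * W)) : entire (joint F) ->
  kform (fun z w => trunc F N (z, conj_vec w)) la mu =
  \sum_(a <- multi_indices E N) \sum_(b <- multi_indices E N)
    (\sum_(p <- la) p.1 * monomial a p.2) * taylor_coef F a b *
    Num.conj (\sum_(q <- mu) q.1 * monomial b q.2).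
Proof.
move=> hF; pose f p a b q : C :=
  p.1 * monomial a p.2 * taylor_coef F a b * Num.conj (q.1 * monomial b q.2).
transitivity (\sum_(p <- la) \sum_(q <- mu) \sum_(a <- multi_indices E N) \sum_(b <- multi_indices E N) f p a b q).
  apply: eq_bigr => p _; apply: eq_bigr => q _; rewrite trunc_sum // mulr_sumr.
  apply: eq_bigr => a _; rewrite mulr_sumr; apply: eq_bigr => b _.
  have -> : monomial b (conj_vec q.2) = Num.conj (monomial b q.2).
    by rewrite /monomial rmorph_prod; apply: eq_bigr => i _; rewrite mxE rmorphXn.
  by rewrite /f rmorphM /=; ring.
under eq_bigr => p _ do rewrite exchange_big /=.
rewrite exchange_big; apply: eq_bigr => a _ /=.
under eq_bigr => p _ do rewrite exchange_big /=.
rewrite exchange_big; apply: eq_bigr => b _ /=.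
rewrite rmorph_sum !mulr_suml; apply: eq_bigr => p _.
by rewrite mulr_sumr.
Qed.

(** On an orthonormal family of measures, the form of a close Taylor polynomial has
    a matrix close to the identity, hence positive definite. That matrix is a
    compression X A X^* of the matrix A of the Taylor coefficients, where X lists
    the moments of the measures. *)
Theorem N_plus_ge F m : entire (joint F) -> reflect_kernel F = F ->
  positive_squares m (kernel_of F) -> (m%:R%:E <= N_plus F)%E.
Proof.
move=> hF rF [L hL].
pose rho : R := 1 + \sum_i \sum_(p <- L i) nv p.2.
have rho0 : 0 < rho.
  rewrite ltr_pwDl // sumr_ge0 // => i _; rewrite sumr_ge0 // => p _; exact: nv_ge0.
have hrho i p : p \in L i -> nv p.2 <= rho.
  move=> hp; rewrite /rho (bigD1 i) //= -[nv p.2]add0r lerD //.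
  rewrite -[nv p.2]addr0 lerD //.
    by apply: (@le_sum_mem _ (L i) (fun p => nv p.2)) => // y; exact: nv_ge0.
  by rewrite sumr_ge0 // => j _; rewrite sumr_ge0 // => q _; exact: nv_ge0.
pose B : R := 1 + \sum_i \sum_(p <- L i) nc p.1.
have hB i : \sum_(p <- L i) nc p.1 <= B.
  rewrite /B (bigD1 i) //= addrCA lerDl addr_ge0 // sumr_ge0 // => j _.
  by rewrite sumr_ge0 // => q _; exact: nc_ge0.
have B0 : 0 < B.
  by rewrite ltr_pwDl // sumr_ge0 // => i _; rewrite sumr_ge0 // => p _; exact: nc_ge0.
pose ep := (2 * m.+1%:R)^-1 / (B * B) : R.
have ep0 : 0 < ep by rewrite divr_gt0 ?mulr_gt0 // invr_gt0 mulr_gt0.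
have [N hN] := trunc_close rho0 ep0 hF.
pose s := multi_indices E N; pose c i j := taylor_coef F (tnth (in_tuple s) i) (tnth (in_tuple s) j).
pose A := \matrix_(i < size s, j < size s) c i j.
pose X := \matrix_(i < m, k < size s) \sum_(p <- L i) p.1 * monomial (tnth (in_tuple s) k) p.2.
have hA : A^t* = A.
  by apply/matrixP => i j; rewrite !mxE /c [RHS](taylor_coef_herm _ _ hF rF).
have hXAX i j : (X *m A *m X^t*) i j =
    kform (fun z w => trunc F N (z, conj_vec w)) (L i) (L j).
  rewrite form_trunc // exchange_big /= -/s (big_tnth _ _ s) mxE.
  apply: eq_bigr => c1 _; rewrite (big_tnth _ _ s) !mxE mulr_suml.
  by apply: eq_bigr => c2 _; rewrite !mxE.
have hclose i j : nc ((X *m A *m X^t*) i j - (i == j)%:R) <= (2 * m.+1%:R)^-1.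
  rewrite hXAX -hL; apply: le_trans (form_close (ep := ep) _) _.
    move=> p q hp hq; have := hN (p.2, conj_vec q.2); rewrite /joint /=; apply.
    apply/nv_pair; split; first exact: hrho hp.
    exact: le_trans (nv_conj_vec _) (hrho _ _ hq).
  rewrite /ep mulrCA -[leRHS]mulr1; apply: ler_wpM2l.
    by rewrite invr_ge0 mulr_ge0.
  rewrite ler_pdivrMr ?mulr_gt0 // mul1r.
  by apply: ler_pM => //; rewrite sumr_ge0 // => p _; exact: nc_ge0.
have hpos : (m <= num_pos_eigen A)%N.
  apply: (@num_pos_eigen_ge _ _ _ A X hA) => y y0.
  have -> : y *m X *m A *m (y *m X)^t* = y *m (X *m A *m X^t*) *m y^t*.
    by rewrite trmx_mul map_mxM !mulmxA.
  exact: near_identity_posdef hclose y y0.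
apply: (@le_trans _ _ ((num_pos_eigen A)%:R%:E)); first by rewrite lee_fin ler_nat.
apply: ereal_sup_ubound; exists (size s), (tnth (in_tuple s)); split => //.
move=> i j; rewrite !(tnth_nth [ffun=> 0%N]) /= => /eqP.
by rewrite nth_uniq ?multi_indices_uniq ?enum_uniq // => /eqP/val_inj.
Qed.

End Transfer.

(** * Kernels of Hermitian symmetric functions *)

Section Main.
Variables (R : realType) (n : nat).
Local Notation C := (Cx R).
Local Notation W := 'rV[C]_n.
Implicit Types (F : W -> W -> C).

Lemma psd_class_upto k F : psd_class k F -> psd_upto k (kernel_of F).
Proof.
move=> [_ hP] la hla; pose d : C * W := (0, 0).
have := hP (fun i => (nth d la i).2) (fun i => (nth d la i).1).
suff -> : \sum_(i < k) \sum_(j < k) F (nth d la i).2 (conj_vec (nth d la j).2)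
   * (nth d la i).1 * Num.conj (nth d la j).1 = kform (kernel_of F) la la by [].
have widen (f : C * W -> C) : f d = 0 -> \sum_(i < k) f (nth d la i) = \sum_(p <- la) f p.
  move=> fd; rewrite (big_nth d) (big_mkord xpredT).
  rewrite (big_ord_widen k (fun i => f (nth d la i)) hla) [LHS](bigID (fun i : 'I_k => (i < size la)%N)) /=.
  by rewrite [X in _ + X]big1 ?addr0 // => i; rewrite -leqNgt => h; rewrite nth_default.
apply: (eq_trans _ (widen (fun p => \sum_(q <- la) p.1 * Num.conj q.1 * kernel_of F p.2 q.2) _)); last first.
  by apply: big1 => q _; rewrite !mul0r.
apply: eq_bigr => i _.
apply: (eq_trans _ (widen (fun q => (nth d la i).1 * Num.conj q.1 * kernel_of F (nth d la i).2 q.2) _)); last first.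
  by rewrite conjC0 mulr0 mul0r.
by apply: eq_bigr => j _; rewrite /kernel_of -mulrA mulrC.
Qed.

Lemma entire_kernel F : entire (joint F) -> forall w, entire ((kernel_of F)^~ w).
Proof.
move=> hF w; apply: (@entire_comp _ _ _ (joint F) (fun z : W => (z, conj_vec w))
  (fun v : W => (v, 0))) => //.
  by move=> p v t; apply/eqP; rewrite -pair_eqE /pair_eq /= scaler0 addr0 !eqxx.
move=> r; exists (Num.max r (nv (conj_vec w))) => p hp; apply/nv_pair.
by rewrite !le_max hp lexx orbT.
Qed.

(** The empty principal submatrix makes the supremum 0 and not -oo. *)
Lemma N_minus_eq0 F : (exists p (f : 'I_p -> W -> C), (forall i, entire (f i)) /\
    forall z w, kernel_of F z w = \sum_(i < p) f i z * Num.conj (f i w)) ->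
  N_minus F = 0%E.
Proof.
move=> [p [f [nf hf]]].
have -> : F = rank_kernel f f.
  apply/funext => z; apply/funext => w.
  by rewrite /rank_kernel -hf /kernel_of conj_vecK.
rewrite /N_minus /num_neg; set S := (X in ereal_sup X).
have -> : S = [set 0%E].
  apply/seteqP; split => x /=.
    by move=> [m [s [_ ->]]]; rewrite num_neg_eigen_rank.
  move=> ->; exists 0%N, (fun=> [ffun=> 0%N]); split; first by move=> [].
  by rewrite num_neg_eigen_rank.
exact: ereal_sup1.
Qed.

End Main.

Unset Implicit Arguments.

Theorem theorem1 (R : realType) (n k : nat) (hn : (1 <= n)%N) (hk : (1 <= k)%N)
    (F : 'rV[Cx R]_n -> 'rV[Cx R]_n -> Cx R)
    (hF : hermitian_symmetric F) (hP : psd_class k F) :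
  N_minus F = 0%E \/ (k.+1%:R%:E <= N_plus F)%E.
Proof.
have [dF sF] := hF.
have nF : entire (joint F) by exact: differentiable_entire.
have hK : hermitian_kernel (kernel_of F) by exact: sF.
have rF : reflect_kernel F = F.
  apply/funext => z; apply/funext => w.
  by rewrite /reflect_kernel -sF conj_vecK.
have [h|h] := pselect (positive_squares k.+1 (kernel_of F)); [right|left].
  exact: N_plus_ge.
apply: N_minus_eq0; case: k hk hP h => // k _ hP h.
exact: finite_rank hK (entire_kernel nF) (psd_class_upto hP) h.
Qed.
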